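(* Let $\alpha>1$. Let $L_2(\mathbb{R},W_\alpha^2\,dx)$ denote the Hilbert space of (classes of) measurable functions $f:\mathbb{R}\to\mathbb{C}$ with $\|f\|^2:=\int_{\mathbb{R}}|f(x)|^2 e^{-2|x|^\alpha}\,dx<\infty$, where $W_\alpha(x)=\exp(-|x|^\alpha)$. Let $\Pi_n$ ($n\geq 0$) be the polynomials of degree at most $n$ and $\Pi_{-1}=\{0\}$, and let $d(f,\Pi_{n-1})$ denote the distance in $L_2(\mathbb{R},W_\alpha^2\,dx)$ from $f$ to $\Pi_{n-1}$. Let \[ L_2(\mathbb{R},W_\alpha^2\,dx)_{\mathrm{ra}}=\{f\in L_2(\mathbb{R},W_\alpha^2\,dx): \sup_{n\geq 0} n^k d(f,\Pi_{n-1})<\infty \text{ for all } k=0,1,2,\ldots\} \] (with $0^0=1$), equipped with the locally convex topology induced by the seminorms $q_k(f)=\sup_{n\geq 0} n^k d(f,\Pi_{n-1})$, $k=0,1,2,\ldots$. Let \[ C^\infty_{\alpha}=\{f\in C^\infty(\mathbb{R}): f^{(j)}\in L_2(\mathbb{R},W_\alpha^2\,dx) \text{ for } j=0,1,2,\ldots\}, \] equipped with the locally convex topology induced by the seminorms $q_{\alpha,j}(f)=\|f^{(j)}\|$ ($j=0,1,2,\ldots$). Let $(P_{\alpha,n})_{n\geq 0}$ be the real-valued orthonormal polynomial basis of $L_2(\mathbb{R},W_\alpha^2\,dx)$ with $\deg P_{\alpha,n}=n$, and $a_{\alpha,n}(f)=\int_{\mathbb{R}} f(x)P_{\alpha,n}(x)W_\alpha^2(x)\,dx$.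 Then: (i) $C^\infty_\alpha$ is a Fréchet space, and if $f_n\to f$ in $C^\infty_\alpha$, then $f_n^{(j)}\to f^{(j)}$ uniformly on compact subsets of $\mathbb{R}$ for all $j\geq 0$. (ii) $L_2(\mathbb{R},W_\alpha^2\,dx)_{\mathrm{ra}}\subset C^\infty_\alpha$ and the inclusion map is continuous; in particular, if $f_n\to f$ in $L_2(\mathbb{R},W_\alpha^2\,dx)_{\mathrm{ra}}$ then $f_n^{(j)}\to f^{(j)}$ uniformly on compact subsets of $\mathbb{R}$ for all $j\geq 0$. (iii) If $f\in L_2(\mathbb{R},W_\alpha^2\,dx)_{\mathrm{ra}}$, then $\sum_{n=0}^\infty a_{\alpha,n}(f)P_{\alpha,n}$ converges to $f$ in $L_2(\mathbb{R},W_\alpha^2\,dx)_{\mathrm{ra}}$, and consequently $\sum_{n=0}^\infty a_{\alpha,n}(f)P_{\alpha,n}^{(j)}$ converges uniformly to $f^{(j)}$ on compact subsets of $\mathbb{R}$ for all $j\geq 0$. (iv) If $\alpha=2$, then $L_2(\mathbb{R},W_2^2\,dx)_{\mathrm{ra}}=\{g e^{x^2}: g\in\mathcal{S}(\mathbb{R})\}$, and the resulting bijection $f\mapsto f e^{-x^2}$ between $L_2(\mathbb{R},W_2^2\,dx)_{\mathrm{ra}}$ and $\mathcal{S}(\mathbb{R})$ is a topological isomorphism.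
   Context: $\mathcal{S}(\mathbb{R})$ is the Schwartz space of rapidly decreasing smooth functions with its usual Fréchet topology. Elements of $L_2(\mathbb{R},W_\alpha^2\,dx)_{\mathrm{ra}}$ are identified with their (unique) smooth representatives in (ii). *)

(* Defs.v *)
(* Complex numbers are represented as pairs
   (real part, imaginary part) : R * R, since MathComp-Analysis has no
   normed/measurable structure on complex numbers. *)
From HB Require Import structures.
From mathcomp Require Import all_boot all_order all_algebra.
From mathcomp Require Import all_classical all_reals all_analysis.
Set Implicit Arguments. Unset Strict Implicit. Unset Printing Implicit Defensive.
Import Order.TTheory GRing.Theory Num.Theory.
Import numFieldNormedType.Exports.
Local Open Scope classical_set_scope.
Local Open Scope ring_scope.

Section Defs.
Context {R : realType}.
Local Notation mu := (@lebesgue_measure R).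

(* a complex-valued function on R: x |-> (Re f x, Im f x) *)
Definition cfun := R -> (R * R)%type.

Definition cabs2 (z : (R * R)%type) : R := z.1 ^+ 2 + z.2 ^+ 2.
Definition cabs (z : (R * R)%type) : R := Num.sqrt (cabs2 z).

Definition csub (f g : cfun) : cfun := fun x => (f x - g x).

Definition Wt (a x : R) : R := expR (- (`|x| `^ a)).

Definition wint2 (a : R) (f : cfun) : \bar R :=
  (\int[mu]_x (cabs2 (f x) * Wt a x ^+ 2)%:E)%E.

Definition cmeasurable (f : cfun) : Prop :=
  measurable_fun setT (fun x => (f x).1) /\ measurable_fun setT (fun x => (f x).2).

Definition inL2 (a : R) (f : cfun) : Prop := cmeasurable f /\ (wint2 a f < +oo)%E.

Definition wnorm (a : R) (f : cfun) : R := Num.sqrt (fine (wint2 a f)).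

(* the complex polynomial p + i q as a function *)
Definition cpoly (p q : {poly R}) : cfun := fun x => (p.[x], q.[x]).

(* d(f, Pi_{n-1}) : complex polynomials of degree <= n-1 (size <= n);
   for n = 0 this is Pi_{-1} = {0} *)
Definition distPi (a : R) (f : cfun) (n : nat) : R :=
  inf [set r | exists p q : {poly R},
          [/\ (size p <= n)%N, (size q <= n)%N & r = wnorm a (csub f (cpoly p q))]].

(* q_k(f) = sup_{n >= 0} n^k d(f, Pi_{n-1}) (extended real; 0^0 = 1) *)
Definition qraE (a : R) (k : nat) (f : cfun) : \bar R :=
  ereal_sup [set ((n%:R ^+ k) * distPi a f n)%:E | n in [set: nat]].
Definition qra (a : R) (k : nat) (f : cfun) : R := fine (qraE a k f).

Definition inLra (a : R) (f : cfun) : Prop :=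
  inL2 a f /\ forall k, (qraE a k f < +oo)%E.

Definition smooth (f : cfun) : Prop :=
  forall (j : nat) (x : R), derivable (derive1n j f) x 1.

Definition inCinf (a : R) (f : cfun) : Prop :=
  smooth f /\ forall j, inL2 a (derive1n j f).

Definition qC (a : R) (j : nat) (f : cfun) : R := wnorm a (derive1n j f).

Definition conv_in (q : nat -> cfun -> R) (fs : nat -> cfun) (f : cfun) : Prop :=
  forall k, (fun n => q k (csub (fs n) f)) @ \oo --> (0 : R).

Definition cauchy_in (q : nat -> cfun -> R) (fs : nat -> cfun) : Prop :=
  forall k (e : R), 0 < e -> exists N : nat, forall m n : nat,
    (N <= m)%N -> (N <= n)%N -> q k (csub (fs m) (fs n)) < e.

Definition ucc (gs : nat -> cfun) (g : cfun) : Prop :=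
  forall K : set R, compact K -> forall e : R, 0 < e ->
    exists N : nat, forall n : nat, (N <= n)%N -> forall x, K x -> cabs (gs n x - g x) < e.

Definition acoef (a : R) (P : {poly R}) (f : cfun) : (R * R)%type :=
  (fine (\int[mu]_x ((f x).1 * P.[x] * Wt a x ^+ 2)%:E)%E,
   fine (\int[mu]_x ((f x).2 * P.[x] * Wt a x ^+ 2)%:E)%E).

Definition schwartz (g : cfun) : Prop :=
  smooth g /\ forall m l : nat, exists M : R, forall x, `|x| ^+ m * cabs (derive1n l g x) <= M.
Definition pS (m l : nat) (g : cfun) : R :=
  sup [set `|x| ^+ m * cabs (derive1n l g x) | x in [set: R]].

End Defs.

(* Main.v *)
Require Import Defs.
From HB Require Import structures.
From mathcomp Require Import all_boot all_order all_algebra.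
From mathcomp Require Import all_classical all_reals all_analysis.
From mathcomp Require Import measurable_realfun ring lra zify.
Import Order.TTheory GRing.Theory Num.Theory.
Import numFieldNormedType.Exports.
Set Implicit Arguments. Unset Strict Implicit. Unset Printing Implicit Defensive.
Local Open Scope classical_set_scope.
Local Open Scope ring_scope.

(** A ladder argument for the weights [(1 - x^2)^k] on [[-1, 1]] bounds the derivatives of a
    polynomial at the centre of an interval by its L2 norm there, up to powers of the degree.
    Since [W] is nearly constant on intervals of length polynomially small in [n] around points
    [|c| <= 18 (n+1)^4], and since [W] kills polynomials of degree [n] beyond, one obtains
    [|c|^M |p^(j)(c)| W(c) <= C (n+1)^S ||p||] for [deg p <= n].  If [p_n] denotes the projection
    of [f] in [L2_ra] onto [Pi_(n-1)], then [p_(n+1) - p_n] is rapidly small in [L2], hence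
    rapidly small in all these weighted norms, so [p_n] converges in [C^infty_alpha]; orthonormal
    expansions are a special case.  Completeness of [C^infty_alpha] follows from a weighted Sobolev
    inequality and Fatou's lemma.

    For [alpha = 2], put [A = d/dx + 2x].  If [u] is Schwartz and orthogonal to
    [Pi_(n-1) e^(-x^2)], then [4 n ||u||^2 <= ||A u||^2]: solve [-v' + 2 x v = u] with [v] Schwartz,
    which is orthogonal to [Pi_(n-2) e^(-x^2)], and use [[A, A^*] = 4] together with
    induction on [n].  As [A] maps [e^(-x^2) p] to [e^(-x^2) p'], iterating this gap gives
    [d(f, Pi_(n-1)) = O(n^-k)] for all [k] without the completeness of the Hermite functions. *)

(** Rapid decay of [distPi] absorbs any fixed power of the degree and nothing larger. So constants
    and exponents may be wasteful, but no factor exponential in [n] may survive. For this reason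
    each derivative moves from the weight [w^k] to [w^(k+1)], with [w = 1 - x^2]: [w] vanishes at
    both ends, integration by parts leaves no boundary term, and values are read off at the centre,
    where [w = 1]. Far out, the crude factor [(13 m^4 X^2)^m] is huge, but [exp (- X)] beats it from
    [X = 18 m^4] on, because [18^2] exceeds [24 * 13]. In the Gaussian case, orthogonality to
    [e^(-x^2)] is exactly the solvability condition for a decaying solution of the first-order
    equation. Derivatives are carried as explicit sequences ([jet]), so that limits, products and
    solutions come with all their derivatives at once. *)

Definition hE := (hornerD, hornerN, hornerM, hornerZ, hornerX, hornerC, hornerXn, horner_exp).

Ltac nneg := repeat first [assumption | rewrite -expr2; exact: sqr_ge0 | exact: sqr_ge0 | exact: ler0n | exact: ler01 |
  exact: expR_ge0 | exact: normr_ge0 | apply: exprn_ge0 | apply: mulr_ge0 | apply: addr_ge0].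

(** * Polynomials on an interval *)

Section PolyIntegral.
Context {R : realType}.
Implicit Types p q u v F : {poly R}.

(** At index [0] the division by [0%:R] returns [0], so this is the antiderivative that vanishes at
    [0]. *)
Definition prim p : {poly R} := \poly_(i < (size p).+1) (p`_i.-1 / i%:R).

Lemma deriv_prim p : (prim p)^`() = p.
Proof.
apply/polyP => i; rewrite coef_deriv coef_poly ltnS /=.
case: ltnP => hi; first by rewrite -[LHS]mulr_natr divfK // pnatr_eq0.
by rewrite mul0rn nth_default.
Qed.

(** An algebraic integral, so that linearity and integration by parts become polynomial identities;
    [integral_poly] links it to Lebesgue measure. *)
Definition pint (c d : R) p : R := (prim p).[d] - (prim p).[c].

Lemma pint_deriv c d F : pint c d F^`() = F.[d] - F.[c].
Proof.
set D := prim F^`() - F.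
have : (size D <= 1)%N.
  have D0 : D^`() = 0 by rewrite derivB deriv_prim subrr.
  apply/leq_sizeP => -[//|j] _; have /polyP/(_ j) := D0.
  by rewrite coef_deriv coef0 => /eqP; rewrite mulrn_eq0 => /eqP.
move=> /size1_polyC DC; rewrite /pint.
have E : prim F^`() = F + D by rewrite /D; ring.
by rewrite E DC !hornerE; ring.
Qed.

Lemma pintD c d p q : pint c d (p + q) = pint c d p + pint c d q.
Proof.
by rewrite -{1}(deriv_prim p) -{1}(deriv_prim q) -derivD pint_deriv !hornerD /pint; ring.
Qed.

Lemma pintZ c d k p : pint c d (k *: p) = k * pint c d p.
Proof. by rewrite -{1}(deriv_prim p) -derivZ pint_deriv !hornerZ /pint; ring. Qed.

Lemma pintN c d p : pint c d (- p) = - pint c d p.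
Proof. by rewrite -scaleN1r pintZ mulN1r. Qed.

Lemma pintB c d p q : pint c d (p - q) = pint c d p - pint c d q.
Proof. by rewrite pintD pintN. Qed.

Lemma pint_chasles c d e p : pint c e p = pint c d p + pint d e p.
Proof. by rewrite /pint; ring. Qed.

Lemma integral_poly c d p : c < d ->
  (\int[@lebesgue_measure R]_(x in `[c, d]) (p.[x])%:E)%E = (pint c d p)%:E.
Proof.
move=> cd; rewrite (@continuous_FTC2 _ (horner p) (horner (prim p)) c d) //.
- by apply: continuous_subspaceT => x; exact: continuous_horner.
- split; first by move=> x _; exact: derivable_horner.
  + by apply: cvg_at_right_filter; exact: continuous_horner.
  + by apply: cvg_at_left_filter; exact: continuous_horner.
- by move=> x _; rewrite -derivE deriv_prim.
Qed.

Lemma pint_ge0 c d p : c <= d -> (forall x, c <= x <= d -> 0 <= p.[x]) ->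
  0 <= pint c d p.
Proof.
rewrite le_eqVlt => /orP[/eqP-> _|cd p0]; first by rewrite /pint subrr.
rewrite -lee_fin -integral_poly //; apply: integral_ge0 => x /=.
by rewrite in_itv /= lee_fin; exact: p0.
Qed.

Lemma le_pint c d p q : c <= d -> (forall x, c <= x <= d -> p.[x] <= q.[x]) ->
  pint c d p <= pint c d q.
Proof.
move=> cd pq; rewrite -subr_ge0 -pintB; apply: pint_ge0 => // x /pq.
by rewrite hornerD hornerN subr_ge0.
Qed.

Definition affine (c l : R) : {poly R} := l *: 'X + c%:P.

Lemma deriv_affine c l : (affine c l)^`() = l%:P.
Proof. by rewrite /affine derivD derivC derivZ derivX addr0 alg_polyC. Qed.

Lemma horner_affine c l x : (affine c l).[x] = c + l * x.
Proof. by rewrite /affine !hornerE addrC. Qed.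

Lemma pint_affine c l p :
  l * pint (-1) 1 (p \Po affine c l) = pint (c - l) (c + l) p.
Proof.
rewrite -pintZ -[p in LHS]deriv_prim.
have -> : l *: ((prim p)^`() \Po affine c l) = (prim p \Po affine c l)^`().
  by rewrite deriv_comp deriv_affine mulrC mul_polyC.
rewrite pint_deriv !horner_comp !horner_affine /pint.
by rewrite mulrN1 mulr1.
Qed.

Lemma derivn_affine c l p k :
  (p \Po affine c l)^`(k) = l ^+ k *: (p^`(k) \Po affine c l).
Proof.
elim: k => [|k IH]; first by rewrite !derivn0 expr0 scale1r.
rewrite !derivnS IH derivZ deriv_comp deriv_affine exprSr -scalerA.
by rewrite mulrC mul_polyC.
Qed.

End PolyIntegral.

(** * The ladder of weights [(1 - x^2)^k] and derivatives at the centre of an interval *)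

Section Ladder.
Context {R : realType}.
Implicit Types p q u v F : {poly R}.

Let w : {poly R} := 1 - 'X^2.

Definition gint k p : R := pint (-1) 1 (w ^+ k * p).

Let wge0 (x : R) : -1 <= x <= 1 -> 0 <= w.[x].
Proof. by move=> /andP[h1 h2]; rewrite /w !hE; nra. Qed.

Let wle1 (x : R) : w.[x] <= 1.
Proof. by rewrite /w !hE; nra. Qed.

Let w0 : w.[0] = 1.
Proof. by rewrite /w !hE; ring. Qed.

Let w1 : w.[1] = 0.
Proof. by rewrite /w !hE; ring. Qed.

Lemma gintD k p q : gint k (p + q) = gint k p + gint k q.
Proof. by rewrite /gint mulrDr pintD. Qed.

Lemma gintZ k c p : gint k (c *: p) = c * gint k p.
Proof. by rewrite /gint -scalerAr pintZ. Qed.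

Lemma gint0 k : gint k 0 = 0.
Proof. by rewrite -(scale0r (0 : {poly R})) gintZ mul0r. Qed.

Lemma gint_sqr_ge0 k p : 0 <= gint k (p ^+ 2).
Proof.
apply: pint_ge0 => [|x hx]; first by lra.
by rewrite hornerM !horner_exp; apply: mulr_ge0; [apply: exprn_ge0; exact: wge0|exact: sqr_ge0].
Qed.

Lemma gintS_le k p : gint k.+1 (p ^+ 2) <= gint k (p ^+ 2).
Proof.
apply: le_pint => [|x hx]; first by lra.
rewrite !hornerM !horner_exp exprS -mulrA ler_piMl ?wle1 //.
by rewrite mulr_ge0 ?exprn_ge0 ?sqr_ge0 ?wge0.
Qed.

(* The adjoint of [d/dx], seen as a map from the weight [w^k] to the weight [w^(k+1)]. *)
Definition adj k u : {poly R} := (2 * k.+1%:R) *: ('X * u) - w * u^`().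

Let dw : w^`() = - (2%:R *: 'X).
Proof. by rewrite /w derivB derivC derivXn /= sub0r scaler_nat. Qed.

(** The two integrands differ by the derivative of [w^(k+1) u v], which vanishes at both
    endpoints. *)
Lemma gint_adj k u v : gint k.+1 (u * v^`()) = gint k (adj k u * v).
Proof.
apply/eqP; rewrite -subr_eq0 /gint -pintB.
have -> : w ^+ k.+1 * (u * v^`()) - w ^+ k * (adj k u * v) = (w ^+ k.+1 * (u * v))^`().
  rewrite !derivM deriv_exp /= dw /adj -mulr_natr -!mul_polyC !exprS.
  by rewrite !rmorphM /= !polyC_natr; ring.
apply/eqP; rewrite pint_deriv /w !hE !exprS; ring.
Qed.

(** Everything rests on the commutation rule [(adj k u)' = 2 (k+1) u + adj (k+1) u']: moving the
    derivative past [adj] raises the weight index and leaves a multiple of [u]. *)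
Lemma gint_adj_sqr k u :
  gint k (adj k u ^+ 2) =
  gint k.+2 (u^`() ^+ 2) + 2 * k.+1%:R * gint k.+1 (u ^+ 2).
Proof.
have -> : adj k u ^+ 2 = adj k u * adj k u by rewrite expr2.
rewrite -gint_adj.
have -> : u * (adj k u)^`() = (2 * k.+1%:R) *: u ^+ 2 + adj k.+1 u^`() * u.
  rewrite /adj derivB derivZ !derivM derivX dw -!mul_polyC.
  rewrite !rmorphM /= !polyC_natr -[k.+2]addn1 natrD; ring.
by rewrite gintD gintZ -gint_adj expr2 addrC.
Qed.

(* With [D] for [d/dx], the induction hypothesis for [p'] bounds [|adj p'|^2 = |D p'|^2 + 2(k+1)|p'|^2]
   by [c |p'|^2], and then Cauchy-Schwarz in [|p'|^2 = <adj p', p>] gives [|p'|^2 <= c |p|^2]. *)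
Lemma ladder n k p : (size p <= n.+1)%N ->
  gint k.+1 (p^`() ^+ 2) <= (2 * n * (n + k))%:R * gint k (p ^+ 2).
Proof.
elim: n k p => [|n IH] k p sp.
  rewrite (size1_polyC sp) derivC expr2 mulr0 gint0.
  by rewrite muln0 mul0n mul0r.
set u := p^`().
have su : (size u <= n.+1)%N by rewrite (leq_trans (size_poly _ _)) // -subn1 leq_subLR add1n.
have {}IH := IH k.+1 u su.
have X0 := gint_sqr_ge0 k.+1 u; set X := gint k.+1 (u ^+ 2) in X0 IH *.
have EX : X = gint k (adj k u * p) by rewrite /X expr2 gint_adj.
set c : R := (2 * n * (n + k.+1))%:R + 2 * k.+1%:R.
have hA : gint k (adj k u ^+ 2) <= c * X.
  by rewrite gint_adj_sqr /c [leRHS]mulrDl -/X lerD2r.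
have P0 := gint_sqr_ge0 k p.
have := gint_sqr_ge0 k (adj k u - c *: p).
have -> : (adj k u - c *: p) ^+ 2 =
   adj k u ^+ 2 + (- 2 * c) *: (adj k u * p) + (c ^+ 2) *: p ^+ 2.
  rewrite -!mul_polyC rmorphM rmorphXn /= rmorphN /= polyC_natr; ring.
rewrite 2!gintD 2!gintZ -EX => h.
have c0 : 0 < c by rewrite /c ltr_wpDl // mulr_gt0.
have : X <= c * gint k (p ^+ 2) by rewrite -(ler_pM2l c0); nra.
move/le_trans; apply; apply: ler_wpM2r => //.
rewrite /c -natrM -natrD ler_nat; lia.
Qed.

Lemma size_derivn_le n p k : (size p <= n)%N -> (size p^`(k) <= n)%N.
Proof.
move=> sp; elim: k => // k IH; rewrite derivnS (leq_trans _ IH) //.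
by rewrite (leq_trans (size_poly _ _)) // leq_pred.
Qed.

Lemma gint_derivn n k p : (size p <= n.+1)%N ->
  gint k (p^`(k) ^+ 2) <= (2 * (n + k) ^ 2)%:R ^+ k * gint 0 (p ^+ 2).
Proof.
(* Order and weight vary up to [k] while the factor keeps the final [k], so every rung contributes
   the same constant. *)
move=> sp; have : (k <= k)%N by []; move: {1 3 4 6}k.
elim=> [|i IH] ik; first by rewrite derivn0 expr0 mul1r.
rewrite derivnS (le_trans (ladder _ (size_derivn_le i sp))) //.
rewrite [_%:R ^+ i.+1]exprS -mulrA ler_pM ?gint_sqr_ge0 // ?IH 1?ltnW //.
by rewrite ler_nat; nia.
Qed.

(** As [w] is [1] at [0] and [0] at [1], the square of [q = p^(k)] at [0] is the integral over
    [[0, 1]] of minus the derivative of [w^(k+1) q^2]; splitting [2 q q'] by a square leaves two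
    weighted norms for the ladder. The factor [13] is generous: for [k <= n] it must dominate
    [4 n^2 + 2 n + 3] and [8 n^2] relative to [(n+1)^2]. *)
Lemma derivn0_bound n k p : (size p <= n.+1)%N ->
  (p^`(k)).[0] ^+ 2 <= (13 * n.+1 ^ 2)%:R ^+ k.+1 * pint (-1) 1 (p ^+ 2).
Proof.
move=> sp.
have P0 : 0 <= pint (-1) 1 (p ^+ 2).
  by have := gint_sqr_ge0 0 p; rewrite /gint expr0 mul1r.
have [nk|kn] := ltnP n k.
  have -> : p^`(k) = 0.
    by apply/polyP => i; rewrite coef_derivn coef0 nth_default ?mul0rn // (leq_trans sp) // (leq_trans nk) // leq_addr.
  by rewrite horner0 expr0n /= mulr_ge0 // exprn_ge0.
set q := p^`(k).
have sq : (size q <= n.+1)%N by exact: size_derivn_le.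
have h1 : q.[0] ^+ 2 = pint 0 1 (- (w ^+ k.+1 * q ^+ 2)^`()).
  by rewrite pintN pint_deriv !hornerM !horner_exp w0 w1 expr1n expr0n /=; ring.
have dF : - (w ^+ k.+1 * q ^+ 2)^`() =
    (2 * k.+1%:R) *: (w ^+ k * 'X * q ^+ 2) - 2%:R *: (w ^+ k.+1 * (q * q^`())).
  rewrite derivM !deriv_exp /= dw -!mul_polyC rmorphM /= !polyC_natr exprS.
  ring.
have h2 : q.[0] ^+ 2 <= pint 0 1 (w ^+ k * ((2 * k.+1%:R) *: q ^+ 2) +
    w ^+ k.+1 * (q ^+ 2 + q^`() ^+ 2)).
  rewrite h1 dF; apply: le_pint => // x /andP[x0 x1].
  have W0 : 0 <= 1 - x * x by nra.
  rewrite !hE; set b := 1 - x * x in W0 *; set s := q.[x]; set t := q^`().[x].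
  have K0 : 0 <= k.+1%:R :> R by [].
  (* The slack of the pointwise bound is twice this term, which comes from [x <= 1], plus the
     completed square that follows. *)
  have h3 : 0 <= (1 - x) * (k.+1%:R * b ^+ k * s ^+ 2).
    apply: mulr_ge0; first lra.
    by nneg.
  have h4 : 0 <= b ^+ k.+1 * (s + t) ^+ 2 by nneg.
  rewrite -subr_ge0; apply: le_trans (addr_ge0 (mulr_ge0 (ler0n R 2) h3) h4) _.
  rewrite le_eqVlt; apply/orP; left; apply/eqP; ring.
have h3 : q.[0] ^+ 2 <= (2 * k.+1).+1%:R * gint k (q ^+ 2) + gint k.+1 (q^`() ^+ 2).
  apply: (le_trans h2).
  set S := (X in pint 0 1 X).
  (* The integrand is nonnegative on [[-1, 0]] as well, so the interval may be enlarged to that of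
     the ladder. *)
  have : pint 0 1 S <= pint (-1) 1 S.
    rewrite (pint_chasles (-1) 0 1) lerDr; apply: pint_ge0 => [|x /andP[x1 x0]]; first lra.
    have W0 : 0 <= 1 - x * x by nra.
    by rewrite /S !hE; nneg.
  move/le_trans; apply; rewrite /S pintD -!/(gint _ _) gintZ gintD addrA lerD2r.
  rewrite -[(2 * k.+1).+1]addn1 natrD natrM [leRHS]mulrDl mul1r lerD2l.
  exact: gintS_le.
have h4 := ladder k sq.
have h5 := gint_derivn k sp; rewrite -/q {2}/gint expr0 mul1r in h5.
apply: (le_trans h3).
have : (2 * k.+1).+1%:R * gint k (q ^+ 2) + gint k.+1 (q^`() ^+ 2) <=
   (13 * n.+1 ^ 2)%:R * gint k (q ^+ 2).
  have G0 := gint_sqr_ge0 k q.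
  have : ((2 * k.+1).+1%:R + (2 * n * (n + k))%:R) * gint k (q ^+ 2) <=
     (13 * n.+1 ^ 2)%:R * gint k (q ^+ 2).
    by apply: ler_wpM2r => //; rewrite -natrD ler_nat; nia.
  by rewrite mulrDl; apply: le_trans; rewrite lerD2l.
move/le_trans; apply; rewrite [_%:R ^+ k.+1]exprS -mulrA ler_wpM2l //.
apply: (le_trans h5); rewrite ler_wpM2r // lerXn2r ?nnegrE // ler_nat; nia.
Qed.

(** Rescaling [[-1, 1]] onto [[c - l, c + l]] costs [l^k] for the derivative, squared, and one more
    [l] for the integral. *)
Lemma derivn_local_bound n k p (c l : R) : (size p <= n.+1)%N -> 0 < l ->
  (p^`(k)).[c] ^+ 2 * l ^+ (2 * k).+1 <=
  (13 * n.+1 ^ 2)%:R ^+ k.+1 * pint (c - l) (c + l) (p ^+ 2).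
Proof.
move=> sp l0.
have sq : (size (p \Po affine c l) <= n.+1)%N.
  have [->|p0] := eqVneq p 0; first by rewrite comp_poly0 size_poly0.
  rewrite (leq_trans (size_comp_poly_leq _ _)) //.
  have : (size (affine c l) <= 2)%N.
    rewrite /affine (leq_trans (size_polyD _ _)) // geq_max.
    by rewrite (leq_trans (size_scale_leq _ _)) ?size_polyX // (leq_trans (size_polyC_leq1 _)).
  by move: sp; nia.
have := derivn0_bound k sq.
rewrite derivn_affine hornerZ horner_comp horner_affine mulr0 addr0.
have E : pint (c - l) (c + l) (p ^+ 2) = l * pint (-1) 1 ((p \Po affine c l) ^+ 2).
  by rewrite -pint_affine rmorphXn.
move=> h; rewrite E [leRHS]mulrCA; have := ler_wpM2l (ltW l0) h; apply: le_trans.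
rewrite le_eqVlt; apply/orP; left; apply/eqP.
have -> : l ^+ (2 * k).+1 = l * (l ^+ k) ^+ 2 by rewrite exprS mulnC exprM.
ring.
Qed.

End Ladder.

(** * Weighted inequalities for polynomials *)

Section IntegrableDom.
Context {R : realType}.
Local Notation mu := (@lebesgue_measure R).
Implicit Types h k : R -> R.

Definition ri (h : R -> R) : Prop := mu.-integrable setT (EFin \o h).

Lemma oneDsqr_gt0 (x : R) : 0 < 1 + x ^+ 2.
Proof. by rewrite ltr_pwDl // sqr_ge0. Qed.

Lemma oneDsqr_ge1 (x : R) : 1 <= 1 + x ^+ 2.
Proof. by rewrite lerDl sqr_ge0. Qed.

Lemma measurable_oneDsqrV : measurable_fun setT (fun x : R => (1 + x ^+ 2)^-1).
Proof. by apply: continuous_measurable_fun; exact: continuous_oneDsqrV. Qed.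

Lemma integral_oneDsqrV : (\int[mu]_x ((1 + x ^+ 2)^-1)%:E = (pi : R)%:E)%E.
Proof.
rewrite (@ge0_symfun_integralT _ (fun x : R => (1 + x ^+ 2)^-1)).
- rewrite (_ : \int[mu]_(x in [set x | (0 <= x)%R]) _ = (pi / 2 : R)%:E)%E.
    by rewrite -EFinM; congr EFin; field.
  by rewrite -set_itvcy; exact: integral0y_oneDsqr.
- by move=> x; rewrite invr_ge0 ltW // oneDsqr_gt0.
- exact: continuous_oneDsqrV.
- by move=> x /=; rewrite sqrrN.
Qed.

Lemma ri_oneDsqrV : ri (fun x => (1 + x ^+ 2)^-1).
Proof.
apply/integrableP; split.
  by apply/measurable_EFinP; exact: measurable_oneDsqrV.
under eq_integral => x _.
  rewrite /= ger0_norm; last by rewrite invr_ge0 ltW // oneDsqr_gt0.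
  over.
by rewrite integral_oneDsqrV ltry.
Qed.

Lemma riZ c h : ri h -> ri (fun x => c * h x).
Proof. by move=> hh; have := integrableZl measurableT c hh. Qed.

Lemma riD h k : ri h -> ri k -> ri (fun x => h x + k x).
Proof. by move=> hh hk; exact: (integrableD measurableT hh hk). Qed.

Lemma ri_le h k : measurable_fun setT h -> ri k -> (forall x, `|h x| <= k x) -> ri h.
Proof.
move=> mh hk hle; apply: (le_integrable measurableT _ _ hk).
  by apply/measurable_EFinP.
by move=> x _ /=; rewrite lee_fin (le_trans (hle x)) // ler_norm.
Qed.

(** [1 / (1 + x^2)] is the standard dominating function below; its total mass is the origin of each
    [pi] in a constant. *)
Lemma ri_dom C h : measurable_fun setT h ->
  (forall x, `|h x| <= C / (1 + x ^+ 2)) -> ri h.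
Proof. by move=> mh hle; apply: (ri_le mh _ hle); apply: riZ; exact: ri_oneDsqrV. Qed.

Lemma Rintegral_dom C h : measurable_fun setT h ->
  (forall x, `|h x| <= C / (1 + x ^+ 2)) -> \int[mu]_x h x <= C * pi.
Proof.
move=> mh hle.
have <- : \int[mu]_x (C * (1 + x ^+ 2)^-1) = C * pi.
  by rewrite RintegralZl //; [rewrite /Rintegral integral_oneDsqrV|exact: ri_oneDsqrV].
apply: le_Rintegral => //; [exact: ri_dom mh hle|apply: riZ; exact: ri_oneDsqrV|].
by move=> x _; rewrite (le_trans (ler_norm _)).
Qed.

End IntegrableDom.

Section Weight.
Context {R : realType} (a : R).
Hypothesis ha : 1 < a.
Local Notation mu := (@lebesgue_measure R).
Local Notation W := (Wt a).
Implicit Types (p q : {poly R}) (f g : R -> R).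

Lemma Wt_gt0 (x : R) : 0 < W x. Proof. exact: expR_gt0. Qed.

Lemma measurable_Wt : measurable_fun setT W.
Proof.
apply: measurableT_comp; first by apply: continuous_measurable_fun; exact: continuous_expR.
apply: measurableT_comp => //.
apply: (@measurableT_comp _ _ _ _ _ _ (fun y : R => y `^ a)); first exact: measurable_powR.
exact: normr_measurable.
Qed.

Lemma Wt_le (x : R) : 1 <= `|x| -> W x <= expR (- `|x|).
Proof. by move=> x1; rewrite /Wt ler_expR lerN2 le1r_powR // ltW. Qed.

Lemma Wt_le1 (x : R) : W x <= 1.
Proof. by rewrite /Wt -expR0 ler_expR lerNl oppr0 powR_ge0. Qed.

Lemma Wt_anti (x y : R) : `|x| <= `|y| -> W y <= W x.
Proof.
move=> xy; rewrite /Wt ler_expR lerN2 ge0_ler_powR // ?nnegrE //.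
by apply: le_trans (ltW ha).
Qed.

Lemma expR_ge_pow n (x : R) : 0 <= x -> x ^+ n <= n`!%:R * expR x.
Proof.
case: n => [|n] x0; first by rewrite expr0 fact0 mul1r -expR0 ler_expR.
rewrite mulrC -ler_pdivrMr ?ltr0n ?fact_gt0 //.
by apply: le_trans (expR_ge1Dxn n x0); rewrite lerDr.
Qed.

(** For [|x| >= 1], [a > 1] gives [W x <= exp (- |x|)], and one term of the exponential series
    yields the factorial; for [|x| < 1] both factors are bounded. *)
Lemma oneDsqr_Wt N : exists2 C, 0 <= C & forall x : R, (1 + x ^+ 2) ^+ N * W x <= C.
Proof.
exists (2 ^+ N * (2 * N)`!%:R); first by rewrite mulr_ge0 // exprn_ge0.
move=> x; have [x1|x1] := leP 1 `|x|.
  have h1 : 1 + x ^+ 2 <= 2 * `|x| ^+ 2.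
    rewrite -(real_normK (num_real x)); nra.
  apply: (@le_trans _ _ ((2 * `|x| ^+ 2) ^+ N * expR (- `|x|))).
    apply: ler_pM => //; [|exact: ltW (Wt_gt0 _)| |exact: Wt_le].
      by rewrite exprn_ge0 // ltW // oneDsqr_gt0.
    by apply: lerXn2r; rewrite ?nnegrE // ?(ltW (oneDsqr_gt0 _)) // mulr_ge0 // sqr_ge0.
  rewrite exprMn -mulrA ler_wpM2l ?exprn_ge0 // -exprM.
  by rewrite expRN ler_pdivrMr ?expR_gt0 // expR_ge_pow.
apply: (@le_trans _ _ (2 ^+ N * 1)).
  apply: ler_pM => //; [|exact: ltW (Wt_gt0 _)| |exact: Wt_le1].
    by rewrite exprn_ge0 // ltW // oneDsqr_gt0.
  apply: lerXn2r; rewrite ?nnegrE // ?(ltW (oneDsqr_gt0 _)) //.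
  by rewrite -(real_normK (num_real x)); have := normr_ge0 x; nra.
by rewrite ler_wpM2l ?exprn_ge0 // ler1n fact_gt0.
Qed.

Lemma horner_le_oneDsqr p :
  exists2 C, 0 <= C & forall x : R, `|p.[x]| <= C * (1 + x ^+ 2) ^+ size p.
Proof.
exists (\sum_(i < size p) `|p`_i|); first by apply: sumr_ge0.
move=> x; rewrite horner_coef (le_trans (ler_norm_sum _ _ _)) // mulr_suml.
apply: ler_sum => i _; rewrite normrM ler_wpM2l // normrX.
apply: (@le_trans _ _ ((1 + x ^+ 2) ^+ i)).
  apply: lerXn2r; rewrite ?nnegrE // ?(ltW (oneDsqr_gt0 _)) //.
  by rewrite -(real_normK (num_real x)); have := normr_ge0 x; nra.
by apply: ler_weXn2l; [exact: oneDsqr_ge1|exact: ltnW].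
Qed.

Definition wint f := ri (fun x => f x * W x ^+ 2).
Definition wE f : R := \int[mu]_x (f x * W x ^+ 2).

Lemma measurable_mulW f : measurable_fun setT f ->
  measurable_fun setT (fun x => f x * W x ^+ 2).
Proof.
move=> mf; apply: measurable_funM => //; apply: measurable_funX; exact: measurable_Wt.
Qed.

Lemma measurable_horner p : measurable_fun setT (horner p).
Proof. by apply: continuous_measurable_fun; exact: continuous_horner. Qed.

(** Of the two factors [W], one absorbs the polynomial together with an extra [1 + x^2], and the
    other is at most [1]. *)
Lemma wint_poly p : wint (horner p).
Proof.
have [C C0 hC] := horner_le_oneDsqr p.
have [D D0 hD] := oneDsqr_Wt (size p).+1.
apply: (@ri_dom _ (C * D)).
  by apply: measurable_mulW; exact: measurable_horner.
move=> x; rewrite ler_pdivlMr ?oneDsqr_gt0 // normrM.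
have W0 := Wt_gt0 x; have W1 := Wt_le1 x.
rewrite [`|W x ^+ 2|]ger0_norm ?sqr_ge0 //.
apply: (@le_trans _ _ (C * (1 + x ^+ 2) ^+ size p * W x * (1 + x ^+ 2))).
  rewrite ler_wpM2r ?(ltW (oneDsqr_gt0 _)) // ler_pM ?sqr_ge0 //.
  by rewrite expr2 ler_piMl // ltW.
by rewrite -!mulrA ler_wpM2l // mulrA mulrAC -exprSr.
Qed.

Lemma wED f g : wint f -> wint g -> wE (fun x => f x + g x) = wE f + wE g.
Proof.
move=> hf hg; rewrite /wE -RintegralD //.
by apply: eq_Rintegral => x _; rewrite mulrDl.
Qed.

Lemma wEZ c f : wint f -> wE (fun x => c * f x) = c * wE f.
Proof.
move=> hf; rewrite /wE -RintegralZl //.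
by apply: eq_Rintegral => x _; rewrite mulrA.
Qed.

Lemma wintZ c f : wint f -> wint (fun x => c * f x).
Proof.
move=> /(riZ c); rewrite /wint.
by rewrite [in X in _ -> X](_ : (fun _ => _) = (fun x => c * (f x * W x ^+ 2))) //; apply/funext => x; rewrite mulrA.
Qed.

Lemma wintD f g : wint f -> wint g -> wint (fun x => f x + g x).
Proof.
move=> hf hg; have := riD hf hg; rewrite /wint.
by rewrite [in X in _ -> X](_ : (fun _ => _) = (fun x => f x * W x ^+ 2 + g x * W x ^+ 2)) //; apply/funext => x; rewrite mulrDl.
Qed.

Lemma wE_ge0 f : (forall x, 0 <= f x) -> 0 <= wE f.
Proof. by move=> f0; apply: Rintegral_ge0 => x _; rewrite mulr_ge0 ?sqr_ge0. Qed.

End Weight.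

(** * Weighted pointwise bounds for derivatives of polynomials *)

Section Nikolskii.
Context {R : realType} (a : R).
Hypothesis ha : 1 < a.
Local Notation mu := (@lebesgue_measure R).
Local Notation W := (Wt a).
Implicit Types (p q : {poly R}) (f g : R -> R).

Lemma EFin_wE f : wint a f -> (wE a f)%:E = (\int[mu]_x (f x * W x ^+ 2)%:E)%E.
Proof. by move=> hf; rewrite /wE /Rintegral fineK //; exact: (integrable_fin_num measurableT hf). Qed.

Lemma wint_polyX p k : wint a (fun x => p.[x] ^+ k).
Proof.
rewrite (_ : (fun _ => _) = horner (p ^+ k)); first exact: wint_poly.
by apply/funext => x; rewrite horner_exp.
Qed.

Lemma pint_le_wE (c d K : R) p : c < d -> 0 <= K ->
  (forall x, c <= x <= d -> K <= W x ^+ 2) ->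
  K * pint c d (p ^+ 2) <= wE a (fun x => p.[x] ^+ 2).
Proof.
move=> cd K0 hK; rewrite -pintZ -lee_fin -integral_poly // EFin_wE; last exact: wint_polyX.
have mi : measurable (`[c, d]%classic : set R) by exact: measurable_itv.
have m2 : measurable_fun setT (fun x : R => p.[x] ^+ 2 * W x ^+ 2).
  by apply: measurable_mulW; apply: measurable_funX; exact: measurable_horner.
apply: (@le_trans _ _ (\int[mu]_(x in `[c, d]) (p.[x] ^+ 2 * W x ^+ 2)%:E)%E).
  apply: ge0_le_integral => //.
  - by move=> x _; rewrite lee_fin hornerZ horner_exp mulr_ge0 ?sqr_ge0.
  - by apply/measurable_EFinP; apply: measurable_funTS; exact: measurable_horner.
  - by apply/measurable_EFinP; apply: measurable_funTS.
  - move=> x /=; rewrite in_itv /= => /hK hx.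
    by rewrite lee_fin hornerZ horner_exp mulrC ler_wpM2l ?sqr_ge0.
apply: ge0_subset_integral => //.
- by apply/measurable_EFinP.
- by move=> x _; rewrite lee_fin mulr_ge0 ?sqr_ge0.
Qed.

Lemma expr1D_le (s : nat) (l : R) : 0 <= l <= 1 -> (1 + l) ^+ s <= 1 + 3 ^+ s * l.
Proof.
move=> /andP[l0 l1]; elim: s => [|s IH]; first by rewrite !expr0; lra.
rewrite exprS; have h3 : 1 <= 3 ^+ s :> R by rewrite exprn_ege1 //; lra.
have hl : 0 <= 1 + l by lra.
apply: le_trans (ler_wpM2l hl IH) _; rewrite [3 ^+ s.+1]exprS.
move: (3 ^+ s) h3 => t t1.
have : 0 <= l * (t * (1 - l)) by apply: mulr_ge0 => //; apply: mulr_ge0; lra.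
have : 0 <= l * (t - 1) by apply: mulr_ge0 => //; lra.
lra.
Qed.

(** For [|c| > 1], [|x|^a <= |c|^a (1 + l)^a <= |c|^a (1 + 3^s l)], and the smallness of [l] keeps
    the excess below [3^s]; for [|c| <= 1] simply [|x| <= 2]. The integer [s >= a] replaces the real
    exponent. *)
Lemma Wt_osc (s : nat) (B l c x : R) : a <= s%:R -> 0 <= B -> 0 <= l ->
  l * (B + 1) ^+ s <= 1 -> `|c| <= B -> `|x - c| <= l -> W c <= expR (3 ^+ s) * W x.
Proof.
move=> as_ B0 l0 lB cB xc.
have a0 : 0 <= a by apply: le_trans (ltW ha).
have B1 : 1 <= (B + 1) ^+ s by rewrite exprn_ege1 //; lra.
have l1 : l <= 1 by nra.
rewrite /Wt -expRD ler_expR; suff : `|x| `^ a <= `|c| `^ a + 3 ^+ s by lra.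
have xle : `|x| <= `|c| + l.
  have -> : x = c + (x - c) by ring.
  by rewrite (le_trans (ler_normD _ _)) // lerD2l.
have [c1|c1] := leP `|c| 1.
  have : `|x| `^ a <= 3 ^+ s.
    apply: (@le_trans _ _ (2 `^ a)).
      by rewrite ge0_ler_powR ?nnegrE //; lra.
    apply: (@le_trans _ _ (2 `^ s%:R)); first by rewrite ler_powR //; lra.
    by rewrite powR_mulrn // lerXn2r ?nnegrE //; lra.
  by have := powR_ge0 `|c| a; lra.
have xle2 : `|x| `^ a <= (`|c| * (1 + l)) `^ a.
  rewrite ge0_ler_powR ?nnegrE //; last by nra.
  by rewrite mulr_ge0 //; lra.
have h1 : (1 + l) `^ a <= 1 + 3 ^+ s * l.
  apply: (@le_trans _ _ ((1 + l) `^ s%:R)); first by rewrite ler_powR //; lra.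
  by rewrite powR_mulrn; [apply: expr1D_le; lra|lra].
have h2 : `|c| `^ a <= (B + 1) ^+ s.
  apply: (@le_trans _ _ (`|c| `^ s%:R)); first by rewrite ler_powR // ltW.
  by rewrite powR_mulrn // lerXn2r ?nnegrE //; lra.
rewrite powRM // in xle2; last by lra.
have P0 := powR_ge0 `|c| a.
have : `|c| `^ a * (1 + l) `^ a <= `|c| `^ a * (1 + 3 ^+ s * l) by exact: ler_wpM2l.
have : `|c| `^ a * l <= 1 by apply: le_trans lB; rewrite mulrC ler_wpM2l.
have : 0 <= 3 ^+ s :> R by rewrite exprn_ge0.
move: (`|c| `^ a) ((1 + l) `^ a) (`|x| `^ a) (3 ^+ s) xle2 P0 => u v w t; nra.
Qed.

Lemma coef_derivn0 p i : p^`(i).[0] = p`_i * i`!%:R.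
Proof. by rewrite horner_coef0 coef_derivn addn0 ffactnn mulr_natr. Qed.

Lemma wE_sqr_ge0 f : 0 <= wE a (fun x => f x ^+ 2).
Proof. by apply: wE_ge0 => x; exact: sqr_ge0. Qed.

Lemma pint01_le_wE p :
  pint (-1) 1 (p ^+ 2) <= expR 2 * wE a (fun x => p.[x] ^+ 2).
Proof.
have := @pint_le_wE (-1) 1 (expR (- 2)) p.
rewrite expRN => h; rewrite -ler_pdivrMl ?expR_gt0 //; apply: h; first by lra.
  by rewrite invr_ge0 ltW // expR_gt0.
move=> x /andP[x1 x2]; rewrite -expRN /Wt -expRM_natl ler_expR.
have : `|x| `^ a <= 1.
  have -> : 1 = 1 `^ a :> R by rewrite powR1.
  apply: ge0_ler_powR; rewrite ?nnegrE //; first by apply: le_trans (ltW ha).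
  by rewrite ler_norml; apply/andP.
lra.
Qed.

(** Up to factorials, the coefficients of [p^(j)] are higher derivatives of [p] at [0], which
    [derivn0_bound] controls, and for [|c| >= 1] each monomial is at most [|c|^(n+1)]. The factor
    [m^2] from counting terms is merged into the power [n + 1]. *)
Lemma derivn_tail_bound n j p (c : R) : (size p <= n.+1)%N -> 1 <= `|c| ->
  (p^`(j)).[c] ^+ 2 <=
    (13 * n.+1%:R ^+ 4 * `|c| ^+ 2) ^+ n.+1 * pint (-1) 1 (p ^+ 2).
Proof.
move=> sp c1; set q := p^`(j); set m : R := n.+1%:R.
have m1 : 1 <= m by rewrite /m ler1n.
have sq : (size q <= n.+1)%N by exact: size_derivn_le.
set P0 := pint _ _ _.
have P00 : 0 <= P0.
  apply: pint_ge0 => [|x _]; first by lra.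
  by rewrite horner_exp sqr_ge0.
set A := (13 * m ^+ 2) ^+ n.+1 * P0.
have A0 : 0 <= A by rewrite mulr_ge0 // exprn_ge0 // mulr_ge0 // exprn_ge0 //; lra.
have hq i : `|q`_i| <= Num.sqrt A.
  rewrite -sqrtr_sqr ler_wsqrtr //.
  have hf : q`_i ^+ 2 <= (q`_i * i`!%:R) ^+ 2.
    rewrite exprMn ler_peMr ?sqr_ge0 // exprn_ege1 // ler1n; exact: fact_gt0.
  apply: (le_trans hf); rewrite -coef_derivn0.
  have [nk|kn] := ltnP n (j + i).
    have -> : q^`(i).[0] = 0.
      rewrite coef_derivn0 /q coef_derivn nth_default ?mul0rn ?mul0r //.
      by rewrite (leq_trans sp).
    by rewrite expr0n.
  have -> : q^`(i) = p^`(i + j) by rewrite /q /derivn -iterD.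
  apply: (le_trans (derivn0_bound _ sp)); rewrite -/P0 /A ler_wpM2r //.
  have -> : (13 * n.+1 ^ 2)%:R = 13 * m ^+ 2 :> R by rewrite natrM natrX.
  apply: ler_weXn2l; last by lia.
  have : 1 <= m ^+ 2 by rewrite exprn_ege1.
  lra.
have hqc : `|q.[c]| <= m * Num.sqrt A * `|c| ^+ n.+1.
  rewrite (@horner_coef_wide _ n.+1) // (le_trans (ler_norm_sum _ _ _)) //.
  have -> : m * Num.sqrt A * `|c| ^+ n.+1 = \sum_(i < n.+1) (Num.sqrt A * `|c| ^+ n.+1).
    by rewrite sumr_const card_ord -[RHS]mulr_natl mulrA.
  apply: ler_sum => i _; rewrite normrM ler_pM // normrX.
  by apply: ler_weXn2l => //; exact: ltnW.
have : q.[c] ^+ 2 <= (m * Num.sqrt A * `|c| ^+ n.+1) ^+ 2.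
  by rewrite -(real_normK (num_real q.[c])) lerXn2r ?nnegrE // (le_trans _ hqc).
move/le_trans; apply.
have -> : (m * Num.sqrt A * `|c| ^+ n.+1) ^+ 2 = m ^+ 2 * A * (`|c| ^+ 2) ^+ n.+1.
  by rewrite !exprMn sqr_sqrtr // -!exprM mulnC.
rewrite /A.
have -> : (13 * m ^+ 4 * `|c| ^+ 2) ^+ n.+1 * P0 =
   (m ^+ 2) ^+ n.+1 * ((13 * m ^+ 2) ^+ n.+1 * P0) * (`|c| ^+ 2) ^+ n.+1.
  rewrite (_ : 13 * m ^+ 4 * `|c| ^+ 2 = m ^+ 2 * (13 * m ^+ 2) * `|c| ^+ 2); last by ring.
  rewrite 2!exprMn; ring.
rewrite ler_wpM2r ?exprn_ge0 // ler_wpM2r //.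
by rewrite -[leLHS]expr1; apply: ler_weXn2l => //; rewrite exprn_ege1.
Qed.

(** With [exp X] written as the [(m+1)]-st power of [exp (X / (m+1))], one factor is compared at a
    time: [exp Y >= Y^4 / 24] reduces the claim to [X^2 >= 312 (m+1)^8], and [18^2 = 324]. *)
Lemma tail_weight (m : nat) (X : R) : 18 * m.+1%:R ^+ 4 <= X ->
  (13 * m.+1%:R ^+ 4 * X ^+ 2) ^+ m.+1 * expR (- X) <= 1.
Proof.
set k : R := m.+1%:R => hX; have k1 : 1 <= k by rewrite /k ler1n.
have k4 : 1 <= k ^+ 4 by rewrite exprn_ege1.
have X0 : 0 < X by lra.
have -> : expR (- X) = (expR (X / k)) ^- m.+1.
  rewrite expRN -expRM_natr; congr (expR _)^-1; rewrite -/k; field.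
  by rewrite gt_eqF //; lra.
rewrite -exprVn -exprMn; apply: exprn_ile1.
  by rewrite !mulr_ge0 // ?sqr_ge0 ?invr_ge0 ?expR_ge0 //; lra.
rewrite ler_pdivrMr ?expR_gt0 // mul1r.
have Y0 : 0 <= X / k by rewrite divr_ge0 //; lra.
have := expR_ge_pow 4 Y0.
have -> : 4`! = 24%N by [].
move=> h.
have : 24 * (13 * k ^+ 4 * X ^+ 2) <= (X / k) ^+ 4.
  rewrite expr_div_n ler_pdivlMr; last by rewrite exprn_gt0 //; lra.
  have -> : X ^+ 4 = X ^+ 2 * X ^+ 2 by ring.
  have : (18 * k ^+ 4) ^+ 2 <= X ^+ 2 by rewrite lerXn2r ?nnegrE //; lra.
  have := sqr_ge0 X; have := sqr_ge0 (k ^+ 4).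
  move: (k ^+ 4) (X ^+ 2) => u v; nra.
by move=> h'; rewrite -(@ler_pM2l _ 24) // (le_trans h').
Qed.

Lemma weighted_nikolskii (M j : nat) : exists (C : R) (S : nat), 0 <= C /\
  forall n p, (size p <= n.+1)%N -> forall c : R,
  (1 + c ^+ 2) ^+ M * p^`(j).[c] ^+ 2 * W c ^+ 2 <=
    C * n.+1%:R ^+ S * wE a (fun x => p.[x] ^+ 2).
Proof.
set s := Num.bound a.
have as_ : a <= s%:R by apply/ltW/archi_boundP; apply: le_trans (ltW ha).
have [D D0 hD] := oneDsqr_Wt ha M.
(* With [B = 18 m^4], [325 = 1 + 18^2] comes from [1 + c^2] and [19 = 18 + 1] from [B + 1]; the
   exponent below adds up the powers of [m] in [(m^8)^M], [(m^2)^(j+1)] and [(m^4)^(s (2j+1))]. *)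
set C1 : R := 325 ^+ M * 13 ^+ j.+1 * 19 ^+ (s * (2 * j).+1) * expR (3 ^+ s) ^+ 2.
have C10 : 0 <= C1 by rewrite /C1; nneg.
exists (C1 + D * expR 2), (8 * M + 2 * j.+1 + 4 * (s * (2 * j).+1))%N; split.
  by rewrite addr_ge0 // mulr_ge0 // expR_ge0.
move=> n p sp c; set m : R := n.+1%:R; set S := (_ + _)%N.
have m1 : 1 <= m by rewrite /m ler1n.
have m4 : 1 <= m ^+ 4 by rewrite exprn_ege1.
have mS : 1 <= m ^+ S by rewrite exprn_ege1.
have E0 := wE_sqr_ge0 (horner p); set E := wE _ _ in E0 *.
have W0 := Wt_gt0 a c; have Wc1 := Wt_le1 a c.
have q0 : 0 <= (1 + c ^+ 2) ^+ M by rewrite exprn_ge0 // ltW // oneDsqr_gt0.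
set B : R := 18 * m ^+ 4.
(* Beyond [B] the Taylor coefficients of [p] at [0] suffice, since [W] beats [|c|^(2n)] there;
   below [B] the local bound is used on an interval where [W] is nearly constant. *)
have [cB|cB] := leP `|c| B; last first.
  have c1 : 1 <= `|c| by rewrite /B in cB; lra.
  have h1 := derivn_tail_bound j sp c1.
  have h2 := pint01_le_wE p; rewrite -/E in h2.
  have h3 := tail_weight (ltW cB); rewrite -/m in h1 h3.
  have h4 := Wt_le ha c1; have h5 := hD c.
  set T := (13 * _ * _) ^+ _ in h1 h3; set P0 := pint _ _ _ in h1 h2.
  have T0 : 0 <= T by rewrite exprn_ge0 // !mulr_ge0 ?exprn_ge0 //; lra.
  set Q := p^`(j).[c] ^+ 2 in h1 *; have Q0 : 0 <= Q by exact: sqr_ge0.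
  have h6 : Q * W c <= expR 2 * E.
    apply: (@le_trans _ _ (T * (expR 2 * E) * expR (- `|c|))).
      apply: ler_pM => //; first exact: ltW.
      by apply: (le_trans h1); rewrite ler_wpM2l.
    by rewrite mulrAC ler_piMl // mulr_ge0 // expR_ge0.
  (* One factor [W] beats the tail bound for [p^(j)], the other the power of [1 + c^2]. *)
  have -> : (1 + c ^+ 2) ^+ M * Q * W c ^+ 2 = ((1 + c ^+ 2) ^+ M * W c) * (Q * W c) by ring.
  apply: (@le_trans _ _ (D * (expR 2 * E))).
    by apply: ler_pM => //; rewrite mulr_ge0 // ltW.
  rewrite mulrA; apply: ler_wpM2r => //; rewrite mulrDl.
  have : D * expR 2 <= D * expR 2 * m ^+ S.
    by rewrite ler_peMr // mulr_ge0 // expR_ge0.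
  have : 0 <= C1 * m ^+ S by rewrite mulr_ge0 //; lra.
  lra.
have B0 : 0 <= B by rewrite /B; lra.
(* The largest length that [Wt_osc] accepts, polynomially small in [m]. *)
set l : R := ((B + 1) ^+ s)^-1.
have Bs : 0 < (B + 1) ^+ s by rewrite exprn_gt0 //; lra.
have l0 : 0 < l by rewrite invr_gt0.
have lB : l * (B + 1) ^+ s <= 1 by rewrite mulVf // gt_eqF.
have hloc := derivn_local_bound j c sp l0.
have cl : c - l < c + l by lra.
set K := (expR (3 ^+ s))^-1 * W c.
have K0 : 0 <= K by rewrite mulr_ge0 ?invr_ge0 ?expR_ge0 // ltW.
have hK x : c - l <= x <= c + l -> K ^+ 2 <= W x ^+ 2.
  move=> hx; apply: lerXn2r; [by []|exact: ltW (Wt_gt0 a x)|].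
  rewrite /K mulrC ler_pdivrMr ?expR_gt0 // mulrC.
  apply: (Wt_osc as_ B0 (ltW l0) lB cB).
  by rewrite ler_norml; apply/andP; lra.
have := pint_le_wE p cl (sqr_ge0 K) hK; rewrite -/E.
set P1 := pint _ _ _ in hloc * => h1.
set Q := p^`(j).[c] ^+ 2 in hloc *; have Q0 : 0 <= Q by exact: sqr_ge0.
have h2 : W c ^+ 2 * P1 <= expR (3 ^+ s) ^+ 2 * E.
  have : expR (3 ^+ s) ^+ 2 * (K ^+ 2 * P1) <= expR (3 ^+ s) ^+ 2 * E.
    by rewrite ler_wpM2l ?sqr_ge0.
  apply: le_trans; rewrite le_eqVlt; apply/orP; left; apply/eqP.
  by rewrite /K; field; rewrite gt_eqF // expR_gt0.
set G : R := (13 * m ^+ 2) ^+ j.+1.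
have GE : (13 * n.+1 ^ 2)%:R = 13 * m ^+ 2 :> R by rewrite natrM natrX.
rewrite GE -/G in hloc.
have G0 : 0 <= G by rewrite exprn_ge0 // mulr_ge0 // sqr_ge0.
set L := ((B + 1) ^+ s) ^+ (2 * j).+1.
have L0 : 0 < L by rewrite exprn_gt0.
have h3 : Q * W c ^+ 2 <= L * G * (expR (3 ^+ s) ^+ 2 * E).
  have -> : Q = Q * l ^+ (2 * j).+1 * L.
    by rewrite /L -mulrA -exprMn mulVf ?expr1n ?mulr1 // gt_eqF.
  apply: (@le_trans _ _ (G * P1 * L * W c ^+ 2)).
    by rewrite ler_wpM2r ?sqr_ge0 // ler_wpM2r // ltW.
  have -> : G * P1 * L * W c ^+ 2 = L * G * (W c ^+ 2 * P1) by ring.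
  by rewrite ler_wpM2l // mulr_ge0 // ltW.
have h4 : (1 + c ^+ 2) ^+ M <= (325 * m ^+ 8) ^+ M.
  have m0 : 0 <= m by lra.
  apply: lerXn2r; [exact: (ltW (oneDsqr_gt0 _))|rewrite nnegrE; by nneg|].
  rewrite -(real_normK (num_real c)).
  have : `|c| ^+ 2 <= B ^+ 2 by rewrite lerXn2r ?nnegrE.
  rewrite /B; have -> : m ^+ 8 = (m ^+ 4) ^+ 2 by ring.
  by move: (m ^+ 4) m4 => u u1; nra.
have h5 : L <= (19 * m ^+ 4) ^+ (s * (2 * j).+1).
  rewrite /L -exprM; apply: lerXn2r; [rewrite nnegrE; lra|rewrite nnegrE; lra|].
  by rewrite /B; lra.
have h6 : (1 + c ^+ 2) ^+ M * (Q * W c ^+ 2) <= C1 * m ^+ S * E.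
  apply: (@le_trans _ _ ((325 * m ^+ 8) ^+ M * ((19 * m ^+ 4) ^+ (s * (2 * j).+1) * G * (expR (3 ^+ s) ^+ 2 * E)))).
    apply: ler_pM => //; first by rewrite mulr_ge0 ?sqr_ge0.
    apply: (le_trans h3); apply: ler_wpM2r; first by rewrite mulr_ge0 ?sqr_ge0.
    exact: ler_wpM2r.
  rewrite le_eqVlt; apply/orP; left; apply/eqP.
  have -> : m ^+ S = (m ^+ 8) ^+ M * (m ^+ 2) ^+ j.+1 * (m ^+ 4) ^+ (s * (2 * j).+1).
    by rewrite -!exprM -!exprD.
  by rewrite /C1 /G ![(_ * _ ^+ _) ^+ _]exprMn; ring.
rewrite -mulrA; apply: (le_trans h6); rewrite ler_wpM2r //.
by rewrite ler_wpM2r ?lerDl ?mulr_ge0 ?expR_ge0 //; lra.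
Qed.

End Nikolskii.

(** * Distances to polynomials *)

Section AlmostEverywhere.
Context {R : realType}.
Local Notation mu := (@lebesgue_measure R).

Lemma aeS (P Q : R -> Prop) : (forall x, P x -> Q x) ->
  (\forall x \ae mu, P x) -> \forall x \ae mu, Q x.
Proof.
move=> PQ [A [mA A0 AP]]; exists A; split => //.
by apply: subset_trans AP => x nQ /PQ.
Qed.

Lemma aeS2 (P Q S : R -> Prop) : (forall x, P x -> Q x -> S x) ->
  (\forall x \ae mu, P x) -> (\forall x \ae mu, Q x) -> \forall x \ae mu, S x.
Proof.
move=> PQS [A [mA A0 AP]] [B [mB B0 BQ]]; exists (A `|` B); split.
- exact: measurableU.
- apply/negligibleP; first exact: measurableU.
  by apply: negligibleU; apply/negligibleP.
- move=> x /= nS; have [p|np] := pselect (P x); last by left; exact: AP.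
  by right; apply: BQ => /= q; apply: nS; exact: PQS.
Qed.

End AlmostEverywhere.

(** * The weighted L2 space, reduced to real and imaginary parts *)

Section L2.
Context {R : realType} (a : R).
Hypothesis ha : 1 < a.
Local Notation mu := (@lebesgue_measure R).
Local Notation W := (Wt a).
Implicit Types (p q : {poly R}) (f g h : R -> R) (u v : R -> (R * R)%type).

Definition rL2 f : Prop := measurable_fun setT f /\ wint a (fun x => f x ^+ 2).

Lemma wint_ext f g : wint a f -> f =1 g -> wint a g.
Proof. by move=> h /funext <-. Qed.

Lemma rL2_ext f g : rL2 f -> f =1 g -> rL2 g.
Proof. by move=> h /funext <-. Qed.

Lemma wint_le f g : measurable_fun setT f -> wint a g ->
  (forall x, `|f x| <= g x) -> wint a f.
Proof.
move=> mf ig fg; apply: (ri_le (measurable_mulW _ mf) ig) => x.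
by rewrite normrM [`|W x ^+ 2|]ger0_norm ?sqr_ge0 // ler_wpM2r ?sqr_ge0.
Qed.

Lemma rL2M f g : rL2 f -> rL2 g -> wint a (fun x => f x * g x).
Proof.
move=> [mf hf] [mg hg]; apply: (@wint_le _ (fun x => f x ^+ 2 + g x ^+ 2)).
- exact: measurable_funM.
- exact: wintD.
- move=> x; rewrite -[f x ^+ 2](real_normK (num_real _)) -[g x ^+ 2](real_normK (num_real _)) normrM.
  by have := normr_ge0 (f x); have := normr_ge0 (g x); nra.
Qed.

Lemma rL2D f g : rL2 f -> rL2 g -> rL2 (fun x => f x + g x).
Proof.
move=> hf hg; split; first by apply: measurable_funD; [case: hf|case: hg].
have h2 := wintD (wintD (proj2 hf) (wintZ 2 (rL2M hf hg))) (proj2 hg).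
by apply: wint_ext h2 _ => x; ring.
Qed.

Lemma rL2Z c f : rL2 f -> rL2 (fun x => c * f x).
Proof.
move=> hf; split; first by apply: measurable_funM => //; case: hf.
have h2 := wintZ (c ^+ 2) (proj2 hf).
by apply: wint_ext h2 _ => x; ring.
Qed.

Lemma rL2N f : rL2 f -> rL2 (fun x => - f x).
Proof.
by move=> /(rL2Z (-1)) h; apply: rL2_ext h _ => x; rewrite mulN1r.
Qed.

Lemma rL2B f g : rL2 f -> rL2 g -> rL2 (fun x => f x - g x).
Proof. by move=> hf hg; apply: rL2D => //; exact: rL2N. Qed.

Lemma rL2_poly p : rL2 (horner p).
Proof. by split; [exact: measurable_horner|exact: wint_polyX]. Qed.

Lemma wEB f g : wint a f -> wint a g -> wE a (fun x => f x - g x) = wE a f - wE a g.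
Proof.
move=> hf hg; rewrite -mulN1r -wEZ // -wED //; last exact: wintZ.
by congr (wE a _); apply/funext => x; rewrite mulN1r.
Qed.

Lemma measurable_cabs2W u : cmeasurable u ->
  measurable_fun setT (fun x => cabs2 (u x) * W x ^+ 2).
Proof.
move=> [m1 m2]; apply: measurable_mulW.
by apply: measurable_funD; apply: measurable_funX.
Qed.

Lemma cabs2_ge0 (z : R * R) : 0 <= cabs2 z.
Proof. by rewrite /cabs2 addr_ge0 ?sqr_ge0. Qed.

Lemma inL2P u : inL2 a u <-> rL2 (fun x => (u x).1) /\ rL2 (fun x => (u x).2).
Proof.
split=> [[[m1 m2] hu]|[[m1 h1] [m2 h2]]].
  have hi : ri (fun x => cabs2 (u x) * W x ^+ 2).
    apply/integrableP; split; first by apply/measurable_EFinP; exact: (measurable_cabs2W (conj m1 m2)).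
    under eq_integral => x _.
      rewrite /= ger0_norm; last by rewrite mulr_ge0 ?sqr_ge0 ?cabs2_ge0.
      over.
    exact: hu.
  have hw : wint a (fun x => cabs2 (u x)) by [].
  by split; split => //; apply: wint_le hw _; try exact: measurable_funX;
    move=> x; rewrite ger0_norm ?sqr_ge0 // /cabs2 ?lerDl ?lerDr sqr_ge0.
split; first by [].
have /integrableP[_] := wintD h1 h2; apply: le_lt_trans.
apply: ge0_le_integral => //.
- by move=> x _; rewrite lee_fin mulr_ge0 ?sqr_ge0 ?cabs2_ge0.
- by apply/measurable_EFinP; exact: (measurable_cabs2W (conj m1 m2)).
- apply: measurableT_comp => //; apply/measurable_EFinP.
  by apply: measurable_mulW; apply: measurable_funD; apply: measurable_funX.
- by move=> x _ /=; rewrite lee_fin ler_norm.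
Qed.

Lemma wint2E u : inL2 a u ->
  wint2 a u = (wE a (fun x => (u x).1 ^+ 2) + wE a (fun x => (u x).2 ^+ 2))%:E.
Proof.
move=> /inL2P[[_ h1] [_ h2]].
by rewrite -wED // EFin_wE //; exact: wintD.
Qed.

Lemma wnorm_sqr u : inL2 a u ->
  wnorm a u ^+ 2 = wE a (fun x => (u x).1 ^+ 2) + wE a (fun x => (u x).2 ^+ 2).
Proof.
by move=> hu; rewrite /wnorm wint2E //= sqr_sqrtr // addr_ge0 // wE_sqr_ge0.
Qed.

Lemma wnorm_ge0 u : 0 <= wnorm a u. Proof. exact: sqrtr_ge0. Qed.

Lemma inL2D u v : inL2 a u -> inL2 a v -> inL2 a (fun x => u x + v x).
Proof.
move=> /inL2P[u1 u2] /inL2P[v1 v2]; apply/inL2P; split => /=; exact: rL2D.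
Qed.

Lemma inL2N u : inL2 a u -> inL2 a (fun x => - u x).
Proof. by move=> /inL2P[u1 u2]; apply/inL2P; split => /=; exact: rL2N. Qed.

Lemma inL2B u v : inL2 a u -> inL2 a v -> inL2 a (csub u v).
Proof. by move=> hu /inL2N hv; exact: inL2D. Qed.

Lemma inL2_cpoly p q : inL2 a (cpoly p q).
Proof. by apply/inL2P; split => /=; exact: rL2_poly. Qed.

(** The real part of the Hermitian product, enough for Cauchy-Schwarz with real multiples and for
    the triangle inequality. *)
Definition cdot u v : R := wE a (fun x => (u x).1 * (v x).1 + (u x).2 * (v x).2).

Lemma wint_cdot u v : inL2 a u -> inL2 a v ->
  wint a (fun x => (u x).1 * (v x).1 + (u x).2 * (v x).2).
Proof. by move=> /inL2P[u1 u2] /inL2P[v1 v2]; apply: wintD; exact: rL2M. Qed.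

Lemma wnormD_sqr u v t : inL2 a u -> inL2 a v ->
  wnorm a (fun x => u x + (t * (v x).1, t * (v x).2)) ^+ 2 =
  wnorm a u ^+ 2 + 2 * t * cdot u v + t ^+ 2 * wnorm a v ^+ 2.
Proof.
move=> hu hv; have hd := wint_cdot hu hv.
have [u1 u2] := (inL2P u).1 hu; have [v1 v2] := (inL2P v).1 hv.
have tv1 := rL2Z t v1; have tv2 := rL2Z t v2.
rewrite wnorm_sqr; last by apply/inL2P; split => /=; exact: rL2D.
rewrite !wnorm_sqr // -!wED /=; try by [case: u1 | case: u2 | case: v1 | case: v2 |
   case: (rL2D u1 tv1) | case: (rL2D u2 tv2)].
have i1 := wintD (proj2 u1) (proj2 u2); have i2 := wintD (proj2 v1) (proj2 v2).
have j1 := wintZ (2 * t) hd; have j2 := wintZ (t ^+ 2) i2.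
rewrite /cdot -(wEZ (2 * t) hd) -(wEZ (t ^+ 2) i2) -(wED i1 j1) -(wED (wintD i1 j1) j2).
by congr (wE a _); apply/funext => x; ring.
Qed.

(** Evaluation at the minimiser [- d / B^2]; for [B = 0] the value [t = - (A^2 + 1) / d] makes the
    affine function negative. *)
Lemma discriminant_le (A B d : R) : 0 <= A -> 0 <= B ->
  (forall t, 0 <= A ^+ 2 + 2 * t * d + t ^+ 2 * B ^+ 2) -> d <= A * B.
Proof.
move=> A0 B0 h; rewrite leNgt; apply/negP => hd.
have d0 : 0 < d by apply: le_lt_trans hd; exact: mulr_ge0.
have [BE|Bn0] := eqVneq B 0.
  have := h (- (A ^+ 2 + 1) / d); rewrite BE.
  have -> : 2 * (- (A ^+ 2 + 1) / d) * d = - 2 * (A ^+ 2 + 1).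
    by field; rewrite gt_eqF.
  by have := sqr_ge0 A; lra.
have Bp : 0 < B by rewrite lt_def Bn0.
have := h (- d / B ^+ 2).
have -> : A ^+ 2 + 2 * (- d / B ^+ 2) * d + (- d / B ^+ 2) ^+ 2 * B ^+ 2 =
  (A ^+ 2 * B ^+ 2 - d ^+ 2) / B ^+ 2 by field.
rewrite pmulr_lge0 ?invr_gt0 ?exprn_gt0 //.
have AB0 : 0 <= A * B by exact: mulr_ge0.
rewrite -exprMn; nra.
Qed.

Lemma cdot_le u v : inL2 a u -> inL2 a v -> cdot u v <= wnorm a u * wnorm a v.
Proof.
move=> hu hv; apply: discriminant_le; [exact: wnorm_ge0|exact: wnorm_ge0|].
by move=> t; rewrite -wnormD_sqr // sqr_ge0.
Qed.

Lemma wnormD u v : inL2 a u -> inL2 a v ->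
  wnorm a (fun x => u x + v x) <= wnorm a u + wnorm a v.
Proof.
move=> hu hv; have A0 := wnorm_ge0 u; have B0 := wnorm_ge0 v.
rewrite -(@ler_pXn2r _ 2) ?nnegrE ?addr_ge0 ?wnorm_ge0 //.
have := wnormD_sqr 1 hu hv.
rewrite (_ : (fun x => _) = (fun x => u x + v x)); last first.
  by apply/funext => x; rewrite !mul1r; case: (v x).
by move=> ->; have := cdot_le hu hv; nra.
Qed.

Lemma wnormN u : wnorm a (fun x => - u x) = wnorm a u.
Proof.
by congr (Num.sqrt (fine _)); apply: eq_integral => x _; rewrite /cabs2 /= !sqrrN.
Qed.

Lemma wnormB u v : inL2 a u -> inL2 a v -> wnorm a (csub u v) <= wnorm a u + wnorm a v.
Proof. by move=> hu hv; have := wnormD hu (inL2N hv); rewrite wnormN. Qed.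

Lemma wnorm_dist u v z : inL2 a u -> inL2 a v -> inL2 a z ->
  wnorm a (csub u z) <= wnorm a (csub u v) + wnorm a (csub v z).
Proof.
move=> hu hv hz; have := wnormD (inL2B hu hv) (inL2B hv hz).
by congr (wnorm a _ <= _); apply/funext => x; rewrite /csub addrA subrK.
Qed.

Lemma wnorm_csubC u v : wnorm a (csub u v) = wnorm a (csub v u).
Proof. by rewrite -wnormN; congr (wnorm a _); apply/funext => x; rewrite /csub opprB. Qed.

Lemma wint2_ae u v : cmeasurable u -> cmeasurable v -> u = v %[ae mu] -> wint2 a u = wint2 a v.
Proof.
move=> mu_ mv uv.
have uv' : ae_eq mu setT (fun x => (cabs2 (u x) * W x ^+ 2)%:E)
                         (fun x => (cabs2 (v x) * W x ^+ 2)%:E).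
  by apply: aeS uv => x h _; rewrite h.
apply: ge0_ae_eq_integral => //.
- by apply/measurable_EFinP; exact: (measurable_cabs2W mu_).
- by apply/measurable_EFinP; exact: (measurable_cabs2W mv).
- by move=> x _; rewrite lee_fin mulr_ge0 ?sqr_ge0 ?cabs2_ge0.
- by move=> x _; rewrite lee_fin mulr_ge0 ?sqr_ge0 ?cabs2_ge0.
Qed.

Lemma wnorm0_ae u : inL2 a u -> wnorm a u = 0 -> u = (fun=> 0) %[ae mu].
Proof.
move=> hu u0; have := hu.1 => mu_.
have w0 : wint2 a u = 0%E.
  rewrite wint2E // -wnorm_sqr // u0; congr EFin; ring.
have : ae_eq mu setT (fun x => (cabs2 (u x) * W x ^+ 2)%:E) (cst 0%E).
  apply/(ae_eq_integral_abs mu measurableT).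
    by apply/measurable_EFinP; exact: (measurable_cabs2W mu_).
  rewrite -w0; apply: eq_integral => x _.
  by rewrite /= ger0_norm // mulr_ge0 ?sqr_ge0 ?cabs2_ge0.
apply: filterS => x /(_ I) /= [] /eqP; rewrite mulf_eq0 orbC sqrf_eq0 gt_eqF ?Wt_gt0 //=.
move=> h _; move: h; rewrite /cabs2 paddr_eq0 ?sqr_ge0 // !sqrf_eq0.
by case: (u x) => y z /= /andP[/eqP-> /eqP->].
Qed.

(** A spare factor [1 + x^2] pays for integrability; pointwise polynomial estimates return to L2 in
    this way. *)
Lemma wint2_le_pointwise u K : cmeasurable u ->
  (forall x, (1 + x ^+ 2) * cabs2 (u x) * W x ^+ 2 <= K) ->
  inL2 a u /\ wnorm a u ^+ 2 <= K * pi.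
Proof.
move=> mu_ hK.
have hle f : measurable_fun setT f -> (forall x, `|f x| <= cabs2 (u x)) -> wint a f.
  move=> mf fu; apply: (@ri_dom _ K); first exact: measurable_mulW.
  move=> x; rewrite ler_pdivlMr ?oneDsqr_gt0 //; apply: le_trans (hK x).
  rewrite normrM [`|W x ^+ 2|]ger0_norm ?sqr_ge0 // mulrC mulrA.
  by rewrite ler_wpM2r ?sqr_ge0 // ler_wpM2l // ltW // oneDsqr_gt0.
have [m1 m2] := mu_.
have hu : inL2 a u.
  apply/inL2P; split; split => //; apply: hle; try exact: measurable_funX;
    by move=> x; rewrite ger0_norm ?sqr_ge0 // /cabs2 ?lerDl ?lerDr sqr_ge0.
split => //; rewrite wnorm_sqr // -wED; [|by case: ((inL2P u).1 hu) => -[] |by case: ((inL2P u).1 hu) => _ []].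
apply: Rintegral_dom; first exact: measurable_cabs2W.
move=> x; rewrite ler_pdivlMr ?oneDsqr_gt0 // ger0_norm; last by rewrite mulr_ge0 ?sqr_ge0 ?cabs2_ge0.
by rewrite mulrC mulrA.
Qed.

End L2.

(** * Orthogonal projections onto polynomials, and the seminorms built from distances *)

Section Projection.
Context {R : realType} (a : R).
Hypothesis ha : 1 < a.
Local Notation W := (Wt a).
Implicit Types (p q r e : {poly R}) (f g h : R -> R) (u v : R -> (R * R)%type).

Lemma horner_eq0 p : (forall c, p.[c] = 0) -> p = 0.
Proof.
move=> p0; apply: (@roots_geq_poly_eq0 _ p [seq i%:R | i <- iota 0 (size p)]).
- by apply/allP => x _; apply/rootP.
- by rewrite map_inj_uniq ?iota_uniq // => i j /eqP; rewrite eqr_nat => /eqP.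
- by rewrite size_map size_iota.
Qed.

(** If the norm vanished, [weighted_nikolskii] with [M = j = 0] would force [p] to vanish at every
    point. *)
Lemma wE_sqr_gt0 p : p != 0 -> 0 < wE a (fun x => p.[x] ^+ 2).
Proof.
move=> p0; rewrite lt_def wE_sqr_ge0 andbT; apply: contra p0 => /eqP E0.
apply/eqP/horner_eq0 => c.
have [C [S [_ hC]]] := weighted_nikolskii ha 0 0.
have := hC (size p) p (leqnSn _) c; rewrite E0 mulr0 expr0 mul1r derivn0 => h.
have : p.[c] ^+ 2 * W c ^+ 2 == 0.
  by rewrite eq_le h mulr_ge0 ?sqr_ge0.
by rewrite mulf_eq0 orbC sqrf_eq0 gt_eqF ?Wt_gt0 //= sqrf_eq0 => /eqP.
Qed.

Definition pdot p q : R := wE a (horner (p * q)).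

Lemma pdotDl p q r : pdot (p + q) r = pdot p r + pdot q r.
Proof.
rewrite /pdot -wED; [|exact: wint_poly|exact: wint_poly].
by congr (wE a _); apply/funext => x; rewrite mulrDl hornerD.
Qed.

Lemma pdotZl c p r : pdot (c *: p) r = c * pdot p r.
Proof.
rewrite /pdot -wEZ; last exact: wint_poly.
by congr (wE a _); apply/funext => x; rewrite -scalerAl hornerZ.
Qed.

Lemma pdotC p q : pdot p q = pdot q p. Proof. by rewrite /pdot mulrC. Qed.

Lemma pdotDr p q r : pdot r (p + q) = pdot r p + pdot r q.
Proof. by rewrite pdotC pdotDl !(pdotC r). Qed.

Lemma pdotZr c p r : pdot r (c *: p) = c * pdot r p.
Proof. by rewrite pdotC pdotZl (pdotC r). Qed.

Lemma pdot_gt0 p : p != 0 -> 0 < pdot p p.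
Proof.
move=> /wE_sqr_gt0; congr (0 < wE a _); apply/funext => x.
by rewrite hornerM expr2.
Qed.

Lemma size_reduce n e q : (size e <= n.+1)%N -> (size q <= n.+1)%N -> e`_n != 0 ->
  (size (q - (q`_n / e`_n) *: e)%R <= n)%N.
Proof.
move=> se sq en; apply/leq_sizeP => j; rewrite leq_eqVlt => /predU1P[<-|nj].
  by rewrite coefB coefZ divfK // subrr.
by rewrite coefB coefZ (nth_default _ (leq_trans sq nj)) (nth_default _ (leq_trans se nj)) mulr0 subrr.
Qed.

(** A Gram-Schmidt step: the induction hypothesis is used for [L] and for the functional
    [pdot 'X^n]. The latter yields [e], monic of degree [n] and orthogonal to lower degrees, and a
    multiple of [e] corrects the value on the new degree. *)
Lemma poly_riesz n (L : {poly R} -> R) :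
  (forall p q, L (p + q) = L p + L q) -> (forall c p, L (c *: p) = c * L p) ->
  exists2 p : {poly R}, (size p <= n)%N &
    forall q, (size q <= n)%N -> pdot p q = L q.
Proof.
elim: n L => [|n IH] L LD LZ.
  exists 0; rewrite ?size_poly0 // => q; rewrite leqn0 size_poly_eq0 => /eqP->.
  by rewrite -(scale0r (0 : {poly R})) pdotZl LZ !mul0r.
have [p sp hp] := IH L LD LZ.
have [e0 se0 he0] := IH (pdot 'X^n) (fun p q => pdotDr p q _) (fun c p => pdotZr c p _).
set e := 'X^n - e0.
have en : e`_n = 1 by rewrite /e coefB coefXn eqxx nth_default // subr0.
have en0 : e`_n != 0 by rewrite en oner_eq0.
have e_neq0 : e != 0 by apply: contraNneq en0 => ->; rewrite coef0.
have se : (size e <= n.+1)%N.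
  rewrite /e (leq_trans (size_polyD _ _)) // geq_max size_polyXn leqnn size_polyN.
  exact: leqW.
have eo q : (size q <= n)%N -> pdot e q = 0.
  by move=> sq; rewrite /e pdotDl -scaleN1r pdotZl he0 // mulN1r subrr.
have ee := pdot_gt0 e_neq0.
exists (p + (L e / pdot e e) *: e).
  rewrite (leq_trans (size_polyD _ _)) // geq_max leqW //=.
  by rewrite (leq_trans (size_scale_leq _ _)).
move=> q sq; have sr := size_reduce se sq en0; rewrite en divr1 in sr.
set r := q - q`_n *: e in sr *.
have Eq : q = q`_n *: e + r by rewrite /r addrC subrK.
move: (q`_n) Eq {sq} => t Eq; rewrite {}Eq; clearbody e r.
rewrite !pdotDl !pdotZl !pdotDr !pdotZr LD LZ (hp _ sr) (pdotC p e).
rewrite (eo _ sr) (eo _ sp).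
by field; rewrite gt_eqF.
Qed.

(** Orthogonality of the residual is the definition, so that partial sums of an orthonormal
    expansion qualify directly. *)
Definition isproj n f p : Prop := (size p <= n)%N /\
  forall q, (size q <= n)%N -> wE a (fun x => (f x - p.[x]) * q.[x]) = 0.

Lemma exists_proj n f : rL2 a f -> exists p, isproj n f p.
Proof.
move=> hf; have hq q : wint a (fun x => f x * q.[x]).
  exact: rL2M hf (rL2_poly ha q).
have [p sp hp] := @poly_riesz n (fun q => wE a (fun x => f x * q.[x]))
  ltac:(by move=> p q; rewrite -wED //; congr (wE a _); apply/funext => x; rewrite hornerD mulrDr)
  ltac:(by move=> c p; rewrite -wEZ //; congr (wE a _); apply/funext => x; rewrite hornerZ mulrCA).
exists p; split => // q sq.
rewrite (_ : (fun x => _) = (fun x => f x * q.[x] - p.[x] * q.[x])); last first.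
  by apply/funext => x; rewrite mulrBl.
rewrite wEB //; last exact: rL2M (rL2_poly ha p) (rL2_poly ha q).
rewrite -hp // /pdot (_ : (fun x => p.[x] * q.[x]) = horner (p * q)) ?subrr //.
by apply/funext => x; rewrite hornerM.
Qed.

Lemma isproj_pythagoras n f p q : rL2 a f -> isproj n f p -> (size q <= n)%N ->
  wE a (fun x => (f x - q.[x]) ^+ 2) =
  wE a (fun x => (f x - p.[x]) ^+ 2) + wE a (fun x => (p - q).[x] ^+ 2).
Proof.
move=> hf [sp hp] sq.
have hfp := rL2B hf (rL2_poly ha p); have hpq := rL2_poly ha (p - q).
have := hp (p - q); rewrite (leq_trans (size_polyD _ _)) ?geq_max ?sp ?size_polyN // => /(_ isT) h0.
have hm := rL2M hfp hpq.
have : wE a (fun x => (f x - q.[x]) ^+ 2) =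
  wE a (fun x => (f x - p.[x]) ^+ 2) + 2 * wE a (fun x => (f x - p.[x]) * (p - q).[x])
   + wE a (fun x => (p - q).[x] ^+ 2).
  rewrite -wEZ // -wED; [|by case: hfp|exact: wintZ].
  rewrite -wED; [|by apply: wintD; [case: hfp|exact: wintZ]|by case: hpq].
  by congr (wE a _); apply/funext => x; rewrite hornerD hornerN; ring.
by rewrite h0 mulr0 addr0.
Qed.

Lemma distPi_le u n p q : (size p <= n)%N -> (size q <= n)%N ->
  distPi a u n <= wnorm a (csub u (cpoly p q)).
Proof.
move=> sp sq; apply: ge_inf; last by exists p, q.
by exists 0 => _ [p' [q' [_ _ ->]]]; exact: wnorm_ge0.
Qed.

Lemma le_distPi u n (b : R) : (forall p q, (size p <= n)%N -> (size q <= n)%N ->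
  b <= wnorm a (csub u (cpoly p q))) -> b <= distPi a u n.
Proof.
move=> h; apply: lb_le_inf.
  by exists (wnorm a (csub u (cpoly 0 0))); exists 0, 0; rewrite size_poly0.
by move=> _ [p [q [sp sq ->]]]; exact: h.
Qed.

Lemma distPi_ge0 u n : 0 <= distPi a u n.
Proof. by apply: le_distPi => p q _ _; exact: wnorm_ge0. Qed.

Lemma distPi_mono u m n : (m <= n)%N -> distPi a u n <= distPi a u m.
Proof.
by move=> mn; apply: le_distPi => p q sp sq; apply: distPi_le; exact: leq_trans mn.
Qed.

(** The weight is real, so the two components are projected separately; Pythagoras in each shows
    that the infimum is attained. *)
Lemma distPi_proj n u p q : inL2 a u ->
  isproj n (fun x => (u x).1) p -> isproj n (fun x => (u x).2) q ->
  distPi a u n = wnorm a (csub u (cpoly p q)).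
Proof.
move=> hu hp hq; have [u1 u2] := (inL2P a u).1 hu.
apply/eqP; rewrite eq_le distPi_le /=; [|by case: hp|by case: hq].
apply: le_distPi => p' q' sp' sq'.
rewrite -(@ler_pXn2r _ 2) ?nnegrE ?wnorm_ge0 //.
have hc p0 q0 : inL2 a (csub u (cpoly p0 q0)) by apply: inL2B => //; exact: inL2_cpoly.
rewrite !wnorm_sqr //= (isproj_pythagoras u1 hp sp') (isproj_pythagoras u2 hq sq').
by rewrite lerD // lerDl wE_sqr_ge0.
Qed.

Lemma csub_cpoly p q p' q' : csub (cpoly p q) (cpoly p' q') = cpoly (p - p') (q - q').
Proof. by apply/funext => x; rewrite /csub /cpoly !hornerD !hornerN. Qed.

Lemma distPiB u v n : inL2 a u -> inL2 a v ->
  distPi a (csub u v) n <= distPi a u n + distPi a v n.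
Proof.
move=> hu hv; have [u1 u2] := (inL2P a u).1 hu; have [v1 v2] := (inL2P a v).1 hv.
have [p1 h1] := exists_proj n u1; have [p2 h2] := exists_proj n u2.
have [q1 k1] := exists_proj n v1; have [q2 k2] := exists_proj n v2.
rewrite (distPi_proj hu h1 h2) (distPi_proj hv k1 k2).
have sB p q : (size p <= n)%N -> (size q <= n)%N -> (size (p - q)%R <= n)%N.
  by move=> sp sq; rewrite (leq_trans (size_polyD _ _)) // geq_max size_polyN sp.
apply: le_trans (distPi_le _ (sB _ _ h1.1 k1.1) (sB _ _ h2.1 k2.1)) _.
have hc w p q : inL2 a w -> inL2 a (csub w (cpoly p q)).
  by move=> hw; apply: inL2B => //; exact: inL2_cpoly.
apply: le_trans (wnormB (hc _ p1 p2 hu) (hc _ q1 q2 hv)).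
rewrite (_ : csub (csub u v) _ = csub (csub u (cpoly p1 p2)) (csub v (cpoly q1 q2))) //.
apply/funext => x; rewrite -csub_cpoly /csub.
by rewrite !opprB addrACA [RHS]addrACA; congr (_ + _); rewrite addrC.
Qed.

(** [fine] sends infinities to [0], so finiteness comes first: above by membership, below by the
    nonnegative term at [0]. *)
Lemma inLra_qra u k n : inLra a u -> n%:R ^+ k * distPi a u n <= qra a k u.
Proof.
move=> [_ /(_ k) hk]; rewrite -lee_fin fineK.
  by apply: ereal_sup_ubound; exists n.
rewrite ge0_fin_numE //; apply: le_trans (ereal_sup_ubound _); last by exists 0%N.
by rewrite lee_fin mulr_ge0 ?exprn_ge0 ?distPi_ge0.
Qed.

Lemma qra_ge0 u k : inLra a u -> 0 <= qra a k u.
Proof.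
by move=> hu; apply: le_trans (inLra_qra k 0 hu); rewrite mulr_ge0 ?exprn_ge0 ?distPi_ge0.
Qed.

Lemma qra_le u k K : (forall n, n%:R ^+ k * distPi a u n <= K) ->
  (qraE a k u < +oo)%E /\ qra a k u <= K.
Proof.
move=> h.
have hK : (qraE a k u <= K%:E)%E by apply: ge_ereal_sup => _ [n _ <-]; rewrite lee_fin.
have fin : (qraE a k u < +oo)%E by rewrite (le_lt_trans hK) // ltry.
split => //; rewrite -lee_fin fineK //.
rewrite ge0_fin_numE //; apply: le_trans (ereal_sup_ubound _); last by exists 0%N.
by rewrite lee_fin mulr_ge0 ?exprn_ge0 ?distPi_ge0.
Qed.

Lemma inLraB u v : inLra a u -> inLra a v -> inLra a (csub u v).
Proof.
move=> hu hv; split; first by apply: inL2B => //; [case: hu|case: hv].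
move=> k; apply: (proj1 (@qra_le _ k (qra a k u + qra a k v) _)) => n.
apply: le_trans (lerD (inLra_qra k n hu) (inLra_qra k n hv)).
by rewrite -mulrDr ler_wpM2l ?exprn_ge0 // distPiB; [|case: hu|case: hv].
Qed.

(** For [n <= N] the distance is at most the norm of the error, which is [distPi a u N], and
    [n^k N <= N^(k+1)]. For [n > N] the projection lies in the approximating space and drops out,
    and [n^k N <= n^(k+1)]. One seminorm index thus buys the rate [1/N]. *)
Lemma qra_partial_sum N k u p q : (0 < N)%N -> inLra a u ->
  isproj N (fun x => (u x).1) p -> isproj N (fun x => (u x).2) q ->
  qra a k (csub (cpoly p q) u) <= qra a k.+1 u / N%:R.
Proof.
move=> N0 hu hp hq; have N0' : 0 < N%:R :> R by rewrite ltr0n.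
apply: (proj2 (@qra_le _ k _ _)) => n; rewrite ler_pdivlMr //.
have [nN|Nn] := leqP n N.
  apply: le_trans (inLra_qra k.+1 N hu).
  rewrite [N%:R ^+ k.+1]exprSr -!mulrA; apply: ler_pM.
  - by rewrite exprn_ge0.
  - by rewrite mulr_ge0 ?distPi_ge0.
  - by rewrite lerXn2r ?nnegrE // ler_nat.
  rewrite mulrC ler_wpM2l // (distPi_proj hu.1 hp hq).
  have := @distPi_le (csub (cpoly p q) u) n 0 0; rewrite size_poly0 => /(_ isT isT).
  rewrite [wnorm a (csub (csub _ _) _)](_ : _ = wnorm a (csub u (cpoly p q))) //.
  rewrite [RHS]wnorm_csubC; congr (wnorm a _); apply/funext => x.
  by rewrite /csub /cpoly /= !horner0 subr0.
apply: le_trans (inLra_qra k.+1 n hu).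
rewrite [n%:R ^+ k.+1]exprSr -!mulrA ler_wpM2l ?exprn_ge0 //.
rewrite mulrC; apply: ler_pM => //; first by exact: distPi_ge0.
  by rewrite ler_nat ltnW.
apply: le_distPi => p' q' sp' sq'.
have sB r r' : (size r <= N)%N -> (size r' <= n)%N -> (size (r - r')%R <= n)%N.
  move=> sr sr'; rewrite (leq_trans (size_polyD _ _)) // geq_max size_polyN sr' andbT.
  by rewrite (leq_trans sr) // ltnW.
apply: le_trans (distPi_le _ (sB _ _ hp.1 sp') (sB _ _ hq.1 sq')) _.
have -> : csub (csub (cpoly p q) u) (cpoly (p - p') (q - q')) = csub (cpoly p' q') u.
  by apply/funext => x; rewrite -csub_cpoly /csub opprB addrC addrA subrK.
by rewrite [leLHS]wnorm_csubC.
Qed.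

(** [P n] has exact degree [n], so subtracting a multiple of it lowers the degree. *)
Lemma span_orthonormal (P : nat -> {poly R}) (L : {poly R} -> R) N :
  (forall n, size (P n) = n.+1) ->
  (forall p q, L (p + q) = L p + L q) -> (forall c p, L (c *: p) = c * L p) ->
  (forall n, (n < N)%N -> L (P n) = 0) -> forall q, (size q <= N)%N -> L q = 0.
Proof.
move=> sP LD LZ; elim: N => [|N IH] hL q sq.
  by move: sq; rewrite leqn0 size_poly_eq0 => /eqP->; rewrite -(scale0r (0 : {poly R})) LZ mul0r.
have PN0 : (P N)`_N != 0.
  have -> : (P N)`_N = lead_coef (P N) by rewrite lead_coefE sP.
  by rewrite lead_coef_eq0 -size_poly_eq0 sP.
have sPN : (size (P N) <= N.+1)%N by rewrite sP.
have := size_reduce sPN sq PN0; set c := _ / _ => sr.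
rewrite -[q](subrK (c *: P N)) LD LZ hL // mulr0 addr0 IH // => n nN.
by apply: hL; exact: leqW.
Qed.

Lemma isproj_expansion (P : nat -> {poly R}) f N :
  (forall n, size (P n) = n.+1) ->
  (forall m n, wE a (fun x => (P m).[x] * (P n).[x]) = (m == n)%:R) ->
  rL2 a f ->
  isproj N f (\sum_(n < N) wE a (fun x => f x * (P n).[x]) *: P n).
Proof.
move=> sP oP hf; set S := \sum_(n < N) _; split.
  apply: (leq_trans (size_sum _ _ _)); apply/bigmax_leqP => i _.
  by rewrite (leq_trans (size_scale_leq _ _)) // sP.
have hS := rL2B hf (rL2_poly ha S).
have hq q := rL2M hS (rL2_poly ha q).
apply: (@span_orthonormal P _ N sP).
- by move=> p q; rewrite -wED //; congr (wE a _); apply/funext => x; rewrite hornerD mulrDr.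
- by move=> c p; rewrite -wEZ //; congr (wE a _); apply/funext => x; rewrite hornerZ mulrCA.
move=> n nN; have hfn := rL2M hf (rL2_poly ha (P n)).
rewrite (_ : (fun x => _) = (fun x => f x * (P n).[x] - (S * P n).[x])); last first.
  by apply/funext => x; rewrite hornerM mulrBl.
rewrite wEB //; last exact: wint_poly.
rewrite -/(pdot S (P n)) /S.
have -> : forall (I : Type) (s : seq I) (F : I -> {poly R}) r,
    pdot (\sum_(i <- s) F i) r = \sum_(i <- s) pdot (F i) r.
  move=> I s F r; elim: s => [|i s IH]; last by rewrite !big_cons pdotDl IH.
  by rewrite !big_nil -(scale0r (0 : {poly R})) pdotZl mul0r.
rewrite (bigD1 (Ordinal nN)) //= big1 ?addr0 => [|i].
  rewrite pdotZl [pdot _ _](_ : _ = 1) ?mulr1 ?subrr //.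
  transitivity ((n == n)%:R : R); last by rewrite eqxx.
  rewrite -oP; congr (wE a _); apply/funext => x; exact: hornerM.
rewrite -val_eqE /= => /negbTE ni; rewrite pdotZl [pdot _ _](_ : _ = 0) ?mulr0 //.
transitivity (((i : nat) == n)%:R : R); last by rewrite ni.
by rewrite -oP; congr (wE a _); apply/funext => x; exact: hornerM.
Qed.

End Projection.

(** * The space of smooth functions *)

Section Jets.
Context {R : realType}.

(** Explicit candidates for all derivatives; [derive1n_jet] identifies them afterwards, so iterated
    derivatives never have to be computed. *)
Definition jet (V : normedModType R) (U : nat -> R -> V) : Prop :=
  forall j x, is_derive x (1 : R) (U j) (U j.+1 x).

Lemma derive1n_jet (V : normedModType R) (U : nat -> R -> V) j :
  jet U -> derive1n j (U 0%N) = U j.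
Proof.
move=> hU; elim: j => // j IH; rewrite derive1nS IH; apply/funext => x.
by rewrite derive1E; exact: (@derive_val _ _ _ _ _ _ _ (hU j x)).
Qed.

Lemma jet_smooth (U : nat -> @cfun R) : jet U -> smooth (U 0%N).
Proof.
by move=> hU j x; rewrite derive1n_jet //; exact: (@ex_derive _ _ _ _ _ _ _ (hU j x)).
Qed.

Lemma smooth_jet (f : @cfun R) : smooth f -> jet (fun j => derive1n j f).
Proof. by move=> hf j x; apply: DeriveDef; [exact: hf|rewrite -derive1E]. Qed.

Lemma is_derive_pairP (f : R -> (R * R)%type) (x : R) (d : (R * R)%type) :
  is_derive x (1 : R) f d <->
  is_derive x (1 : R) (fun y => (f y).1) d.1 /\ is_derive x (1 : R) (fun y => (f y).2) d.2.
Proof.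
split=> [[cf df]|[[c1 d1] [c2 d2]]].
  have hf : (fun h : R => h^-1 *: ((f \o shift x) (h *: 1) - f x)) @ 0^' --> d.
    by rewrite -df; exact: cf.
  have h1 : (fun h : R => h^-1 *: (((fun y => (f y).1) \o shift x) (h *: 1) - (f x).1)) @ 0^' --> d.1.
    exact: (cvg_comp _ _ hf cvg_fst).
  have h2 : (fun h : R => h^-1 *: (((fun y => (f y).2) \o shift x) (h *: 1) - (f x).2)) @ 0^' --> d.2.
    exact: (cvg_comp _ _ hf cvg_snd).
  split; apply: DeriveDef.
  - by apply/cvg_ex; exists d.1.
  - exact/cvg_lim.
  - by apply/cvg_ex; exists d.2.
  - exact/cvg_lim.
have h1 : (fun h : R => h^-1 *: (((fun y => (f y).1) \o shift x) (h *: 1) - (f x).1)) @ 0^' --> d.1.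
  by rewrite -d1; exact: c1.
have h2 : (fun h : R => h^-1 *: (((fun y => (f y).2) \o shift x) (h *: 1) - (f x).2)) @ 0^' --> d.2.
  by rewrite -d2; exact: c2.
have hf : (fun h : R => h^-1 *: ((f \o shift x) (h *: 1) - f x)) @ 0^' --> d.
  have := cvg_pair h1 h2; rewrite (surjective_pairing d); exact.
apply: DeriveDef; first by apply/cvg_ex; exists d.
exact/cvg_lim.
Qed.

Lemma jet_pairP (U : nat -> R -> (R * R)%type) :
  jet U <-> jet (fun j x => (U j x).1) /\ jet (fun j x => (U j x).2).
Proof.
split=> [h|[h1 h2] j x]; last by apply/is_derive_pairP.
by split=> j x; have /is_derive_pairP[] := h j x.
Qed.

Lemma jetB (V : normedModType R) (U U' : nat -> R -> V) :
  jet U -> jet U' -> jet (fun j x => U j x - U' j x).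
Proof. by move=> h h' j x; have := is_deriveB (h j x) (h' j x). Qed.

Lemma isdM (u v : R -> R) (x du dv : R) : is_derive x (1 : R) u du ->
  is_derive x (1 : R) v dv ->
  is_derive x (1 : R) (fun y => u y * v y) (du * v x + u x * dv).
Proof.
move=> hu hv; have h := is_deriveM hu hv; apply: is_derive_eq h _.
by rewrite /GRing.scale /= addrC [v x * du]mulrC.
Qed.

Lemma isdD (u v : R -> R) (x du dv : R) : is_derive x (1 : R) u du ->
  is_derive x (1 : R) v dv -> is_derive x (1 : R) (fun y => u y + v y) (du + dv).
Proof. by move=> hu hv; exact: is_deriveD. Qed.

Lemma isdZ (u : R -> R) (k x du : R) : is_derive x (1 : R) u du ->
  is_derive x (1 : R) (fun y => k * u y) (k * du).
Proof. by move=> hu; exact: is_deriveZ. Qed.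

Lemma jet_poly (p : {poly R}) : jet (fun j => horner p^`(j) : R -> R).
Proof. by move=> j x; rewrite derivnS; exact: is_derive_poly. Qed.

Lemma jet_cpoly (p q : {poly R}) : jet (fun j => cpoly p^`(j) q^`(j)).
Proof. by apply/jet_pairP; split; exact: jet_poly. Qed.

Lemma derive1n_cpoly j (p q : {poly R}) : derive1n j (cpoly p q) = cpoly p^`(j) q^`(j).
Proof. by rewrite (derive1n_jet j (jet_cpoly p q)). Qed.

Lemma is_derive_continuous (u : R -> R) (x d : R) : is_derive x (1 : R) u d -> {for x, continuous u}.
Proof. by move=> h; apply/differentiable_continuous/derivable1_diffP; exact: ex_derive. Qed.

Lemma jet_continuous (U : nat -> R -> R) (j : nat) : jet U -> continuous (U j).
Proof. by move=> hU x; apply: is_derive_continuous (hU j x). Qed.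

Lemma smoothB (f g : @cfun R) : smooth f -> smooth g ->
  smooth (csub f g) /\ forall j, derive1n j (csub f g) = csub (derive1n j f) (derive1n j g).
Proof.
move=> /smooth_jet hf /smooth_jet hg; have h := jetB hf hg.
by split; [exact: (jet_smooth h)|move=> j; exact: (derive1n_jet j h)].
Qed.

Lemma smooth_cmeasurable (f : @cfun R) j : smooth f -> cmeasurable (derive1n j f).
Proof.
move=> /smooth_jet /jet_pairP[h1 h2].
have c1 : continuous (fun x : R => (derive1n j f x).1) := jet_continuous h1.
have c2 : continuous (fun x : R => (derive1n j f x).2) := jet_continuous h2.
by split; exact: continuous_measurable_fun.
Qed.

(** A quadratic remainder estimate survives pointwise limits, unlike differentiability itself;
    limits of Cauchy sequences inherit their derivatives through it. *)
Lemma is_derive_quadratic (u : R -> R) (x d B : R) :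
  (forall y, `|y - x| <= 1 -> `|u y - u x - (y - x) * d| <= B * (y - x) ^+ 2) ->
  is_derive x (1 : R) u d.
Proof.
move=> h.
have hc : (fun t : R => t^-1 *: ((u \o shift x) (t *: 1) - u x)) @ 0^' --> d.
  apply/cvgrPdist_lt => e e0; near=> t.
  have t0 : t != 0 by near: t; exact: nbhs_dnbhs_neq.
  have t1 : `|t| <= 1.
    near: t; apply: dnbhs0_le; exact: ltr01.
  have te : `|t| < e / (`|B| + 1).
    by near: t; apply: dnbhs0_lt; rewrite divr_gt0 // ltr_wpDl.
  rewrite /= distrC [t *: 1]mulr1.
  have -> : t^-1 *: (u (t + x) - u x) - d = t^-1 * (u (t + x) - u x - (t + x - x) * d).
    by rewrite addrK mulrBr mulKf.
  rewrite normrM normfV ltr_pdivrMl ?normr_gt0 //.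
  apply: (le_lt_trans (h (t + x) _)); rewrite addrK //.
  rewrite -(real_normK (num_real t)).
  have t0' : 0 < `|t| by rewrite normr_gt0.
  rewrite expr2 mulrA mulrC ltr_pM2l //.
  have B1 : 0 < `|B| + 1 by rewrite ltr_wpDl.
  apply: (@le_lt_trans _ _ ((`|B| + 1) * `|t|)).
    by rewrite ler_wpM2r // (le_trans (ler_norm B)) // lerDl.
  by rewrite mulrC -ltr_pdivlMr.
apply: DeriveDef; first by apply/cvg_ex; exists d.
exact/cvg_lim.
Unshelve. all: by end_near. Qed.

Lemma mean_value (u du : R -> R) (x y : R) :
  (forall z, is_derive z (1 : R) u (du z)) ->
  exists2 c, `|c - x| <= `|y - x| & u y - u x = du c * (y - x).
Proof.
move=> hu; have cu (s t : R) : {within `[s, t], continuous u}.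
  by apply: continuous_subspaceT => z; apply: is_derive_continuous (hu z).
have [xy|yx] := leP x y.
  have [c] := MVT_segment xy (fun z _ => hu z) (cu x y).
  rewrite in_itv /= => /andP[c1 c2] E; exists c => //.
  by rewrite !ger0_norm ?subr_ge0 // lerD2r.
have [c] := MVT_segment (ltW yx) (fun z _ => hu z) (cu y x).
rewrite in_itv /= => /andP[c1 c2] E; exists c.
  by rewrite !ler0_norm ?subr_le0 // ?(ltW yx) // lerN2 lerD2r.
by rewrite -(opprB (u x)) E -mulrN opprB.
Qed.

Lemma second_order_remainder (u du ddu : R -> R) (x y B : R) :
  (forall z, is_derive z (1 : R) u (du z)) ->
  (forall z, is_derive z (1 : R) du (ddu z)) ->
  (forall z, `|z - x| <= `|y - x| -> `|ddu z| <= B) ->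
  `|u y - u x - (y - x) * du x| <= B * (y - x) ^+ 2.
Proof.
move=> hu hdu hB; have [c cx ->] := mean_value x y hu.
have [e ec E] := mean_value x c hdu.
rewrite [(y - x) * _]mulrC -mulrBl E normrM normrM.
have hBe : `|ddu e| <= B by apply: hB; exact: le_trans cx.
rewrite -(real_normK (num_real (y - x))) expr2 mulrA ler_wpM2r // ler_pM //.
Qed.

End Jets.

(** * Point values controlled by weighted norms *)

Section Sobolev.
Context {R : realType}.
Local Notation mu := (@lebesgue_measure R).

(** The derivative of [(x - (c + 1)) u^2] integrates to [u(c)^2]: the linear factor is [0] at the
    right end, [-1] at the left end, and of modulus at most [1] between them. *)
Lemma sobolev_unit (u du : R -> R) (c : R) :
  (forall z, is_derive z (1 : R) u (du z)) -> continuous du ->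
  ((u c ^+ 2)%:E <= \int[mu]_(x in `[c, (c + 1)%R]) (2 * u x ^+ 2 + du x ^+ 2)%:E)%E.
Proof.
move=> hu cdu.
have cu : continuous u by move=> z; apply: is_derive_continuous (hu z).
pose F (x : R) := (x - (c + 1)) * u x ^+ 2.
pose f (x : R) := u x ^+ 2 + (x - (c + 1)) * (2 * u x * du x).
have dF (x : R) : is_derive x (1 : R) F (f x).
  have h1 : is_derive x (1 : R) (fun y : R => y - (c + 1)) 1.
    have := is_deriveB (is_derive_id x (1 : R)) (is_derive_cst (c + 1) x (1 : R)).
    by rewrite subr0.
  have h3 := isdM h1 (isdM (hu x) (hu x)).
  by apply: is_derive_eq h3 _; rewrite /f; ring.
have cf : continuous f.
  move=> x; apply: cvgD; first by apply: cvgM; exact: cu.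
  apply: cvgM; first by apply: cvgB; [exact: cvg_id|exact: cvg_cst].
  by apply: cvgM; [apply: cvgM; [exact: cvg_cst|exact: cu]|exact: cdu].
have c1 : c < c + 1 by rewrite ltrDl.
have E : (\int[mu]_(x in `[c, (c + 1)%R]) (f x)%:E = (u c ^+ 2)%:E)%E.
  rewrite (@continuous_FTC2 _ f F) //.
  - rewrite /F -EFinB; congr EFin; ring.
  - exact: continuous_subspaceT.
  - split; first by move=> x _; apply: ex_derive.
    + apply: cvg_at_right_filter; exact: is_derive_continuous (dF c).
    + apply: cvg_at_left_filter; exact: is_derive_continuous (dF (c + 1)).
  - by move=> x _; rewrite derive1E; exact: derive_val.
rewrite -E.
have ii (h : R -> R) : continuous h -> mu.-integrable `[c, (c + 1)%R] (EFin \o h).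
  move=> ch; apply: continuous_compact_integrable; first exact: segment_compact.
  exact: continuous_subspaceT.
have cg : continuous (fun x => 2 * u x ^+ 2 + du x ^+ 2).
  move=> x; apply: cvgD; last by apply: cvgM; exact: cdu.
  by apply: cvgM; [exact: cvg_cst|apply: cvgM; exact: cu].
apply: le_integral => //; [exact: ii|exact: ii|].
move=> x; rewrite inE /= in_itv /= => /andP[x1 x2]; rewrite lee_fin /f.
have : 0 <= (u x + (x - (c + 1)) * - du x) ^+ 2 by exact: sqr_ge0.
have : 0 <= (1 - (x - (c + 1)) ^+ 2) * du x ^+ 2 by rewrite mulr_ge0 ?sqr_ge0 //; nra.
nra.
Qed.

Lemma sobolev_weighted (a M : R) : 1 < a -> exists2 C, 0 <= C &
  forall u du : R -> R, (forall z, is_derive z (1 : R) u (du z)) -> continuous du ->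
  rL2 a u -> rL2 a du -> forall c, `|c| <= M ->
  u c ^+ 2 <= C * (wE a (fun x => u x ^+ 2) + wE a (fun x => du x ^+ 2)).
Proof.
(* On [[c, c + 1]] with [|c| <= M] the weight is at least its value at [M + 1]. *)
move=> ha; pose K := Wt a (M + 1) ^+ 2.
have K0 : 0 < K by rewrite exprn_gt0 // Wt_gt0.
exists (2 / K); first by rewrite divr_ge0 // ltW.
move=> u du hu cdu [mu_ iu] [md id_] c cM.
pose g x := 2 * u x ^+ 2 + du x ^+ 2.
have g0 x : 0 <= g x by rewrite /g; nneg.
have mg : measurable_fun setT g.
  by apply: measurable_funD; [apply: measurable_funM => //|]; exact: measurable_funX.
have ig : wint a g by apply: wintD => //; exact: wintZ.
have gE : wE a g <= 2 * (wE a (fun x => u x ^+ 2) + wE a (fun x => du x ^+ 2)).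
  rewrite wED //; last exact: wintZ.
  rewrite wEZ // mulrDr lerD2l ler_peMl ?ler1n // wE_ge0 // => x; exact: sqr_ge0.
have M0 : 0 <= M by apply: le_trans cM.
have mi : measurable (`[c, (c + 1)%R]%classic : set R) by exact: measurable_itv.
have h : (K%:E * (u c ^+ 2)%:E <= (wE a g)%:E)%E.
  rewrite EFin_wE //.
  apply: (@le_trans _ _ (\int[mu]_(x in `[c, (c + 1)%R]) (g x * Wt a x ^+ 2)%:E)%E).
    apply: (@le_trans _ _ (K%:E * \int[mu]_(x in `[c, (c + 1)%R]) (g x)%:E)%E).
      by rewrite lee_pmul2l // ?lte_fin //; exact: sobolev_unit.
    rewrite -ge0_integralZl //.
    - apply: ge0_le_integral => //.
      + by move=> x _; rewrite -EFinM lee_fin mulr_ge0 // ltW.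
      + apply/measurable_EFinP; apply: measurable_funTS; exact: measurable_funM.
      + apply/measurable_EFinP; apply: measurable_funTS; exact: measurable_mulW.
      + move=> x /=; rewrite in_itv /= => /andP[x1 x2].
        rewrite -EFinM lee_fin mulrC; apply: ler_wpM2l; first exact: g0.
        rewrite /K; apply: lerXn2r; [exact: ltW (Wt_gt0 _ _)|exact: ltW (Wt_gt0 _ _)|].
        apply: Wt_anti => //; rewrite [leRHS]ger0_norm; last by lra.
        by move: cM; rewrite !ler_norml => /andP[? ?]; apply/andP; split; lra.
    - by apply/measurable_EFinP; apply: measurable_funTS.
    - by move=> x _; rewrite lee_fin.
    - by rewrite lee_fin ltW.
  apply: ge0_subset_integral => //.
  - by apply/measurable_EFinP; exact: measurable_mulW.
  - by move=> x _; rewrite lee_fin mulr_ge0 ?sqr_ge0.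
rewrite -EFinM lee_fin in h.
rewrite -mulrA mulrCA -(ler_pM2l K0) [leRHS]mulrA divff ?gt_eqF // mul1r.
by apply: le_trans gE.
Qed.

End Sobolev.

(** * Limits of sequences, Fatou, and almost everywhere equality of continuous functions *)

Section Sequences.
Context {R : realType}.
Local Notation mu := (@lebesgue_measure R).
Implicit Types (u v : nat -> R) (l : R).

Lemma cvg_seqP u l : u @ \oo --> l <->
  (forall e : R, 0 < e -> exists N : nat, forall n, (N <= n)%N -> `|u n - l| < e).
Proof.
split=> [/cvgrPdist_lt h e e0|h].
  by have [N _ hN] := h _ e0; exists N => n nN; rewrite distrC; exact: hN.
apply/cvgrPdist_lt => e e0; have [N hN] := h _ e0.
by exists N => // n nN; rewrite distrC; exact: hN.
Qed.

Lemma cvg_norm_le_from u l (K : R) N : u @ \oo --> l ->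
  (forall n, (N <= n)%N -> `|u n| <= K) -> `|l| <= K.
Proof.
move=> /cvg_seqP hu hK; apply/ler_addgt0Pr => e e0; have [N' hN'] := hu _ e0.
have n1 : (N <= maxn N N')%N by exact: leq_maxl.
have n2 : (N' <= maxn N N')%N by exact: leq_maxr.
have -> : l = u (maxn N N') - (u (maxn N N') - l) by ring.
by rewrite (le_trans (ler_normB _ _)) // lerD ?hK // ltW // hN'.
Qed.

Lemma real_cauchy_cvg u :
  (forall e : R, 0 < e -> exists N : nat, forall m n, (N <= m)%N -> (N <= n)%N -> `|u m - u n| < e) ->
  exists l : R, u @ \oo --> l.
Proof.
move=> h; apply/cvg_ex; apply/cauchy_cvgP/cauchy_ballP => e e0.
have [N hN] := h _ e0.
exists (u @` [set n | (N <= n)%N], u @` [set n | (N <= n)%N]).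
  by split; exists N => // n nN; exists n.
by move=> [_ _] /= [[m hm <-] [n hn <-]]; rewrite /ball /=; exact: hN.
Qed.

Lemma cvg0_le (u v : nat -> R) : (forall n, 0 <= u n <= v n) -> v @ \oo --> (0 : R) ->
  u @ \oo --> (0 : R).
Proof.
move=> huv /cvg_seqP hv; apply/cvg_seqP => e e0; have [N hN] := hv e e0.
exists N => n nN; have /andP[u0 uv] := huv n; have := hN n nN.
rewrite !subr0 (ger0_norm u0) ger0_norm; first exact: le_lt_trans.
exact: le_trans uv.
Qed.

Lemma fatou_wint2 (a K : R) (us : nat -> @cfun R) (u : @cfun R) :
  (forall n, cmeasurable (us n)) ->
  (forall x, (fun n => (us n x).1) @ \oo --> (u x).1) ->
  (forall x, (fun n => (us n x).2) @ \oo --> (u x).2) ->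
  (forall n, (wint2 a (us n) <= K%:E)%E) -> (wint2 a u <= K%:E)%E.
Proof.
move=> mus h1 h2 hK.
pose F n x := (cabs2 (us n x) * Wt a x ^+ 2)%:E.
have hF x : F ^~ x @ \oo --> (cabs2 (u x) * Wt a x ^+ 2)%:E.
  apply: cvg_EFin; first by near=> n.
  rewrite (_ : fine \o F^~ x = fun n => cabs2 (us n x) * Wt a x ^+ 2) //.
  by apply: cvgM; [apply: cvgD; apply: cvgM|exact: cvg_cst].
have := @fatou _ _ _ mu setT measurableT F.
have mF n : measurable_fun setT (F n).
  by apply/measurable_EFinP; exact: measurable_cabs2W.
have F0 n x : setT x -> (0 <= F n x)%E.
  by move=> _; rewrite lee_fin mulr_ge0 ?sqr_ge0 ?cabs2_ge0.
move=> /(_ mF F0) h.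
have -> : wint2 a u = (\int[mu]_x limn_einf (F^~ x))%E.
  apply: eq_integral => x _; rewrite is_cvg_limn_einfE; last by apply/cvg_ex; eexists; exact: hF.
  by apply/esym/cvg_lim => //; exact: hF.
apply: (le_trans h); rewrite limn_einf_lim.
set I := fun n => _; have -> : limn (einfs I) = ereal_sup (range (einfs I)).
  by apply/cvg_lim => //; exact: cvg_einfs_sup.
apply: ge_ereal_sup => _ [n _ <-].
by apply: (le_trans _ (hK n)); apply: ereal_inf_lbound; exists n => //=.
Unshelve. all: by end_near. Qed.

(** A point where the functions differ has a whole ball of such points, and a ball has positive
    measure. *)
Lemma ae_eq_continuous (f g : R -> R) : continuous f -> continuous g ->
  f = g %[ae mu] -> f = g.
Proof.
move=> cf cg [A [mA A0 hA]]; apply/funext => x; apply/eqP; apply: contrapT => /negP fg.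
have h0 : f x - g x != 0 by rewrite subr_eq0.
have ch : {for x, continuous (fun y => f y - g y)} by apply: cvgB; [exact: cf|exact: cg].
have /nbhs_ballP[e /= e0 he] : \forall y \near x, f y - g y != 0.
  exact: (ch _ (open_nbhs_nbhs (conj (@open_neq _ 0) h0))).
have bA : ball x e `<=` A.
  move=> y /he hy; apply: hA => /= /(_ I) E; move: hy; by rewrite E subrr eqxx.
have : (mu (ball x e) <= mu A)%E by apply: le_measure; rewrite ?inE //; exact: measurable_ball.
by rewrite A0 lebesgue_measure_ball ?(ltW e0) // lee_fin leNgt pmulrn_lgt0 // e0.
Qed.

End Sequences.

(** * Convergence and completeness in the space of smooth functions *)

Section Frechet.
Context {R : realType} (a : R).
Hypothesis ha : 1 < a.
Local Notation mu := (@lebesgue_measure R).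
Implicit Types (f g : @cfun R) (fs : nat -> @cfun R).

Lemma inCinfB f g : inCinf a f -> inCinf a g -> inCinf a (csub f g).
Proof.
move=> [sf hf] [sg hg]; have [s h] := smoothB sf sg; split => // j.
by rewrite h; exact: inL2B.
Qed.

Lemma sobolev_cfun (M : R) : exists2 C, 0 <= C & forall f, inCinf a f ->
  forall j c, `|c| <= M -> cabs2 (derive1n j f c) <= C * (qC a j f ^+ 2 + qC a j.+1 f ^+ 2).
Proof.
have [C C0 hC] := sobolev_weighted M ha; exists C => // f [sf hf] j c cM.
have /jet_pairP[j1 j2] := smooth_jet sf.
have [a1 a2] := (inL2P a _).1 (hf j); have [b1 b2] := (inL2P a _).1 (hf j.+1).
rewrite /qC !wnorm_sqr //.
have := hC _ _ (j1 j) (jet_continuous (j := j.+1) j1) a1 b1 c cM.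
have := hC _ _ (j2 j) (jet_continuous (j := j.+1) j2) a2 b2 c cM.
by rewrite /cabs2; lra.
Qed.

Lemma cabs_le (z : (R * R)%type) e : 0 <= e -> cabs2 z <= e ^+ 2 -> cabs z <= e.
Proof. by move=> e0 h; rewrite /cabs -[leRHS](ger0_norm e0) -sqrtr_sqr ler_wsqrtr. Qed.

Lemma norm1_cabs2 (z : (R * R)%type) e : 0 <= e -> cabs2 z <= e ^+ 2 -> `|z.1| <= e /\ `|z.2| <= e.
Proof.
move=> e0 h; split; rewrite -(@ler_pXn2r _ 2) ?nnegrE // real_normK ?num_real //;
  apply: le_trans h; by rewrite /cabs2 ?lerDl ?lerDr sqr_ge0.
Qed.

Lemma compact_norm_le (K : set R) : compact K -> exists M, forall x, K x -> `|x| <= M.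
Proof.
move=> /compact_bounded [M [_ hM]]; exists (M + 1) => x Kx; apply: hM => //.
by rewrite ltrDl.
Qed.

Lemma Cinf_cvg_ucc fs f : (forall n, inCinf a (fs n)) -> inCinf a f ->
  conv_in (qC a) fs f -> forall j, ucc (fun n => derive1n j (fs n)) (derive1n j f).
Proof.
move=> hfs hf hc j K cK e e0; have [M hM] := compact_norm_le cK.
have [C C0 hC] := sobolev_cfun M.
(* With both seminorms below [min d e], their squares are at most [d e], and
   [2 C d e < 2 (C + 1) d e = e^2]. *)
pose d := e / (2 * (C + 1)).
have d0 : 0 < d by rewrite divr_gt0 // mulr_gt0 // ltr_wpDl.
pose d' := Num.min d e; have d'0 : 0 < d' by rewrite lt_min d0.
have [N1 h1] := (cvg_seqP _ _).1 (hc j) d' d'0.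
have [N2 h2] := (cvg_seqP _ _).1 (hc j.+1) d' d'0.
exists (maxn N1 N2) => n; rewrite geq_max => /andP[n1 n2] x Kx.
have := hC _ (inCinfB (hfs n) hf) j x (hM x Kx).
have [_ ->] := smoothB (hfs n).1 hf.1; rewrite {1}/csub => h.
have {h1} := h1 n n1; have {h2} := h2 n n2; rewrite !subr0.
set A := qC a j.+1 _ in h *; set B := qC a j _ in h *.
have A0 : 0 <= A by exact: wnorm_ge0.
have B0 : 0 <= B by exact: wnorm_ge0.
rewrite !ger0_norm // => hA hB.
have A2 : A ^+ 2 <= d * e.
  rewrite expr2; apply: ler_pM => //; apply: ltW; apply: lt_le_trans hA _; rewrite /d' ge_min lexx ?orbT //.
have B2 : B ^+ 2 <= d * e.
  rewrite expr2; apply: ler_pM => //; apply: ltW; apply: lt_le_trans hB _; rewrite /d' ge_min lexx ?orbT //.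
have C1 : 0 < C + 1 by rewrite ltr_wpDl.
have : C * (B ^+ 2 + A ^+ 2) < e ^+ 2.
  have hd : d * (2 * (C + 1)) = e by rewrite /d divfK // gt_eqF // mulr_gt0.
  apply: (@le_lt_trans _ _ (C * (2 * d * e))); first by apply: ler_wpM2l => //; lra.
  have -> : e ^+ 2 = C * (2 * d * e) + 2 * d * e by rewrite expr2 -{1}hd; ring.
  by rewrite ltrDl; apply: mulr_gt0 => //; apply: mulr_gt0.
move=> hlt; rewrite /cabs -[ltRHS](ger0_norm (ltW e0)) -sqrtr_sqr.
by rewrite ltr_sqrt ?exprn_gt0 //; apply: le_lt_trans hlt.
Qed.

Lemma Cinf_separated f : inCinf a f -> (forall j, qC a j f = 0) -> f = (fun=> 0).
Proof.
move=> hf h0; apply/funext => x; have [C C0 hC] := sobolev_cfun `|x|.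
have := hC f hf 0%N x (lexx _); rewrite !h0 derive1n0 expr0n addr0 mulr0 => h.
have := cabs2_ge0 (f x); rewrite le_eqVlt ltNge h orbF eq_sym /cabs2 paddr_eq0 ?sqr_ge0 //.
by rewrite !sqrf_eq0; case: (f x) => y z /= /andP[/eqP-> /eqP->].
Qed.

Lemma qC_bounded fs j : (forall n, inCinf a (fs n)) -> cauchy_in (qC a) fs ->
  exists B N, 0 <= B /\ forall n, (N <= n)%N -> qC a j (fs n) <= B.
Proof.
move=> hfs hc; have [N hN] := hc j 1 ltr01.
exists (1 + qC a j (fs N)), N; split; first by rewrite addr_ge0 // wnorm_ge0.
move=> n nN; have := hN n N nN (leqnn N); rewrite /qC.
have [_ ->] := smoothB (hfs n).1 (hfs N).1.
have := wnormD (inL2B ((hfs n).2 j) ((hfs N).2 j)) ((hfs N).2 j).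
rewrite (_ : (fun x => _) = derive1n j (fs n)); last first.
  by apply/funext => x; rewrite /csub subrK.
by lra.
Qed.

(** The Sobolev bound gives pointwise limits of all derivatives. Local bounds two orders higher
    carry the second-order remainders to the limit, so these limits form a [jet]; Fatou in the
    second index then gives membership and convergence in norm. *)
Lemma Cinf_complete fs : (forall n, inCinf a (fs n)) -> cauchy_in (qC a) fs ->
  exists f, inCinf a f /\ conv_in (qC a) fs f.
Proof.
move=> hfs hc.
have jets n : jet (fun j => derive1n j (fs n)) := smooth_jet (hfs n).1.
have j1 n : jet (fun j x => (derive1n j (fs n) x).1) := ((jet_pairP _).1 (jets n)).1.
have j2 n : jet (fun j x => (derive1n j (fs n) x).2) := ((jet_pairP _).1 (jets n)).2.
have Dsub m n j : derive1n j (csub (fs m) (fs n)) = csub (derive1n j (fs m)) (derive1n j (fs n)).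
  by have [_ ->] := smoothB (hfs m).1 (hfs n).1.
have small j (c e : R) : 0 < e -> exists N : nat, forall m n, (N <= m)%N -> (N <= n)%N ->
   cabs2 (csub (derive1n j (fs m)) (derive1n j (fs n)) c) < e ^+ 2.
  move=> e0; have [C C0 hC] := sobolev_cfun `|c|.
  have C1 : 0 < C + 1 by rewrite ltr_wpDl.
  pose d := Num.min 1 (e ^+ 2 / (2 * (C + 1))).
  have d0 : 0 < d by rewrite lt_min ltr01 divr_gt0 // ?exprn_gt0 // mulr_gt0.
  have [N1 h1] := hc j d d0; have [N2 h2] := hc j.+1 d d0.
  exists (maxn N1 N2) => m n; rewrite !geq_max => /andP[m1 m2] /andP[n1 n2].
  have {h1} := h1 _ _ m1 n1; have {h2} := h2 _ _ m2 n2.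
  have := hC _ (inCinfB (hfs m) (hfs n)) j c (lexx _); rewrite Dsub.
  set A := qC a j.+1 _; set B := qC a j _ => h hA hB.
  have A0 : 0 <= A by exact: wnorm_ge0.
  have B0 : 0 <= B by exact: wnorm_ge0.
  have dle1 : d <= 1 by rewrite /d ge_min lexx.
  have dle : d <= e ^+ 2 / (2 * (C + 1)) by rewrite /d ge_min lexx orbT.
  have A2 : A ^+ 2 <= d by nra.
  have B2 : B ^+ 2 <= d by nra.
  apply: (le_lt_trans h); apply: (@le_lt_trans _ _ (C * (2 * d))).
    by apply: ler_wpM2l => //; lra.
  rewrite ler_pdivlMr ?mulr_gt0 // in dle; nra.
have ex1 j x : exists l : R, (fun n => (derive1n j (fs n) x).1) @ \oo --> l.
  apply: real_cauchy_cvg => e e0; have e20 : 0 < e / 2 by rewrite divr_gt0.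
  have [N hN] := small j x _ e20; exists N => m n hm hn.
  have [h _] := norm1_cabs2 (ltW e20) (ltW (hN m n hm hn)).
  by move: h; rewrite /csub /= => h; apply: (le_lt_trans h); lra.
have ex2 j x : exists l : R, (fun n => (derive1n j (fs n) x).2) @ \oo --> l.
  apply: real_cauchy_cvg => e e0; have e20 : 0 < e / 2 by rewrite divr_gt0.
  have [N hN] := small j x _ e20; exists N => m n hm hn.
  have [_ h] := norm1_cabs2 (ltW e20) (ltW (hN m n hm hn)).
  by move: h; rewrite /csub /= => h; apply: (le_lt_trans h); lra.
pose g1 j x := projT1 (cid (ex1 j x)); pose g2 j x := projT1 (cid (ex2 j x)).
have c1 j x : (fun n => (derive1n j (fs n) x).1) @ \oo --> g1 j x := projT2 (cid (ex1 j x)).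
have c2 j x : (fun n => (derive1n j (fs n) x).2) @ \oo --> g2 j x := projT2 (cid (ex2 j x)).
have bnd j (M : R) : exists (B : R) (N : nat), forall n c, (N <= n)%N -> `|c| <= M ->
    `|(derive1n j (fs n) c).1| <= B /\ `|(derive1n j (fs n) c).2| <= B.
  have [C C0 hC] := sobolev_cfun M.
  have [B1 [N1 [B10 h1]]] := qC_bounded j hfs hc.
  have [B2 [N2 [B20 h2]]] := qC_bounded j.+1 hfs hc.
  exists ((C + 1) * (B1 + B2)), (maxn N1 N2) => n c.
  rewrite geq_max => /andP[n1 n2] cM; apply: norm1_cabs2.
    by rewrite mulr_ge0 // addr_ge0.
  apply: (le_trans (hC _ (hfs n) j c cM)).
  have := h1 n n1; have := h2 n n2.
  have := wnorm_ge0 a (derive1n j (fs n)); have := wnorm_ge0 a (derive1n j.+1 (fs n)).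
  rewrite -/(qC a j (fs n)) -/(qC a j.+1 (fs n)).
  move: (qC a j (fs n)) (qC a j.+1 (fs n)) => s t t0 s0 tB sB.
  have st : s ^+ 2 + t ^+ 2 <= (B1 + B2) ^+ 2 by nra.
  rewrite exprMn; apply: ler_pM => //; last by nra.
  by rewrite addr_ge0 ?sqr_ge0.
have jg1 : jet g1.
  move=> j x; have [B [N hB]] := bnd j.+2 (`|x| + 1).
  apply: (@is_derive_quadratic _ _ _ _ B) => y yx.
  apply: (@cvg_norm_le_from _ (fun n => (derive1n j (fs n) y).1 - (derive1n j (fs n) x).1
     - (y - x) * (derive1n j.+1 (fs n) x).1) _ _ N).
    by apply: cvgB; [apply: cvgB; exact: c1|apply: cvgM; [exact: cvg_cst|exact: c1]].
  move=> n nN; apply: (second_order_remainder (j1 n j) (j1 n j.+1)) => z zx.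
  apply: (proj1 (hB n z nN _)); have -> : z = x + (z - x) by ring.
  by rewrite (le_trans (ler_normD _ _)) // lerD2l (le_trans zx).
have jg2 : jet g2.
  move=> j x; have [B [N hB]] := bnd j.+2 (`|x| + 1).
  apply: (@is_derive_quadratic _ _ _ _ B) => y yx.
  apply: (@cvg_norm_le_from _ (fun n => (derive1n j (fs n) y).2 - (derive1n j (fs n) x).2
     - (y - x) * (derive1n j.+1 (fs n) x).2) _ _ N).
    by apply: cvgB; [apply: cvgB; exact: c2|apply: cvgM; [exact: cvg_cst|exact: c2]].
  move=> n nN; apply: (second_order_remainder (j2 n j) (j2 n j.+1)) => z zx.
  apply: (proj2 (hB n z nN _)); have -> : z = x + (z - x) by ring.
  by rewrite (le_trans (ler_normD _ _)) // lerD2l (le_trans zx).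
pose g j x := (g1 j x, g2 j x).
have jg : jet g by apply/jet_pairP.
have sg : smooth (g 0%N) := jet_smooth jg.
have Dg j : derive1n j (g 0%N) = g j by exact: derive1n_jet.
have mg j : cmeasurable (g j) by rewrite -Dg; exact: smooth_cmeasurable.
have mf n j : cmeasurable (derive1n j (fs n)) := smooth_cmeasurable j (hfs n).1.
have msub (u v : @cfun R) : cmeasurable u -> cmeasurable v -> cmeasurable (csub u v).
  by move=> [? ?] [? ?]; split; exact: measurable_funB.
have key j (e : R) : 0 < e -> exists N : nat, forall n, (N <= n)%N ->
    (wint2 a (csub (derive1n j (fs n)) (g j)) <= (e ^+ 2)%:E)%E.
  move=> e0; have [N hN] := hc j e e0; exists N => n nN.
  (* Starting at index [N] makes every term obey the Cauchy bound, as Fatou is stated with a bound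
     at all indices. *)
  apply: (@fatou_wint2 _ a _ (fun m => csub (derive1n j (fs n)) (derive1n j (fs (N + m)%N)))).
  - by move=> m; exact: msub.
  - move=> x; apply: cvgB; first exact: cvg_cst.
    by have := c1 j x; rewrite -(cvg_shiftn N); under eq_fun do rewrite addnC.
  - move=> x; apply: cvgB; first exact: cvg_cst.
    by have := c2 j x; rewrite -(cvg_shiftn N); under eq_fun do rewrite addnC.
  move=> m; have := hN n (N + m)%N nN (leq_addr _ _); rewrite /qC Dsub => h.
  have hi := inL2B ((hfs n).2 j) ((hfs (N + m)%N).2 j).
  rewrite wint2E // -wnorm_sqr // lee_fin.
  by rewrite lerXn2r ?nnegrE ?wnorm_ge0 // ltW.
have inL j : exists N : nat, forall n, (N <= n)%N -> inL2 a (csub (derive1n j (fs n)) (g j)).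
  have [N hN] := key j 1 ltr01; exists N => n nN; split; first exact: msub.
  by apply: (le_lt_trans (hN n nN)); rewrite ltry.
have inLg j : inL2 a (g j).
  have [N hN] := inL j; have := inL2B ((hfs N).2 j) (hN N (leqnn N)).
  rewrite (_ : csub _ _ = g j) //; apply/funext => x.
  by rewrite /csub opprB addrC subrK.
have inCg : inCinf a (g 0%N) by split => // j; rewrite Dg.
exists (g 0%N); split => // j; apply/cvg_seqP => e e0.
have e20 : 0 < e / 2 by rewrite divr_gt0.
have [N hN] := key j _ e20; exists N => n nN.
rewrite subr0 ger0_norm ?wnorm_ge0 // /qC.
have [_ ->] := smoothB (hfs n).1 sg; rewrite Dg.
have hi := inL2B ((hfs n).2 j) (inLg j).
have := hN n nN; rewrite wint2E // -wnorm_sqr // lee_fin.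
rewrite ler_pXn2r ?nnegrE ?wnorm_ge0 //; last exact: ltW.
by move/le_lt_trans; apply; lra.
Qed.

Lemma smooth_ae_eq f g : smooth f -> smooth g -> f = g %[ae mu] -> f = g.
Proof.
move=> /smooth_jet/jet_pairP[f1 f2] /smooth_jet/jet_pairP[g1 g2] fg.
have E1 : (fun x => (f x).1) = (fun x => (g x).1).
  apply: ae_eq_continuous; [exact: (jet_continuous (j := 0%N) f1)|exact: (jet_continuous (j := 0%N) g1)|].
  by apply: aeS fg => x h _; rewrite h.
have E2 : (fun x => (f x).2) = (fun x => (g x).2).
  apply: ae_eq_continuous; [exact: (jet_continuous (j := 0%N) f2)|exact: (jet_continuous (j := 0%N) g2)|].
  by apply: aeS fg => x h _; rewrite h.
apply/funext => x; rewrite (surjective_pairing (f x)) (surjective_pairing (g x)).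
by congr (_, _); [have := congr1 (@^~ x) E1|have := congr1 (@^~ x) E2].
Qed.

End Frechet.

(** * Rapidly approximable functions *)

Section RapidApprox.
Context {R : realType} (a : R).
Hypothesis ha : 1 < a.
Local Notation mu := (@lebesgue_measure R).
Local Notation W := (Wt a).
Implicit Types (f g : @cfun R) (fs gs : nat -> @cfun R).

(** The square root of the weight in [weighted_nikolskii], so that bounds concern absolute values
    and can be summed. *)
Definition kap (M : nat) (c : R) : R := Num.sqrt ((1 + c ^+ 2) ^+ M) * W c.

Lemma kap_gt0 M c : 0 < kap M c.
Proof. by rewrite mulr_gt0 ?Wt_gt0 // sqrtr_gt0 exprn_gt0 // oneDsqr_gt0. Qed.

Lemma kap_sqr M c : kap M c ^+ 2 = (1 + c ^+ 2) ^+ M * W c ^+ 2.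
Proof. by rewrite exprMn sqr_sqrtr // exprn_ge0 // ltW // oneDsqr_gt0. Qed.

Lemma norm_le_sqr (x y : R) : 0 <= y -> x ^+ 2 <= y ^+ 2 -> `|x| <= y.
Proof. by move=> y0 h; rewrite -(@ler_pXn2r _ 2) ?nnegrE // real_normK ?num_real. Qed.

Lemma nikolskii_kap M j : exists (C : R) (S : nat), 0 <= C /\
  forall n (p : {poly R}), (size p <= n.+1)%N -> forall c : R,
  `|kap M c * p^`(j).[c]| <= C * n.+1%:R ^+ S * Num.sqrt (wE a (fun x => p.[x] ^+ 2)).
Proof.
have [C [S [C0 h]]] := weighted_nikolskii ha M j.
exists (Num.sqrt C), S; split; first exact: sqrtr_ge0.
move=> n p sp c; have m1 : 1 <= n.+1%:R :> R by rewrite ler1n.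
have mS : 1 <= n.+1%:R ^+ S :> R by rewrite exprn_ege1.
have E0 := wE_sqr_ge0 a (horner p).
apply: norm_le_sqr; first by rewrite !mulr_ge0 ?sqrtr_ge0 ?exprn_ge0.
rewrite exprMn kap_sqr mulrAC 2!exprMn !sqr_sqrtr //.
apply: le_trans (h n p sp c) _; rewrite ler_wpM2r // ler_wpM2l //.
by rewrite expr2 ler_peMl // (le_trans ler01).
Qed.

Definition isprojs f (p q : nat -> {poly R}) : Prop :=
  forall n, isproj a n (fun x => (f x).1) (p n) /\ isproj a n (fun x => (f x).2) (q n).

Lemma exists_projs f : inL2 a f -> exists p q : nat -> {poly R}, isprojs f p q.
Proof.
move=> /inL2P[h1 h2].
have [p hp] := choice (fun n => exists_proj ha n h1).
by have [q hq] := choice (fun n => exists_proj ha n h2); exists p, q.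
Qed.

(** Telescoping: [1 / k^2 <= 2 (1/k - 1/(k+1))], so the induction carries a difference of
    reciprocals. *)
Lemma sum_inv_sqr (u : nat -> R) (A : R) : 0 <= A ->
  (forall n, `|u n.+1 - u n| <= A / n.+1%:R ^+ 2) ->
  forall n m, (n <= m)%N -> `|u m - u n| <= 2 * A / n.+1%:R.
Proof.
move=> A0 hu n m nm.
suff : `|u m - u n| <= 2 * A * (n.+1%:R^-1 - m.+1%:R^-1).
  move/le_trans; apply; apply: ler_wpM2l; first by nneg.
  by rewrite gerBl invr_ge0.
elim: m nm => [|m IH]; first by rewrite leqn0 => /eqP->; rewrite !subrr normr0 mulr0.
rewrite leq_eqVlt => /predU1P[<-|]; first by rewrite !subrr normr0 mulr0.
rewrite ltnS => /IH {}IH.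
have -> : u m.+1 - u n = (u m.+1 - u m) + (u m - u n) by ring.
apply: (le_trans (ler_normD _ _)); apply: le_trans (lerD (hu m) IH) _.
have k1 : 1 <= m.+1%:R :> R by rewrite ler1n.
have -> : m.+2%:R = m.+1%:R + 1 :> R by rewrite -natr1.
move: (m.+1%:R : R) k1 => k k1.
have k0 : 0 < k by apply: lt_le_trans k1.
have kk : 0 < k + 1 by rewrite addr_gt0.
rewrite addrC -lerBrDl -mulrBr.
have -> : n.+1%:R^-1 - (k + 1)^-1 - (n.+1%:R^-1 - k^-1) = (k * (k + 1))^-1.
  have -> : n.+1%:R^-1 - (k + 1)^-1 - (n.+1%:R^-1 - k^-1) = k^-1 - (k + 1)^-1 by ring.
  by field; rewrite !gt_eqF.
rewrite [2 * A]mulrC -!mulrA ler_wpM2l // ler_pdivlMr ?mulr_gt0 //.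
rewrite mulrC ler_pdivrMr ?exprn_gt0 //; nra.
Qed.

(** At [n = 0] the factor [n^k] may vanish, whence the term [qra a 0 f]; for [n >= 1],
    [n + 1 <= 2 n]. *)
Lemma distPi_weighted k f n : inLra a f ->
  n.+1%:R ^+ k * distPi a f n <= 2 ^+ k * (qra a 0 f + qra a k f).
Proof.
move=> hf; have q0 := qra_ge0 0 hf; have qk := qra_ge0 k hf.
have d0 := distPi_ge0 a f n.
case: n d0 => [|n] d0.
  rewrite expr1n mul1r; have := inLra_qra 0 0 hf; rewrite expr0 mul1r => h.
  apply: (le_trans h); rewrite -[leLHS]mul1r; apply: ler_pM => //; last by rewrite lerDl.
  by rewrite exprn_ege1 // ler1n.
apply: (@le_trans _ _ (2 ^+ k * (n.+1%:R ^+ k * distPi a f n.+1))); last first.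
  by rewrite ler_wpM2l ?exprn_ge0 // (le_trans (inLra_qra k n.+1 hf)) // lerDr.
rewrite mulrA -exprMn ler_wpM2r // lerXn2r ?nnegrE // -natrM ler_nat; lia.
Qed.

(** The increment from [p i] to [p (i+1)] has degree at most [i] and norm at most [2 distPi a f i].
    The Nikolskii bound loses [(i+1)^S], so the seminorm of index [S + 2] leaves the summable
    [1 / (i+1)^2]. That [A] and [k] do not depend on [f] is what later yields continuity. *)
Lemma projs_cauchy M j : exists (A : R) (k : nat), 0 <= A /\
  forall f p q, inLra a f -> isprojs f p q -> forall n m c, (n <= m)%N ->
  `|kap M c * ((p m)^`(j).[c] - (p n)^`(j).[c])| <= A * (qra a 0 f + qra a k f) / n.+1%:R /\
  `|kap M c * ((q m)^`(j).[c] - (q n)^`(j).[c])| <= A * (qra a 0 f + qra a k f) / n.+1%:R.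
Proof.
have [C [S [C0 hC]]] := nikolskii_kap M j.
exists (2 * (C * (2 * 2 ^+ S.+2))), S.+2; split; first by nneg.
move=> f p q hf hpq n m c nm.
set Q := qra a 0 f + qra a _ f; have Q0 : 0 <= Q by rewrite addr_ge0 // qra_ge0.
have hstep (e1 : {poly R}) i : (size e1 <= i.+1)%N -> Num.sqrt (wE a (fun x => e1.[x] ^+ 2)) <=
    2 * distPi a f i -> `|kap M c * e1^`(j).[c]| <= C * (2 * 2 ^+ S.+2) * Q / i.+1%:R ^+ 2.
  move=> se he; apply: (le_trans (hC i e1 se c)).
  have i0 : 0 < i.+1%:R ^+ 2 :> R by rewrite exprn_gt0.
  rewrite ler_pdivlMr //.
  apply: (@le_trans _ _ (C * i.+1%:R ^+ S * (2 * distPi a f i) * i.+1%:R ^+ 2)).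
    by rewrite ler_wpM2r // ?(ltW i0) // ler_wpM2l // mulr_ge0 // exprn_ge0.
  have -> : C * i.+1%:R ^+ S * (2 * distPi a f i) * i.+1%:R ^+ 2 =
     C * 2 * (i.+1%:R ^+ S.+2 * distPi a f i) by rewrite -[S.+2]addn2 exprD; ring.
  have -> : C * (2 * 2 ^+ S.+2) * Q = C * 2 * (2 ^+ S.+2 * Q) by ring.
  by apply: ler_wpM2l; [nneg|exact: distPi_weighted].
have sz (r : nat -> {poly R}) i : (forall l, (size (r l) <= l)%N) -> (size (r i.+1 - r i)%R <= i.+1)%N.
  by move=> sr; rewrite (leq_trans (size_polyD _ _)) // geq_max size_polyN sr leqW.
have hD i : wnorm a (cpoly (p i.+1 - p i) (q i.+1 - q i)) <= 2 * distPi a f i.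
  have hc e1 e2 : inL2 a (csub f (cpoly e1 e2)) by apply: inL2B; [exact: hf.1|exact: inL2_cpoly].
  have [h1 h2] := hpq i; have [h3 h4] := hpq i.+1.
  have -> : cpoly (p i.+1 - p i) (q i.+1 - q i) =
     csub (csub f (cpoly (p i) (q i))) (csub f (cpoly (p i.+1) (q i.+1))).
    apply/funext => x; rewrite -csub_cpoly /csub opprB.
    by rewrite [RHS]addrC addrA subrK.
  apply: (le_trans (wnormB (hc _ _) (hc _ _))).
  rewrite -(distPi_proj ha hf.1 h1 h2) -(distPi_proj ha hf.1 h3 h4).
  rewrite mulr2n mulrDl mul1r lerD2l; exact: distPi_mono.
have hpart i : Num.sqrt (wE a (fun x => (p i.+1 - p i).[x] ^+ 2)) <= 2 * distPi a f i /\
               Num.sqrt (wE a (fun x => (q i.+1 - q i).[x] ^+ 2)) <= 2 * distPi a f i.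
  have hc := inL2_cpoly ha (p i.+1 - p i) (q i.+1 - q i).
  have E1 := wE_sqr_ge0 a (horner (p i.+1 - p i)); have E2 := wE_sqr_ge0 a (horner (q i.+1 - q i)).
  split; apply: le_trans (hD i); rewrite -[leRHS](ger0_norm (wnorm_ge0 _ _)) -sqrtr_sqr;
    by rewrite ler_wsqrtr // wnorm_sqr //= ?lerDl ?lerDr.
have fin (r : nat -> {poly R}) : (forall l, (size (r l) <= l)%N) ->
   (forall i, Num.sqrt (wE a (fun x => (r i.+1 - r i).[x] ^+ 2)) <= 2 * distPi a f i) ->
   `|kap M c * ((r m)^`(j).[c] - (r n)^`(j).[c])| <= 2 * (C * (2 * 2 ^+ S.+2)) * Q / n.+1%:R.
  move=> sr hr.
  have A0 : 0 <= C * (2 * 2 ^+ S.+2) * Q by nneg.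
  rewrite mulrBr -(mulrA 2); apply: (sum_inv_sqr (u := fun i => kap M c * (r i)^`(j).[c]) A0) => // i.
  have := hstep _ i (sz r i sr) (hr i).
  by rewrite derivnB hornerD hornerN mulrBr.
by split; apply: fin => i; try exact: (hpart i).1; try exact: (hpart i).2;
  [exact: (hpq i).1.1|exact: (hpq i).2.1].
Qed.

Lemma inCinf_cpoly (p q : {poly R}) : inCinf a (cpoly p q).
Proof.
split=> [|j]; last by rewrite derive1n_cpoly; exact: inL2_cpoly.
exact: (jet_smooth (jet_cpoly p q)).
Qed.

Lemma wnorm_le_kap (u : @cfun R) (K : R) : 0 <= K -> cmeasurable u ->
  (forall c, `|kap 1 c * (u c).1| <= K) -> (forall c, `|kap 1 c * (u c).2| <= K) ->
  inL2 a u /\ wnorm a u <= Num.sqrt (2 * pi) * K.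
Proof.
move=> K0 mu_ h1 h2.
have sq (x : R) : `|x| <= K -> x ^+ 2 <= K ^+ 2.
  by move=> h; rewrite -(real_normK (num_real x)) lerXn2r ?nnegrE.
have [|hu hn] := @wint2_le_pointwise _ a u (2 * K ^+ 2) mu_.
  move=> x; rewrite /cabs2.
  have := sq _ (h1 x); have := sq _ (h2 x).
  by rewrite (exprMn 2 (kap 1 x) (u x).1) (exprMn 2 (kap 1 x) (u x).2) !kap_sqr expr1; lra.
split => //; have p0 : 0 <= 2 * pi :> R by rewrite mulr_ge0 // pi_ge0.
rewrite -(@ler_pXn2r _ 2) ?nnegrE ?wnorm_ge0 ?mulr_ge0 ?sqrtr_ge0 //.
by rewrite [leRHS]exprMn [Num.sqrt _ ^+ 2 in leRHS]sqr_sqrtr //; apply: (le_trans hn); lra.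
Qed.

(** By [projs_cauchy] the projections are Cauchy in every [qC], and completeness gives a smooth
    limit; they also tend to [f] in L2, which identifies that limit. *)
Lemma projs_cvg f p q : inLra a f -> isprojs f p q -> exists g,
  [/\ inCinf a g, g = f %[ae mu] & conv_in (qC a) (fun n => cpoly (p n) (q n)) g].
Proof.
move=> hf hpq; have hc n : inCinf a (cpoly (p n) (q n)) by exact: inCinf_cpoly.
have cau : cauchy_in (qC a) (fun n => cpoly (p n) (q n)).
  move=> j e e0; have [A [k [A0 hA]]] := projs_cauchy 1 j.
  set T := Num.sqrt (2 * pi) * (A * (qra a 0 f + qra a k f)).
  have T0 : 0 <= T by rewrite !mulr_ge0 ?sqrtr_ge0 // addr_ge0 // qra_ge0.
  have [N hN] : exists N : nat, T < e * N.+1%:R.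
    exists (Num.bound (T / e)); rewrite mulrC -ltr_pdivrMr //.
    apply: (@lt_trans _ _ (Num.bound (T / e))%:R); last by rewrite ltr_nat.
    by apply: archi_boundP; rewrite divr_ge0 // ltW.
  have key n m : (N <= n)%N -> (n <= m)%N ->
      qC a j (csub (cpoly (p m) (q m)) (cpoly (p n) (q n))) < e.
    move=> Nn nm; rewrite /qC csub_cpoly derive1n_cpoly.
    have K0 : 0 <= A * (qra a 0 f + qra a k f) / n.+1%:R.
      by rewrite divr_ge0 // mulr_ge0 // addr_ge0 // qra_ge0.
    have [_] := @wnorm_le_kap (cpoly (p m - p n)^`(j) (q m - q n)^`(j)) _ K0
       (proj1 (inL2_cpoly ha _ _))
       ltac:(by move=> c /=; rewrite derivnB hornerD hornerN; exact: (hA f p q hf hpq n m c nm).1)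
       ltac:(by move=> c /=; rewrite derivnB hornerD hornerN; exact: (hA f p q hf hpq n m c nm).2).
    move/le_lt_trans; apply; rewrite mulrA -/T ltr_pdivrMr ?ltr0n //.
    apply: (lt_le_trans hN); rewrite ler_wpM2l ?(ltW e0) // ler_nat ltnS //.
  exists N => m n hm hn; have [nm|mn] := leqP n m; first exact: key.
  have := key _ _ hm (ltnW mn); rewrite /qC !csub_cpoly !derive1n_cpoly.
  congr (_ < e); rewrite -wnormN; congr (wnorm a _); apply/funext => x.
  rewrite -[p m - p n]opprB -[q m - q n]opprB /cpoly !derivnN !hornerN.
  by [].
have [g [hg cg]] := Cinf_complete ha hc cau.
exists g; split => //.
have hgf : inL2 a (csub g f) by apply: inL2B; [exact: (hg.2 0%N)|exact: hf.1].
have z : wnorm a (csub g f) = 0.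
  apply/eqP; rewrite eq_le wnorm_ge0 andbT; apply/ler_addgt0Pr => e e0.
  have e20 : 0 < e / 2 by rewrite divr_gt0.
  have [N1 h1] := (cvg_seqP _ _).1 (cg 0%N) _ e20.
  pose N2 := Num.bound (qra a 1 f / (e / 2)).
  have hN2 : qra a 1 f < (e / 2) * N2%:R.
    rewrite mulrC -ltr_pdivrMr //; apply: archi_boundP; rewrite divr_ge0 ?(ltW e20) //.
    exact: qra_ge0.
  pose n := maxn N1 N2.+1.
  have := h1 n (leq_maxl _ _).
  rewrite subr0 ger0_norm ?wnorm_ge0 // /qC derive1n0 => hA.
  have nn : (N2.+1 <= n)%N by exact: leq_maxr.
  have n0 : 0 < n%:R :> R by rewrite ltr0n (leq_trans _ nn).
  have hB : wnorm a (csub f (cpoly (p n) (q n))) <= e / 2.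
    rewrite -(distPi_proj ha hf.1 (hpq n).1 (hpq n).2) -(ler_pM2l n0).
    apply: (le_trans _ (le_trans (ltW hN2) _)); first by have := inLra_qra 1 n hf; rewrite expr1.
    by rewrite mulrC ler_wpM2r ?(ltW e20) // ler_nat ltnW.
  have hcp := inL2_cpoly ha (p n) (q n).
  apply: (le_trans (wnorm_dist (hg.2 0%N) hcp hf.1)).
  rewrite derive1n0 [wnorm a (csub g _)]wnorm_csubC [wnorm a (csub _ f)]wnorm_csubC.
  by rewrite add0r; lra.
have := wnorm0_ae hgf z; apply: aeS => x h _.
by have := h I; rewrite /csub => /eqP; rewrite subr_eq0 => /eqP.
Qed.

(** The projection of index [0] is the zero polynomial, so [projs_cauchy] started there bounds all
    projections uniformly, and the bound passes to the pointwise limit. *)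
Lemma Lra_pointwise M j : exists (A : R) (k : nat), 0 <= A /\
  forall f g, inLra a f -> inCinf a g -> g = f %[ae mu] -> forall c,
  `|kap M c * (derive1n j g c).1| <= A * (qra a 0 f + qra a k f) /\
  `|kap M c * (derive1n j g c).2| <= A * (qra a 0 f + qra a k f).
Proof.
have [A [k [A0 hA]]] := projs_cauchy M j; exists A, k; split => // f g hf hg gf c.
have [p [q hpq]] := exists_projs hf.1.
have [g' [hg' gf' cg']] := projs_cvg hf hpq.
have <- : g' = g.
  apply: smooth_ae_eq; [exact: hg'.1|exact: hg.1|].
  by apply: aeS2 gf' gf => x h1 h2 _; rewrite h1 // h2.
have hp0 : p 0%N = 0 by apply/eqP; rewrite -size_poly_leq0; exact: (hpq 0%N).1.1.
have hq0 : q 0%N = 0 by apply/eqP; rewrite -size_poly_leq0; exact: (hpq 0%N).2.1.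
have hcv := Cinf_cvg_ucc ha (fun n => inCinf_cpoly (p n) (q n)) hg' cg' j (@compact_set1 _ c).
have hb n : `|kap M c * (p n)^`(j).[c]| <= A * (qra a 0 f + qra a k f) /\
            `|kap M c * (q n)^`(j).[c]| <= A * (qra a 0 f + qra a k f).
  have := hA f p q hf hpq 0%N n c (leq0n _).
  by rewrite hp0 hq0 linear0 horner0 !subr0 divr1.
have cabs_norm (z : (R * R)%type) : `|z.1| <= cabs z /\ `|z.2| <= cabs z.
  by split; rewrite /cabs -sqrtr_sqr ler_wsqrtr // /cabs2 ?lerDl ?lerDr sqr_ge0.
have c1 : (fun n => (p n)^`(j).[c]) @ \oo --> (derive1n j g' c).1.
  apply/cvg_seqP => e e0; have [N hN] := hcv e e0; exists N => n nN.
  have := hN n nN c erefl; rewrite derive1n_cpoly; apply: le_lt_trans.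
  by have [h _] := cabs_norm (cpoly (p n)^`(j) (q n)^`(j) c - derive1n j g' c); exact: h.
have c2 : (fun n => (q n)^`(j).[c]) @ \oo --> (derive1n j g' c).2.
  apply/cvg_seqP => e e0; have [N hN] := hcv e e0; exists N => n nN.
  have := hN n nN c erefl; rewrite derive1n_cpoly; apply: le_lt_trans.
  by have [_ h] := cabs_norm (cpoly (p n)^`(j) (q n)^`(j) c - derive1n j g' c); exact: h.
split.
  apply: (@cvg_norm_le_from _ (fun n => kap M c * (p n)^`(j).[c]) _ _ 0%N).
    by apply: cvgM; [exact: cvg_cst|exact: c1].
  by move=> n _; exact: (hb n).1.
apply: (@cvg_norm_le_from _ (fun n => kap M c * (q n)^`(j).[c]) _ _ 0%N).
  by apply: cvgM; [exact: cvg_cst|exact: c2].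
by move=> n _; exact: (hb n).2.
Qed.

Lemma Lra_sub_Cinf f : inLra a f -> exists g, inCinf a g /\ g = f %[ae mu].
Proof.
move=> hf; have [p [q hpq]] := exists_projs hf.1.
by have [g [? ? _]] := projs_cvg hf hpq; exists g.
Qed.

Lemma qra_le_sum i k f : inLra a f -> (i < k)%N -> qra a i f <= \sum_(l < k) qra a l f.
Proof.
move=> hf ik; rewrite (bigD1 (Ordinal ik)) //= lerDl.
by apply: sumr_ge0 => l _; exact: qra_ge0.
Qed.

Lemma sum_qra_ge0 k f : inLra a f -> 0 <= \sum_(l < k) qra a l f.
Proof. by move=> hf; apply: sumr_ge0 => l _; exact: qra_ge0. Qed.

Lemma Lra_Cinf_continuous j : exists (k : nat) (C : R), forall f g,
  inLra a f -> inCinf a g -> g = f %[ae mu] -> qC a j g <= C * \sum_(i < k) qra a i f.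
Proof.
have [A [k [A0 hA]]] := Lra_pointwise 1 j.
(* The sum must contain the index [k], and the factor [2] covers the two seminorms of
   [Lra_pointwise]. *)
exists k.+1, (Num.sqrt (2 * pi) * (A * 2)) => f g hf hg gf.
have K0 : 0 <= A * (qra a 0 f + qra a k f) by rewrite mulr_ge0 // addr_ge0 // qra_ge0.
have [_ h] := @wnorm_le_kap (derive1n j g) _ K0 (smooth_cmeasurable j hg.1)
  (fun c => (hA f g hf hg gf c).1) (fun c => (hA f g hf hg gf c).2).
apply: (le_trans h); rewrite -!mulrA ler_wpM2l ?sqrtr_ge0 // ler_wpM2l //.
rewrite mulr2n mulrDl mul1r lerD // qra_le_sum //.
Qed.

Lemma cvg_sum_qra k fs f : conv_in (qra a) fs f ->
  (fun n => \sum_(i < k) qra a i (csub (fs n) f)) @ \oo --> (0 : R).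
Proof.
move=> h; elim: k => [|k IH].
  by under eq_fun do rewrite big_ord0; exact: cvg_cst.
rewrite (_ : (fun n => _) = (fun n => \sum_(i < k) qra a i (csub (fs n) f) + qra a k (csub (fs n) f))).
  by have := cvgD IH (h k); rewrite addr0 => H; exact: H.
by apply/funext => n; rewrite big_ord_recr.
Qed.

Lemma Lra_cvg_Cinf fs gs f g : (forall n, inLra a (fs n)) -> inLra a f ->
  (forall n, inCinf a (gs n)) -> inCinf a g ->
  (forall n, gs n = fs n %[ae mu]) -> g = f %[ae mu] ->
  conv_in (qra a) fs f -> conv_in (qC a) gs g.
Proof.
move=> hfs hf hgs hg gsfs gf hc j; have [k [C hC]] := Lra_Cinf_continuous j.
apply: (@cvg0_le _ _ (fun n => C * \sum_(i < k) qra a i (csub (fs n) f))).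
  move=> n; apply/andP; split; first exact: wnorm_ge0.
  apply: hC; [exact: (inLraB ha (hfs n) hf)|exact: inCinfB|].
  by apply: aeS2 (gsfs n) gf => x h1 h2 _; rewrite /csub h1 // h2.
by have H := cvgM (cvg_cst C) (cvg_sum_qra k hc); rewrite mulr0 in H; exact: H.
Qed.

(** From [n = N] on the distance is [0]; before that, [N^k] times the norm bounds the weighted
    distance. *)
Lemma inLra_cpoly (p q : {poly R}) : inLra a (cpoly p q).
Proof.
have hL := inL2_cpoly ha p q; split => // k; set N := maxn (size p) (size q).
apply: (proj1 (@qra_le _ _ _ k (N%:R ^+ k * wnorm a (cpoly p q)) _)) => n.
have [Nn|nN] := leqP N n.
  have : distPi a (cpoly p q) n <= 0.
    have sp : (size p <= n)%N by rewrite (leq_trans _ Nn) // leq_maxl.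
    have sq : (size q <= n)%N by rewrite (leq_trans _ Nn) // leq_maxr.
    apply: (le_trans (distPi_le _ _ sp sq)); rewrite csub_cpoly !subrr.
    rewrite -(@ler_pXn2r _ 2) ?nnegrE ?wnorm_ge0 // expr0n /= wnorm_sqr //; last exact: inL2_cpoly.
    rewrite (_ : (fun x => _) = (horner 0)) /=.
      have := wEZ 0 (wint_poly ha 0); rewrite mul0r (_ : (fun x => _) = horner 0) => [->|].
        by rewrite addr0.
      by apply/funext => x; rewrite horner0 mul0r.
    by apply/funext => x; rewrite /= horner0 expr0n.
  move=> d0; have -> : distPi a (cpoly p q) n = 0 by apply/eqP; rewrite eq_le d0 distPi_ge0.
  by rewrite mulr0 mulr_ge0 ?exprn_ge0 ?wnorm_ge0.
apply: ler_pM; [by rewrite exprn_ge0|exact: distPi_ge0|by rewrite lerXn2r ?nnegrE // ler_nat ltnW|].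
have := @distPi_le _ a (cpoly p q) n 0 0; rewrite size_poly0 => /(_ isT isT).
by rewrite csub_cpoly !subr0.
Qed.

Section Expansion.
Variables (P : nat -> {poly R}) (f : @cfun R).
Hypothesis sP : forall n, size (P n) = n.+1.
Hypothesis oP : forall m n, wE a (fun x => (P m).[x] * (P n).[x]) = (m == n)%:R.
Hypothesis hf : inLra a f.

Definition partial1 N : {poly R} := \sum_(n < N) (acoef a (P n) f).1 *: P n.
Definition partial2 N : {poly R} := \sum_(n < N) (acoef a (P n) f).2 *: P n.

Lemma sum_pair (N : nat) (F G : 'I_N -> R) :
  \sum_(i < N) (F i, G i) = (\sum_(i < N) F i, \sum_(i < N) G i) :> (R * R)%type.
Proof.
by rewrite [LHS]surjective_pairing; congr (_, _); apply: (big_morph _ _ _).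
Qed.

(** Brings the complex sums into the form [cpoly], to which the results on projections apply. *)
Lemma expansion_partial j : (fun N x => \sum_(n < N) ((derivn j (P n)).[x] * (acoef a (P n) f).1,
   (derivn j (P n)).[x] * (acoef a (P n) f).2)) =
   (fun N => cpoly (partial1 N)^`(j) (partial2 N)^`(j)).
Proof.
apply/funext => N; apply/funext => x; rewrite sum_pair /cpoly; congr (_, _);
  rewrite /partial1 /partial2 linear_sum /= horner_sum; apply: eq_bigr => i _;
  by rewrite derivnZ hornerZ mulrC.
Qed.

Lemma projs_expansion : isprojs f partial1 partial2.
Proof.
have [h1 h2] := (inL2P a f).1 hf.1.
by move=> N; split; exact: isproj_expansion.
Qed.

Lemma expansion_cvg : conv_in (qra a) (fun N => cpoly (partial1 N) (partial2 N)) f.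
Proof.
move=> k; have hq := qra_ge0 k.+1 hf.
apply/cvg_seqP => e e0.
pose N0 := Num.bound (qra a k.+1 f / e).
have hN0 : qra a k.+1 f < e * N0%:R.
  by rewrite mulrC -ltr_pdivrMr //; apply: archi_boundP; rewrite divr_ge0 // ltW.
exists N0.+1 => N N0N; have Np : (0 < N)%N by exact: leq_ltn_trans N0N.
have hL : inLra a (csub (cpoly (partial1 N) (partial2 N)) f).
  exact: (inLraB ha (inLra_cpoly _ _) hf).
rewrite subr0 ger0_norm; last exact: qra_ge0.
have [h1 h2] := projs_expansion N.
have h := qra_partial_sum ha k Np hf h1 h2; apply: (le_lt_trans h).
rewrite ltr_pdivrMr ?ltr0n //; apply: (lt_le_trans hN0).
by rewrite ler_wpM2l ?(ltW e0) // ler_nat ltnW.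
Qed.

Lemma expansion_ucc (g : @cfun R) j : inCinf a g -> g = f %[ae mu] ->
  ucc (fun N => cpoly (partial1 N)^`(j) (partial2 N)^`(j)) (derive1n j g).
Proof.
move=> hg gf.
have hc := Lra_cvg_Cinf (fun N => inLra_cpoly (partial1 N) (partial2 N)) hf
  (fun N => inCinf_cpoly (partial1 N) (partial2 N)) hg (fun N => ae_eq_refl _ _ _) gf expansion_cvg.
have := Cinf_cvg_ucc ha (fun N => inCinf_cpoly (partial1 N) (partial2 N)) hg hc j.
by under eq_fun do rewrite derive1n_cpoly.
Qed.

End Expansion.

End RapidApprox.

(** * The Gaussian weight *)

Section Antiderivative.
Context {R : realType}.
Local Notation mu := (@lebesgue_measure R).
Implicit Types (f F : R -> R).

Definition gauss (x : R) : R := expR (- x ^+ 2).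

Lemma gauss_gt0 x : 0 < gauss x. Proof. exact: expR_gt0. Qed.

Lemma is_derive_gauss x : is_derive x (1 : R) gauss (- (2 * x) * gauss x).
Proof.
have h1 : is_derive x (1 : R) (fun y : R => - (y * y)) (- (2 * x)).
  have h := is_deriveN (isdM (is_derive_id x (1 : R)) (is_derive_id x (1 : R))).
  apply: is_derive_eq h _; ring.
have h2 := @is_derive1_comp _ expR (fun y : R => - (y * y)) x _ _ (is_derive_expR _) h1.
have -> : gauss = expR \o (fun y : R => - (y * y)) by apply/funext => y; rewrite /gauss expr2.
by apply: is_derive_eq h2 _; rewrite /= mulrC.
Qed.

Lemma continuous_gauss : continuous gauss.
Proof. by move=> x; apply: is_derive_continuous (is_derive_gauss x). Qed.

Lemma gaussN x : gauss (- x) = gauss x.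
Proof. by rewrite /gauss sqrrN. Qed.

Lemma gauss_cvg0 : gauss x @[x --> +oo] --> (0 : R).
Proof.
apply: (@squeeze_cvgr _ _ _ _ (fun=> 0) (fun x => expR (- x))).
- near=> x; have x1 : 1 <= x by near: x; exact: nbhs_pinfty_ge.
  by rewrite (ltW (gauss_gt0 x)) /= ler_expR lerN2; nra.
- exact: cvg_cst.
- exact: cvgr_expR.
Unshelve. all: by end_near. Qed.

Lemma integral_gauss_tail (K x : R) : 0 <= K -> 1 <= x ->
  (\int[mu]_(t in `[x, +oo[) (K * (2 * t * gauss t))%:E = (K * gauss x)%:E)%E.
Proof.
move=> K0 x1.
have dF t : is_derive t (1 : R) (fun y => - K * gauss y) (K * (2 * t * gauss t)).
  by apply: is_derive_eq (isdZ (- K) (is_derive_gauss t)) _; ring.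
have cF : continuous (fun y => - K * gauss y).
  by move=> t; apply: is_derive_continuous (dF t).
have cf : continuous (fun t : R => K * (2 * t * gauss t)).
  move=> t; apply: cvgM; first exact: cvg_cst.
  by apply: cvgM; [apply: cvgM; [exact: cvg_cst|exact: cvg_id]|exact: continuous_gauss].
rewrite (@ge0_continuous_FTC2y _ _ (fun y => - K * gauss y) x 0) //.
- by rewrite -EFinB; congr EFin; ring.
- move=> t xt; have t0 : 0 <= t by lra.
  by have := ltW (gauss_gt0 t) => g0; nneg.
- exact: continuous_subspaceT.
- by have h := cvgM (cvg_cst (- K)) gauss_cvg0; rewrite mulr0 in h; exact: h.
- by apply: cvg_at_right_filter; exact: cF.
- by move=> t _; rewrite derive1E; apply: derive_val.
Qed.

(** For [t >= 1], [gauss t <= 2 t gauss t], which has an explicit antiderivative. *)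
Lemma abs_integral_tail f (K x : R) : continuous f -> 1 <= x ->
  (forall t, x <= t -> `|f t| <= K * gauss t) ->
  (\int[mu]_(t in `[x, +oo[) `|f t|%:E <= (K * gauss x)%:E)%E.
Proof.
move=> cf x1 hf; have K0 : 0 <= K.
  have := le_trans (normr_ge0 _) (hf x (lexx _)); rewrite pmulr_lge0 //; exact: gauss_gt0.
rewrite -integral_gauss_tail //; apply: ge0_le_integral => //.
- by apply/measurable_EFinP; apply: measurable_funTS; apply: measurableT_comp => //;
    exact: continuous_measurable_fun.
- apply/measurable_EFinP; apply: measurable_funTS; apply: continuous_measurable_fun => t.
  apply: cvgM; first exact: cvg_cst.
  by apply: cvgM; [apply: cvgM; [exact: cvg_cst|exact: cvg_id]|exact: continuous_gauss].
- move=> t /=; rewrite in_itv /= andbT => xt; rewrite lee_fin (le_trans (hf t xt)) //.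
  rewrite ler_wpM2l // -[leLHS]mul1r ler_wpM2r ?(ltW (gauss_gt0 _)) //; lra.
Qed.

(** [F] integrates from minus infinity; since the total integral is [0], on either side [F x] is up
    to sign the integral over the tail beyond [x], which has Gaussian size. *)
Lemma exists_antiderivative f (C : R) : continuous f ->
  (forall x, `|f x| <= C / (1 + x ^+ 2)) -> \int[mu]_x f x = 0 ->
  exists F, (forall x, is_derive x (1 : R) F (f x)) /\
    forall x K, 1 <= `|x| -> (forall t, `|x| <= `|t| -> `|f t| <= K * gauss t) ->
      `|F x| <= K * gauss x.
Proof.
move=> cf fC f0.
have mf : measurable_fun setT f by exact: continuous_measurable_fun.
have fi : mu.-integrable setT (EFin \o f) by exact: (ri_dom mf fC).
have fiS (A : set R) : measurable A -> mu.-integrable A (EFin \o f).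
  by move=> mA; apply: integrableS fi.
exists (fun x => \int[mu]_(t in `]-oo, x]) f t); split.
  move=> x; have x1 : x < x + 1 by rewrite ltrDl.
  have [h1 h2] := @continuous_FTC1 _ f -oo%O x _ x1 (fiS _ (measurable_itv _)) (ltNyr _) (cf x).
  by apply: DeriveDef; [exact: h1|rewrite -derive1E; exact: h2].
move=> x K x1 hK; have [x0|x0] := leP 0 x.
  rewrite ger0_norm // in x1 hK.
  have E : \int[mu]_(t in `]-oo, x]) f t = - \int[mu]_(t in `[x, +oo[) f t.
    apply/eqP; rewrite -addr_eq0 -f0.
    rewrite -Rintegral_itv_obnd_cbnd; last exact: fiS.
    rewrite -Rintegral_setU //.
    + by rewrite -itv_bndbnd_setU // set_itvNyy.
    + by rewrite -itv_bndbnd_setU // set_itvNyy.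
    + by apply: lt_disjoint => s t; rewrite !in_itv /= andbT; exact: le_lt_trans.
  rewrite E normrN -lee_fin; apply: le_trans (abs_integral_tail cf x1 _); last first.
    by move=> t xt; apply: hK; rewrite (le_trans xt) // ler_norm.
  rewrite EFin_normr_Rintegral //; last by apply: fiS; exact: measurable_itv.
  by apply: le_abse_integral => //; apply/measurable_EFinP; exact: measurable_funTS.
rewrite ltr0_norm // in x1 hK.
rewrite -lee_fin EFin_normr_Rintegral //; last by apply: fiS; exact: measurable_itv.
have cnf : continuous (fun t => `|f t|).
  by move=> t; apply: continuous_comp; [exact: cf|exact: norm_continuous].
have mnf : measurable_fun setT (fun t => `|f t|) by exact: continuous_measurable_fun.
apply: (@le_trans _ _ (\int[mu]_(t in `]-oo, x]) `|f t|%:E)%E).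
  by apply: le_abse_integral => //; apply/measurable_EFinP; exact: measurable_funTS.
rewrite -{1}(opprK x) (@ge0_integration_by_substitutionNy _ (fun t => `|f t|)); last 2 first.
- exact: continuous_subspaceT.
- by move=> t _.
rewrite -(gaussN x); apply: (@abs_integral_tail (fun t => f (- t))) => //.
  by move=> t; apply: continuous_comp; [exact: opp_continuous|exact: cf].
move=> t xt; rewrite -(gaussN t); apply: hK; rewrite normrN.
by rewrite (le_trans xt) // ler_norm.
Qed.

(** Dominated convergence over growing symmetric intervals, on each of which the integral is a
    difference of two decaying values of [F]. *)
Lemma Rintegral_deriv0 F f (C : R) : (forall x, is_derive x (1 : R) F (f x)) ->
  continuous f -> (forall x, `|f x| <= C / (1 + x ^+ 2)) ->
  (forall x, `|F x| <= C / (1 + x ^+ 2)) -> \int[mu]_x f x = 0.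
Proof.
move=> dF cf fC FC.
have mf : measurable_fun setT f by exact: continuous_measurable_fun.
have fi : mu.-integrable setT (EFin \o f) by exact: (ri_dom mf fC).
have cF : continuous F by move=> x; apply: is_derive_continuous (dF x).
(* The radius [n + 1] keeps the interval nondegenerate at [n = 0]. *)
pose I n : set R := `[- n.+1%:R, n.+1%:R]%classic.
pose fn n := (EFin \o f) \_ (I n).
have mI n : measurable (I n) by exact: measurable_itv.
have := @dominated_convergence _ _ _ mu setT measurableT fn (EFin \o f) (fun x => `|f x|%:E).
case.
- move=> n; apply/measurable_restrict => //; first exact: mI.
  by apply/measurable_EFinP; exact: measurable_funTS.
- by apply/measurable_EFinP.
- apply: aeW => x _; apply: cvg_near_cst; near=> n.
  rewrite /fn patchE mem_set // /I /= in_itv /= -ler_norml.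
  apply: (@le_trans _ _ n%:R); last by rewrite ler_nat.
  by near: n; exact: nbhs_infty_ger.
- by apply: (@le_integrable _ _ _ mu setT measurableT _ (EFin \o f)) => //;
    [apply/measurable_EFinP; exact: measurableT_comp|move=> x _ /=; rewrite normr_id].
- apply: aeW => x n _; rewrite /fn patchE; case: ifPn => _ //=.
  by rewrite normr0 lee_fin.
move=> _ _; set s := [sequence _]_n => hs.
have Es n : s n = (F n.+1%:R - F (- n.+1%:R))%:E.
  rewrite /s /= /fn -integral_mkcond /I (@continuous_FTC2 _ f F) //.
  - by rewrite gtrN.
  - exact: continuous_subspaceT.
  - split; first by move=> x _; apply: ex_derive.
    + by apply: cvg_at_right_filter; exact: cF.
    + by apply: cvg_at_left_filter; exact: cF.
  - by move=> x _; rewrite derive1E; apply: derive_val.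
have h0 : (fun n : nat => F n.+1%:R - F (- n.+1%:R)) @ \oo --> (0 : R).
  apply/cvg_seqP => e e0.
  have C0 : 0 <= C.
    by have := le_trans (normr_ge0 _) (fC 0); rewrite expr0n addr0 divr1.
  exists (Num.bound (2 * C / e)) => n hn; rewrite subr0.
  apply: le_lt_trans (ler_normB _ _) _.
  apply: le_lt_trans (lerD (FC _) (FC _)) _.
  rewrite sqrrN -mulrDl ltr_pdivrMr ?oneDsqr_gt0 //.
  have hb : 2 * C / e < (Num.bound (2 * C / e))%:R.
    by apply: archi_boundP; rewrite divr_ge0 ?(ltW e0) // mulr_ge0.
  rewrite ltr_pdivrMr // in hb.
  have : (Num.bound (2 * C / e))%:R <= n.+1%:R :> R by rewrite ler_nat ltnW.
  have : 1 <= n.+1%:R :> R by rewrite ler1n.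
  move: ((Num.bound _)%:R : R) (n.+1%:R : R) hb => b k hb k1 bk.
  have : e * b <= e * k by rewrite ler_wpM2l // ltW.
  have : e * k <= e * k ^+ 2 by rewrite ler_wpM2l ?(ltW e0) // expr2 ler_peMl //; lra.
  lra.
have hs0 : s @ \oo --> (0%:E : \bar R).
  rewrite (_ : s = EFin \o (fun n : nat => F n.+1%:R - F (- n.+1%:R))); last by apply/funext => n; rewrite Es.
  by apply: cvg_EFin; [near=> n|exact: h0].
have := cvg_unique _ hs hs0; rewrite /Rintegral => /= E.
by rewrite -[X in fine X]/(\int[mu]_x (EFin \o f) x)%E E.
Unshelve. all: by end_near. Qed.

End Antiderivative.

(** * Schwartz functions, the operators [d/dx + s x], and the spectral gap *)

Section SchwartzJets.
Context {R : realType}.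
Local Notation mu := (@lebesgue_measure R).
Implicit Types (U V : nat -> R -> R) (p q : {poly R}).

Definition sjet U : Prop := jet U /\
  forall m l, exists M : R, forall x, `|x| ^+ m * `|U l x| <= M.

(** Leibniz for the product with [x]; at [l = 0] the spurious [U l.-1] has coefficient [0]. *)
Definition xmul U : nat -> R -> R := fun l x => x * U l x + l%:R * U l.-1 x.
Definition jshift U : nat -> R -> R := fun l => U l.+1.
Definition jlin (c d : R) U V : nat -> R -> R := fun l x => c * U l x + d * V l x.

(* The jet of [d/dx + s x] applied to the function with jet [U]. *)
Definition ddx (s : R) U : nat -> R -> R := jlin 1 s (jshift U) (xmul U).

Lemma jet_xmul U : jet U -> jet (xmul U).
Proof.
move=> hU l x; have h1 := isdM (is_derive_id x (1 : R)) (hU l x).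
case: l h1 => [|l] h1.
  have h2 := isdD h1 (isdZ (0%:R : R) (hU 0%N x)).
  by apply: is_derive_eq h2 _; rewrite /xmul /=; ring.
have h2 := isdD h1 (isdZ (l.+1%:R : R) (hU l x)).
by apply: is_derive_eq h2 _; rewrite /xmul /=; ring.
Qed.

Lemma jet_shift U : jet U -> jet (jshift U).
Proof. by move=> hU l x; exact: hU. Qed.

Lemma jet_lin c d U V : jet U -> jet V -> jet (jlin c d U V).
Proof. by move=> hU hV l x; exact: (isdD (isdZ c (hU l x)) (isdZ d (hV l x))). Qed.

Lemma jet_ddx s U : jet U -> jet (ddx s U).
Proof. by move=> hU; apply: jet_lin; [exact: jet_shift|exact: jet_xmul]. Qed.

Lemma jet_iter_ddx s k U : jet U -> jet (iter k (ddx s) U).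
Proof. by move=> hU; elim: k => //= k; exact: jet_ddx. Qed.

(** Each [ddx] raises the derivative order and the power of [x] by at most one, so finitely many
    seminorms suffice. The free weight [w] will be [1] for Schwartz functions and [gauss] for the
    weighted space. *)
Lemma ddx_bound s k m l : exists (N : nat) (C : R), 0 <= C /\
  forall U (w : R -> R) (K : R), (forall x, 0 <= w x) -> 0 <= K ->
  (forall m' l', (m' < N)%N -> (l' < N)%N -> forall x, w x * (`|x| ^+ m' * `|U l' x|) <= K) ->
  forall x, w x * (`|x| ^+ m * `|iter k (ddx s) U l x|) <= C * K.
Proof.
elim: k m l => [|k IH] m l.
  exists (maxn m l).+1, 1; split => // U w K w0 K0 hU x; rewrite mul1r.
  by apply: hU; rewrite ltnS ?leq_maxl ?leq_maxr.
have [N [C [C0 hN]]] := IH m l.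
exists N.+1, (C * (1 + `|s| * (1 + N%:R))); split.
  by rewrite mulr_ge0 // addr_ge0 // mulr_ge0 // addr_ge0.
move=> U w K w0 K0 hU x; rewrite iterSr -mulrA.
apply: hN => //; first by rewrite mulr_ge0 // addr_ge0 // mulr_ge0 // addr_ge0.
move=> m' l' hm hl y; rewrite /ddx /jlin /xmul /jshift mul1r.
have h1 := hU m' l'.+1 (leqW hm) hl y.
have h2 := hU m'.+1 l' hm (leqW hl) y; rewrite exprS in h2.
have hl1 : (l'.-1 < N.+1)%N by rewrite ltnS (leq_trans (leq_pred _)) // ltnW.
have h3 := hU m' l'.-1 (leqW hm) hl1 y.
have n1 : `|U l'.+1 y + s * (y * U l' y + l'%:R * U l'.-1 y)| <=
  `|U l'.+1 y| + `|s| * (`|y| * `|U l' y| + N%:R * `|U l'.-1 y|).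
  apply: (le_trans (ler_normD _ _)); rewrite lerD2l normrM ler_wpM2l //.
  apply: (le_trans (ler_normD _ _)); rewrite !normrM lerD2l normr_nat ler_wpM2r // ler_nat.
  exact: ltnW.
have wy := w0 y; have ym : 0 <= `|y| ^+ m' by rewrite exprn_ge0.
apply: (@le_trans _ _ (w y * (`|y| ^+ m' * (`|U l'.+1 y| + `|s| * (`|y| * `|U l' y| + N%:R * `|U l'.-1 y|))))).
  by apply: ler_wpM2l => //; exact: ler_wpM2l.
have -> : w y * (`|y| ^+ m' * (`|U l'.+1 y| + `|s| * (`|y| * `|U l' y| + N%:R * `|U l'.-1 y|))) =
  w y * (`|y| ^+ m' * `|U l'.+1 y|) + `|s| * (w y * (`|y| * `|y| ^+ m' * `|U l' y|) +
   N%:R * (w y * (`|y| ^+ m' * `|U l'.-1 y|))) by ring.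
have -> : (1 + `|s| * (1 + N%:R)) * K = K + `|s| * (K + N%:R * K) by ring.
apply: lerD => //; apply: ler_wpM2l => //; apply: lerD => //; exact: ler_wpM2l.
Qed.

Lemma sjet_ge0 U m l : sjet U -> exists2 M : R, 0 <= M & forall x, `|x| ^+ m * `|U l x| <= M.
Proof.
move=> [_ /(_ m l)[M hM]]; exists M => //.
by apply: le_trans (hM 0); rewrite mulr_ge0 // exprn_ge0.
Qed.

Lemma sjet_iter_ddx s k U : sjet U -> sjet (iter k (ddx s) U).
Proof.
move=> hU; split; first by apply: jet_iter_ddx; case: hU.
move=> m l; have [N [C [C0 h]]] := ddx_bound s k m l.
have [M hM] := choice (fun ml : nat * nat => hU.2 ml.1 ml.2).
exists (C * \sum_(i < N) \sum_(j < N) `|M (i : nat, j : nat)|) => x.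
rewrite -[leLHS]mul1r; apply: (h U (fun=> 1)) => //.
  by apply: sumr_ge0 => i _; apply: sumr_ge0.
move=> m' l' hm hl y; rewrite mul1r (le_trans (hM (m', l') y)) // (le_trans (ler_norm _)) //.
rewrite (bigD1 (Ordinal hm)) //= (bigD1 (Ordinal hl)) //= -!addrA lerDl addr_ge0 //.
  by apply: sumr_ge0.
by apply: sumr_ge0 => i _; apply: sumr_ge0.
Qed.

Lemma sjet_ddx s U : sjet U -> sjet (ddx s U).
Proof. exact: (sjet_iter_ddx s 1). Qed.

Lemma sjet_lin c d U V : sjet U -> sjet V -> sjet (jlin c d U V).
Proof.
move=> hU hV; split; first by apply: jet_lin; [case: hU|case: hV].
move=> m l; have [M hM] := hU.2 m l; have [M' hM'] := hV.2 m l.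
exists (`|c| * M + `|d| * M') => x; rewrite /jlin.
apply: (@le_trans _ _ (`|x| ^+ m * (`|c| * `|U l x| + `|d| * `|V l x|))).
  by rewrite ler_wpM2l ?exprn_ge0 // -!normrM ler_normD.
rewrite mulrDr !(mulrCA (`|x| ^+ m)); apply: lerD; exact: ler_wpM2l.
Qed.

Lemma sjet_oneDsqr U m l : sjet U -> exists2 M : R, 0 <= M &
  forall x, (1 + x ^+ 2) ^+ m * `|U l x| <= M.
Proof.
move=> hU; have [M0 M00 h0] := sjet_ge0 0 l hU; have [M1 M10 h1] := sjet_ge0 (2 * m) l hU.
exists (2 ^+ m * (M0 + M1)); first by rewrite mulr_ge0 ?exprn_ge0 // addr_ge0.
move=> x; have [x1|x1] := leP `|x| 1.
  apply: ler_pM => //; first by rewrite exprn_ge0 // ltW // oneDsqr_gt0.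
    apply: lerXn2r; rewrite ?nnegrE ?(ltW (oneDsqr_gt0 _)) //.
    by rewrite -(real_normK (num_real x)); have := normr_ge0 x; nra.
  by have := h0 x; rewrite expr0 mul1r; lra.
apply: (@le_trans _ _ (2 ^+ m * (`|x| ^+ (2 * m) * `|U l x|))).
  rewrite mulrA ler_wpM2r // exprM -exprMn.
  apply: lerXn2r; rewrite ?nnegrE ?(ltW (oneDsqr_gt0 _)) ?mulr_ge0 ?sqr_ge0 //.
  by rewrite -(real_normK (num_real x)); nra.
by rewrite ler_wpM2l ?exprn_ge0 // (le_trans (h1 x)) // lerDr.
Qed.

Definition ip U V : R := \int[mu]_x (U 0%N x * V 0%N x).

Lemma sjet_prod_dom U V i j : sjet U -> sjet V -> exists2 C : R, 0 <= C &
  forall x, `|U i x * V j x| <= C / (1 + x ^+ 2).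
Proof.
move=> hU hV; have [M M0 hM] := sjet_oneDsqr 1 i hU; have [M' M'0 hM'] := sjet_ge0 0 j hV.
exists (M * M'); first exact: mulr_ge0.
move=> x; rewrite ler_pdivlMr ?oneDsqr_gt0 // normrM mulrC mulrA.
apply: ler_pM => //; first by rewrite mulr_ge0 // ltW // oneDsqr_gt0.
  by have := hM x; rewrite expr1.
by have := hM' x; rewrite expr0 mul1r.
Qed.

Lemma measurable_jet U i : jet U -> measurable_fun setT (U i).
Proof. by move=> hU; apply: continuous_measurable_fun; exact: jet_continuous. Qed.

Lemma ri_prod U V i j : sjet U -> sjet V -> ri (fun x => U i x * V j x).
Proof.
move=> hU hV; have [C C0 hC] := sjet_prod_dom i j hU hV.
apply: ri_dom hC; apply: measurable_funM; apply: measurable_jet; [exact: hU.1|exact: hV.1].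
Qed.

Lemma ipC U V : ip U V = ip V U.
Proof. by apply: eq_Rintegral => x _; rewrite mulrC. Qed.

Lemma eq_ip U U' V : U 0%N =1 U' 0%N -> ip U V = ip U' V.
Proof. by move=> h; apply: eq_Rintegral => x _; rewrite h. Qed.

Lemma ip_oppl U U' V : sjet U -> sjet V -> (forall x, U' 0%N x = - U 0%N x) ->
  ip U' V = - ip U V.
Proof.
move=> hU hV h; have := @RintegralZl _ _ _ mu setT _ (-1) measurableT (ri_prod 0 0 hU hV).
by rewrite mulN1r /ip => <-; apply: eq_Rintegral => x _; rewrite h; ring.
Qed.

Lemma ip_lin c d U V V' : sjet U -> sjet V -> sjet V' ->
  ip U (jlin c d V V') = c * ip U V + d * ip U V'.
Proof.
move=> hU hV hV'; have h1 := ri_prod 0 0 hU hV; have h2 := ri_prod 0 0 hU hV'.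
rewrite /ip -RintegralZl // -RintegralZl // -RintegralD //; [|exact: riZ|exact: riZ].
by apply: eq_Rintegral => x _; rewrite /jlin; ring.
Qed.

Lemma ip_ge0 U : 0 <= ip U U.
Proof. by apply: Rintegral_ge0 => x _; rewrite -expr2 sqr_ge0. Qed.

Lemma ip_derive U V : sjet U -> sjet V -> ip (jshift U) V = - ip U (jshift V).
Proof.
move=> hU hV; apply/eqP; rewrite -addr_eq0.
have h1 := ri_prod 1 0 hU hV; have h2 := ri_prod 0 1 hU hV.
rewrite /ip -RintegralD //; apply/eqP.
have [C1 C10 hC1] := sjet_prod_dom 1 0 hU hV; have [C2 C20 hC2] := sjet_prod_dom 0 1 hU hV.
have [C3 C30 hC3] := sjet_prod_dom 0 0 hU hV.
have cU i := jet_continuous (j := i) hU.1; have cV i := jet_continuous (j := i) hV.1.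
have le_C (x c : R) : c <= C1 + C2 + C3 -> c / (1 + x ^+ 2) <= (C1 + C2 + C3) / (1 + x ^+ 2).
  by move=> hc; apply: ler_wpM2r => //; rewrite invr_ge0 ltW // oneDsqr_gt0.
apply: (@Rintegral_deriv0 _ (fun x => U 0%N x * V 0%N x) _ (C1 + C2 + C3)).
- by move=> x; exact: (isdM (hU.1 0%N x) (hV.1 0%N x)).
- by move=> x; apply: cvgD; apply: cvgM; [exact: cU|exact: cV|exact: cU|exact: cV].
- move=> x; apply: (le_trans (ler_normD _ _)); apply: le_trans (lerD (hC1 x) (hC2 x)) _.
  by rewrite -mulrDl; apply: le_C; lra.
- by move=> x; apply: le_trans (hC3 x) _; apply: le_C; lra.
Qed.

Lemma ip_xmul U V : ip (xmul U) V = ip U (xmul V).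
Proof. by apply: eq_Rintegral => x _; rewrite /xmul /=; ring. Qed.

Lemma sjet_xmul U : sjet U -> sjet (xmul U).
Proof.
move=> hU; have := sjet_lin 1 (-1) (sjet_ddx 1 hU) (sjet_ddx 0 hU).
congr sjet; apply/funext => l; apply/funext => x.
by rewrite /ddx /jlin; ring.
Qed.

Lemma sjet_shift U : sjet U -> sjet (jshift U).
Proof.
move=> hU; have := sjet_ddx 0 hU.
by congr sjet; apply/funext => l; apply/funext => x; rewrite /ddx /jlin; ring.
Qed.

(** Differentiation is skew and multiplication by [x] symmetric. *)
Lemma ip_ddx s U V : sjet U -> sjet V -> ip (ddx s U) V = - ip U (ddx (- s) V).
Proof.
move=> hU hV; rewrite ipC /ddx ip_lin //; [|exact: sjet_shift|exact: sjet_xmul].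
rewrite ip_lin //; [|exact: sjet_shift|exact: sjet_xmul].
by rewrite ipC ip_derive // (ipC V) ip_xmul; ring.
Qed.

(* This is the relation [[d/dx + 2x, d/dx - 2x] = -4]. *)
Lemma ip_ddx_commutator V : sjet V ->
  ip (ddx (-2) V) (ddx (-2) V) = ip (ddx 2 V) (ddx 2 V) + 4 * ip V V.
Proof.
move=> hV; have h2 := sjet_ddx 2 hV; have hm2 := sjet_ddx (-2) hV.
rewrite ip_ddx // [in RHS]ip_ddx // opprK.
have -> : ip V (ddx 2 (ddx (-2) V)) = ip V (jlin 1 (-4) (ddx (-2) (ddx 2 V)) V).
  rewrite ipC [RHS]ipC; apply: eq_ip => x.
  by rewrite /ddx /jlin /jshift /xmul /=; ring.
by rewrite ip_lin //; [ring|exact: sjet_ddx].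
Qed.

(* The jet of [e^(-x^2) V], since [d/dx (e^(-x^2) V) = e^(-x^2) (d/dx - 2x) V]. *)
Definition gjet V : nat -> R -> R := fun l x => gauss x * iter l (ddx (-2)) V 0%N x.

Lemma jet_gjet V : jet V -> jet (gjet V).
Proof.
move=> hV l x; have h := isdM (is_derive_gauss x) (jet_iter_ddx (-2) l hV 0%N x).
by apply: is_derive_eq h _; rewrite /gjet /= /ddx /jlin /jshift /xmul /=; ring.
Qed.

Definition pjet p : nat -> R -> R := fun l => horner p^`(l).

Lemma jet_pjet p : jet (pjet p). Proof. exact: jet_poly. Qed.

Lemma Wt2 (x : R) : Wt 2 x = gauss x.
Proof. by rewrite /Wt /gauss powR_mulrn // real_normK // num_real. Qed.

Lemma one_lt2 : 1 < 2 :> R. Proof. by rewrite ltr1n. Qed.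

Lemma gauss_poly_bound p m : exists M : R, forall x, gauss x * (`|x| ^+ m * `|p.[x]|) <= M.
Proof.
have [C C0 hC] := horner_le_oneDsqr (p * 'X^m).
have [D D0 hD] := oneDsqr_Wt one_lt2 (size (p * 'X^m)).
exists (C * D) => x; rewrite mulrC -normrX -normrM.
have -> : x ^+ m * p.[x] = (p * 'X^m).[x] by rewrite !hE mulrC.
apply: (@le_trans _ _ (C * (1 + x ^+ 2) ^+ size (p * 'X^m) * gauss x)).
  by rewrite ler_wpM2r ?(ltW (gauss_gt0 x)).
by rewrite -mulrA ler_wpM2l // -Wt2.
Qed.

Lemma iter_ddx_poly s k p : exists q, forall x, iter k (ddx s) (pjet p) 0%N x = q.[x].
Proof.
suff : exists q, iter k (ddx s) (pjet p) = pjet q.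
  by move=> [q ->]; exists q => x; rewrite /pjet derivn0.
elim: k => [|k [q IH]]; first by exists p.
exists (q^`() + s *: ('X * q)); rewrite iterS IH; apply/funext => l; apply/funext => x.
rewrite /ddx /jlin /jshift /xmul /pjet derivnD derivnZ hornerD hornerZ -derivSn mul1r.
congr (_ + s * _); elim: l x => [|l IHl] x; first by rewrite !derivn0 hornerM hornerX mul0r addr0.
have E : ('X * q)^`(l) = 'X * q^`(l) + l%:R *: q^`(l.-1).
  apply/eqP; rewrite -subr_eq0; apply/eqP/horner_eq0 => c.
  by rewrite !hE IHl subrr.
rewrite [('X * q)^`(l.+1)]derivnS E derivD derivM derivX derivZ -!derivnS !hE mul1r.
case: l {IHl E} => [|l] /=; first by rewrite !mul0r !mul1r addr0 addrC.
by rewrite -addrA addrC -addrA -[l.+2]addn1 natrD; ring.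
Qed.

Lemma sjet_gpoly p : sjet (gjet (pjet p)).
Proof.
split; first by apply: jet_gjet; exact: jet_pjet.
move=> m l; have [q hq] := iter_ddx_poly (-2) l p.
have [M hM] := gauss_poly_bound q m; exists M => x.
by rewrite /gjet normrM (gtr0_norm (gauss_gt0 x)) mulrCA hq.
Qed.

(** After multiplication by [expsq], this is orthogonality to the polynomials of degree below [n] in
    the weighted space, by [wE_expsq]. *)
Definition gorth n U : Prop := forall p, (size p <= n)%N -> ip U (gjet (pjet p)) = 0.

Lemma ddx2_gjet V x : ddx 2 (gjet V) 0%N x = gauss x * V 1%N x.
Proof. by rewrite /ddx /jlin /jshift /xmul /gjet /= /ddx /jlin /jshift /xmul /=; ring. Qed.

(** The solution is [- e^(x^2)] times the integral of [U e^(-t^2)] from minus infinity.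
    Orthogonality to [e^(-x^2)] makes that integral vanish at plus infinity; otherwise the solution
    would grow like [e^(x^2)]. *)
Lemma solve_ddx U : sjet U -> gorth 1 U ->
  exists2 V, sjet V & forall x, - ddx (-2) V 0%N x = U 0%N x.
Proof.
move=> hU hU1; have hg := sjet_gpoly 1.
have [C C0 hC] := sjet_prod_dom 0 0 hU hg.
have g1 x : gjet (pjet 1) 0%N x = gauss x by rewrite /gjet /pjet /= hornerC mulr1.
have cf : continuous (fun x => U 0%N x * gauss x).
  by move=> x; apply: cvgM; [exact: (jet_continuous (j := 0%N) hU.1)|exact: continuous_gauss].
have fC x : `|U 0%N x * gauss x| <= C / (1 + x ^+ 2) by rewrite -g1.
have f0 : \int[mu]_x (U 0%N x * gauss x) = 0.
  rewrite -(hU1 1); last by rewrite size_poly1.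
  by apply: eq_Rintegral => x _; rewrite g1.
have [F [dF FK]] := exists_antiderivative cf fC f0.
pose v0 (x : R) := - ((gauss x)^-1 * F x).
have gn0 (x : R) : gauss x != 0 by rewrite gt_eqF // gauss_gt0.
have dv0 x : is_derive x (1 : R) v0 (2 * (x * v0 x) - U 0%N x).
  have h1 : is_derive x (1 : R) (fun y => (gauss y)^-1) (2 * x * (gauss x)^-1).
    have h := is_deriveV (gn0 x) (is_derive_gauss x).
    by apply: is_derive_eq h _; rewrite /GRing.scale /=; field.
  have h2 := isdZ (-1) (isdM h1 (dF x)).
  rewrite (_ : v0 = fun y => -1 * ((gauss y)^-1 * F y)); last by apply/funext => y; rewrite mulN1r.
  by apply: is_derive_eq h2 _; rewrite mulN1r; field.
(* Higher derivatives are prescribed by differentiating [v' = 2 x v - U] formally [l] times. *)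
pose V := fix V l : R -> R := match l with
  | 0%N => v0
  | l'.+1 => fun x => 2 * (x * V l' x + l'%:R * (if l' is l''.+1 then V l'' x else 0)) - U l' x
  end.
have VS l x : V l.+1 x = 2 * xmul V l x - U l x.
  by case: l => [|l]; rewrite /xmul //= !mul0r.
have jV : jet V.
  have stepV l : (forall x, is_derive x (1 : R) (V l) (V l.+1 x)) ->
      (forall x, is_derive x (1 : R) (V l.-1) (V l.-1.+1 x)) ->
      forall x, is_derive x (1 : R) (V l.+1) (V l.+2 x).
    move=> h1 h2 x.
    have h3 := isdD (isdM (is_derive_id x (1 : R)) (h1 x)) (isdZ l%:R (h2 x)).
    have h4 := isdD (isdZ 2 h3) (isdZ (-1) (hU.1 l x)).
    rewrite (_ : V l.+1 = fun y => 2 * (y * V l y + l%:R * V l.-1 y) + -1 * U l y); last first.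
      by apply/funext => y; rewrite VS /xmul mulN1r.
    apply: is_derive_eq h4 _; rewrite VS /xmul /=.
    by case: l {h1 h2 h3} => [|l] /=; ring.
  (* The recursion has two terms, so the orders [l] and [l - 1] are carried together. *)
  have key l : (forall x, is_derive x (1 : R) (V l) (V l.+1 x)) /\
               (forall x, is_derive x (1 : R) (V l.-1) (V l.-1.+1 x)).
    elim: l => [|l [IH1 IH2]]; last by split => //; exact: stepV.
    have h x : is_derive x (1 : R) (V 0%N) (V 1%N x).
      by apply: is_derive_eq (dv0 x) _; rewrite VS /xmul /=; ring.
    by split.
  by move=> l x; exact: (key l).1.
exists V; last by move=> x; rewrite /ddx /jlin /jshift VS; ring.
split => //; move=> m l; elim: l {-2}l (leqnn l) m => [|n IH] l.
  rewrite leqn0 => /eqP-> m.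
  have [M M0 hM] := sjet_oneDsqr m 0 hU.
  have c0 : continuous v0 by move=> x; apply: is_derive_continuous (dv0 x).
  have [B hB] : exists B, forall x, `|x| <= 1 -> `|v0 x| <= B.
    have cK : compact (v0 @` `[-1, 1]%classic).
      by apply: continuous_compact; [exact: continuous_subspaceT|exact: segment_compact].
    have [B hB] := compact_norm_le cK; exists B => x hx; apply: hB; exists x => //=.
    by rewrite in_itv /= -ler_norml.
  exists (`|B| + M) => x; have [x1|x1] := leP `|x| 1.
    apply: (@le_trans _ _ `|B|); last by rewrite lerDl.
    rewrite -[leRHS]mul1r; apply: ler_pM; [exact: exprn_ge0|exact: normr_ge0|exact: exprn_ile1|].
    exact: le_trans (hB x x1) (ler_norm B).
  apply: (@le_trans _ _ M); last by rewrite lerDr.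
  set q := (1 + x ^+ 2) ^+ m; have q0 : 0 < q by rewrite exprn_gt0 // oneDsqr_gt0.
  have xq : `|x| ^+ m <= q.
    by apply: lerXn2r; rewrite ?nnegrE ?(ltW (oneDsqr_gt0 _)) // -(real_normK (num_real x)); nra.
  (* Beyond [|x|] the Schwartz bound gives [|U| <= M / q]; the antiderivative keeps this constant,
     and [gauss x] cancels against its inverse in [v0]. *)
  have hF : `|F x| <= M / q * gauss x.
    apply: FK; first exact: ltW.
    move=> t xt; rewrite normrM (gtr0_norm (gauss_gt0 t)) ler_wpM2r ?(ltW (gauss_gt0 t)) //.
    rewrite ler_pdivlMr // mulrC; apply: le_trans (hM t); rewrite ler_wpM2r //.
    apply: lerXn2r; rewrite ?nnegrE ?(ltW (oneDsqr_gt0 _)) // lerD2l.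
    rewrite -(real_normK (num_real x)) -(real_normK (num_real t)).
    by rewrite lerXn2r ?nnegrE.
  have hv : `|v0 x| <= M / q.
    rewrite normrN normrM normfV (gtr0_norm (gauss_gt0 x)) mulrC ler_pdivrMr ?gauss_gt0 //.
  apply: (@le_trans _ _ (q * (M / q))); first by apply: ler_pM => //; rewrite exprn_ge0.
  by rewrite mulrC divfK // gt_eqF.
rewrite leq_eqVlt => /predU1P[->|]; last by rewrite ltnS; exact: IH.
(* Decay of the next derivative follows from the recursion; its term [x v^(n)] takes one more power
   of [x]. *)
move=> m; have [M1 h1] := IH n (leqnn n) m.+1.
have [M2 h2] := IH n.-1 (leq_pred n) m; have [M3 h3] := hU.2 m n.
exists (2 * (M1 + n%:R * M2) + M3) => x; rewrite VS /xmul.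
have xm : 0 <= `|x| ^+ m by rewrite exprn_ge0.
have k1 := h1 x; have k2 := h2 x; have k3 := h3 x; rewrite exprS in k1.
have n0 : 0 <= n%:R :> R by [].
apply: (@le_trans _ _ (`|x| ^+ m * (2 * (`|x| * `|V n x| + n%:R * `|V n.-1 x|) + `|U n x|))).
  apply: ler_wpM2l => //; apply: (le_trans (ler_normB _ _)); rewrite lerD2r normrM normr_nat.
  rewrite ler_wpM2l // (le_trans (ler_normD _ _)) // !normrM normr_nat //.
have -> : `|x| ^+ m * (2 * (`|x| * `|V n x| + n%:R * `|V n.-1 x|) + `|U n x|) =
   2 * (`|x| * `|x| ^+ m * `|V n x| + n%:R * (`|x| ^+ m * `|V n.-1 x|)) + `|x| ^+ m * `|U n x| by ring.
apply: lerD => //; apply: ler_wpM2l => //; apply: lerD => //; exact: ler_wpM2l.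
Qed.

Lemma gorth_le m n U : (m <= n)%N -> gorth n U -> gorth m U.
Proof. by move=> mn h p sp; apply: h; exact: leq_trans mn. Qed.

(* If [V] solves [-V' + 2 x V = U], then [V] inherits one order of orthogonality less than [U],
   so that the gap for [V] and the commutator relation give the gap for [U]. *)
Lemma spectral_gap n U : sjet U -> gorth n U ->
  4 * n%:R * ip U U <= ip (ddx 2 U) (ddx 2 U).
Proof.
elim: n U => [|n IH] U hU oU; first by rewrite mulr0 mul0r ip_ge0.
have [V hV VU] := solve_ddx hU (gorth_le (ltn0Sn n) oU).
have hV2 := sjet_ddx 2 hV; have hVm := sjet_ddx (-2) hV; have hU2 := sjet_ddx 2 hU.
have UE Z : sjet Z -> ip U Z = ip V (ddx 2 Z).
  move=> hZ; have -> : ip U Z = - ip (ddx (-2) V) Z.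
    by apply: ip_oppl => // x; rewrite VU.
  by rewrite ip_ddx // !opprK.
(* [e^(-x^2) p] is the image under [ddx 2] of [e^(-x^2)] times a primitive of [p]; passing to the
   adjoint turns [V] into [U]. *)
have oV : gorth n V.
  move=> p sp; have sP : (size (prim p) <= n.+1)%N.
    by rewrite /prim (leq_trans (size_poly _ _)).
  rewrite -(oU _ sP) UE; last exact: sjet_gpoly.
  rewrite ipC [RHS]ipC; apply: eq_ip => x.
  by rewrite ddx2_gjet /gjet /pjet /= ?derivn1 deriv_prim.
have gV := IH V hV oV.
have UU : ip U U = ip (ddx (-2) V) (ddx (-2) V).
  by apply: eq_Rintegral => x _; rewrite -VU mulrNN.
have UVA := UE U hU.
have cV := ip_ddx_commutator hV; rewrite -UU in cV.
set t : R := 4 * n.+1%:R.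
(* Expanding [|A U - t V|^2 >= 0] with [<V, A U> = |U|^2] and [t |V|^2 <= |U|^2] gives
   [|A U|^2 >= t |U|^2]. *)
have := ip_ge0 (jlin 1 (- t) (ddx 2 U) V).
rewrite ip_lin //; last exact: sjet_lin.
rewrite ipC ip_lin // [ip (jlin _ _ _ _) V]ipC ip_lin // -UVA (ipC (ddx 2 U) V) -UVA.
have tE : t = 4 * n%:R + 4 by rewrite /t -natr1; ring.
have t0 : 0 <= t by rewrite /t mulr_ge0.
have tV : t * ip V V <= ip U U by rewrite tE mulrDl cV lerD2r.
have : t * (t * ip V V) <= t * ip U U by exact: ler_wpM2l.
rewrite -/t; lra.
Qed.

(** The adjoint of [ddx 2] sends [e^(-x^2) p] to [e^(-x^2) (4 x p - p')], one degree higher. *)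
Lemma gorth_ddx n U : sjet U -> gorth n.+1 U -> gorth n (ddx 2 U).
Proof.
move=> hU oU p sp; have hp := sjet_gpoly p.
set q := 4%:R *: ('X * p) - p^`().
have sq : (size q <= n.+1)%N.
  rewrite (leq_trans (size_polyD _ _)) // geq_max; apply/andP; split.
    rewrite (leq_trans (size_scale_leq _ _)) // (leq_trans (size_polyMleq _ _)) // size_polyX.
    by rewrite add2n /= ltnS.
  by rewrite size_polyN (leq_trans (size_poly _ _)) // (leq_trans (leq_pred _)) // leqW.
have oq := oU q sq.
rewrite ip_ddx //; apply/eqP; rewrite oppr_eq0; apply/eqP.
have -> : ip U (ddx (-2) (gjet (pjet p))) = - ip U (gjet (pjet q)).
  rewrite ipC [in RHS]ipC; apply: ip_oppl => // [|x]; first exact: sjet_gpoly.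
  rewrite /ddx /jlin /jshift /xmul /gjet /pjet /= /ddx /jlin /jshift /xmul /pjet /=.
  by rewrite ?derivn1 /q !hE; ring.
by rewrite oq oppr0.
Qed.

Lemma gorth_iter_ddx n k U : sjet U -> gorth (n + k) U -> gorth n (iter k (ddx 2) U).
Proof.
elim: k n U => [|k IH] n U hU; first by rewrite addn0.
rewrite addnS iterSr => oU; apply: IH; [exact: sjet_ddx|exact: gorth_ddx].
Qed.

(** Each [ddx 2] spends one order of orthogonality, so at least [n] orders remain throughout; the
    factor [4] is given away. *)
Lemma spectral_gap_iter n k U : sjet U -> gorth (n + k) U ->
  n%:R ^+ k * ip U U <= ip (iter k (ddx 2) U) (iter k (ddx 2) U).
Proof.
elim: k U => [|k IH] U hU oU; first by rewrite expr0 mul1r.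
rewrite iterSr exprSr -mulrA.
have oU' : gorth (n + k) (ddx 2 U) by apply: gorth_ddx; rewrite -?addnS.
apply: le_trans (IH _ (sjet_ddx 2 hU) oU').
rewrite ler_wpM2l ?exprn_ge0 //.
apply: le_trans (spectral_gap hU oU); rewrite ler_wpM2r ?ip_ge0 //.
by rewrite -natrM ler_nat; lia.
Qed.

End SchwartzJets.

(** * Transfer between Schwartz functions and the weighted space for [alpha = 2] *)

Section Hermite.
Context {R : realType}.
Local Notation mu := (@lebesgue_measure R).
Implicit Types (U V : nat -> R -> R) (p q : {poly R}).

Lemma jet_eq U V : jet U -> jet V -> U 0%N =1 V 0%N -> U = V.
Proof.
move=> hU hV /funext h; apply/funext => j.
by rewrite -(derive1n_jet j hU) -(derive1n_jet j hV) h.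
Qed.

Lemma ddx2_gpoly k p : iter k (ddx 2) (gjet (pjet p)) = gjet (pjet p^`(k)).
Proof.
elim: k => [|k IH]; first by rewrite derivn0.
rewrite iterS IH; apply: jet_eq; [apply: jet_ddx| |].
- by apply: jet_gjet; exact: jet_pjet.
- by apply: jet_gjet; exact: jet_pjet.
- by move=> x; rewrite ddx2_gjet /gjet /pjet /= ?derivn1 ?derivn0 -derivnS.
Qed.

Lemma iter_ddx_lin s k c d U V :
  iter k (ddx s) (jlin c d U V) = jlin c d (iter k (ddx s) U) (iter k (ddx s) V).
Proof.
elim: k => //= k ->; apply/funext => l; apply/funext => x.
by rewrite /ddx /jlin /jshift /xmul /=; ring.
Qed.

Lemma size_derivn_sub n k p : (size p <= n)%N -> (size p^`(k) <= n - k)%N.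
Proof.
move=> sp; apply/leq_sizeP => j; rewrite leq_subLR => nj.
by rewrite coef_derivn nth_default ?mul0rn // (leq_trans sp).
Qed.

(** Pythagoras: [A^k r] is [A^k U] minus [e^(-x^2) p^(k)], and it is orthogonal to the latter, since
    it keeps [n - k] orders of orthogonality while [p^(k)] has size at most [n - k]. *)
Lemma proj_residual n k U p : sjet U -> (size p <= n)%N -> (k <= n)%N ->
  let r := jlin 1 (-1) U (gjet (pjet p)) in gorth n r ->
  ip (iter k (ddx 2) r) (iter k (ddx 2) r) <= ip (iter k (ddx 2) U) (iter k (ddx 2) U).
Proof.
move=> hU sp kn r hr; have hp := sjet_gpoly p.
have sr : sjet r by exact: sjet_lin.
set A := iter k (ddx 2) U; set G := gjet (pjet p^`(k)).
set rho := iter k (ddx 2) r; have srho : sjet rho by exact: sjet_iter_ddx.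
have sG : sjet G by exact: sjet_gpoly.
have sA : sjet A by exact: sjet_iter_ddx.
have rG : ip rho G = 0.
  have : gorth (n - k) rho by apply: gorth_iter_ddx => //; rewrite subnK.
  by apply; exact: size_derivn_sub.
have rE : rho = jlin 1 (-1) A G by rewrite /rho /r iter_ddx_lin ddx2_gpoly.
have AE x : A 0%N x = jlin 1 1 rho G 0%N x by rewrite rE /jlin; ring.
rewrite [leRHS](eq_ip _ AE) ipC [leRHS](eq_ip _ AE).
have sl : sjet (jlin 1 1 rho G) by exact: sjet_lin.
rewrite [leRHS]ip_lin // (ipC _ rho) (ipC _ G) !ip_lin // rG (ipC G) rG.
by have := ip_ge0 G; lra.
Qed.

Definition expsq (x : R) : R := expR (x ^+ 2).

Lemma expsq_gauss x : expsq x * gauss x = 1.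
Proof. by rewrite /expsq /gauss -expRD subrr expR0. Qed.

Lemma continuous_expsq : continuous expsq.
Proof. by move=> x; apply: continuous_comp; [exact: exprn_continuous|exact: continuous_expR]. Qed.

Lemma wE_expsq U V : wE 2 (fun x => (expsq x * U 0%N x) * (expsq x * V 0%N x)) = ip U V.
Proof.
apply: eq_Rintegral => x _; rewrite Wt2.
have -> : expsq x * U 0%N x * (expsq x * V 0%N x) * gauss x ^+ 2 =
  (expsq x * gauss x) ^+ 2 * (U 0%N x * V 0%N x) by ring.
by rewrite expsq_gauss expr1n mul1r.
Qed.

Lemma rL2_expsq U : sjet U -> rL2 2 (fun x => expsq x * U 0%N x).
Proof.
move=> hU; split.
  apply: continuous_measurable_fun => x; apply: cvgM; first exact: continuous_expsq.
  exact: (jet_continuous (j := 0%N) hU.1).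
have h := ri_prod 0 0 hU hU; rewrite /wint (_ : (fun x => _) = (fun x => U 0%N x * U 0%N x)) //.
apply/funext => x; rewrite Wt2.
have -> : (expsq x * U 0%N x) ^+ 2 * gauss x ^+ 2 =
  (expsq x * gauss x) ^+ 2 * (U 0%N x * U 0%N x) by ring.
by rewrite expsq_gauss expr1n mul1r.
Qed.

(** For [n >= 2 k], [n <= 2 (n - k)] and the iterated gap applies to the residual; the second
    summand covers smaller [n], where [n^k <= (2 k)^k]. *)
Lemma proj_decay k n U p : sjet U -> isproj 2 n (fun x => expsq x * U 0%N x) p ->
  n%:R ^+ k * wE 2 (fun x => (expsq x * U 0%N x - p.[x]) ^+ 2) <=
  2 ^+ k * ip (iter k (ddx 2) U) (iter k (ddx 2) U) + (2 * k)%:R ^+ k * ip U U.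
Proof.
move=> hU [sp hp]; set r := jlin 1 (-1) U (gjet (pjet p)).
have sr : sjet r by apply: sjet_lin => //; exact: sjet_gpoly.
have gE q x : gjet (pjet q) 0%N x = gauss x * q.[x] by rewrite /gjet /pjet /= ?derivn0.
have rE x : expsq x * r 0%N x = expsq x * U 0%N x - p.[x].
  rewrite /r /jlin gE mulrDr mul1r mulN1r mulrN mulrA expsq_gauss mul1r //.
have pE q x : q.[x] = expsq x * gjet (pjet q) 0%N x by rewrite gE mulrA expsq_gauss mul1r.
have or : gorth n r.
  move=> q sq; rewrite -wE_expsq -(hp q sq); congr (wE 2 _); apply/funext => x.
  by rewrite rE -pE.
have -> : wE 2 (fun x => (expsq x * U 0%N x - p.[x]) ^+ 2) = ip r r.
  by rewrite -wE_expsq; congr (wE 2 _); apply/funext => x; rewrite rE expr2.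
have r0 := ip_ge0 r; have U0 := ip_ge0 U; have K0 := ip_ge0 (iter k (ddx 2) U).
have [nk|kn] := ltnP n (2 * k).
  have h0 : ip r r <= ip U U := proj_residual (k := 0) hU sp (leq0n n) or.
  apply: (@le_trans _ _ ((2 * k)%:R ^+ k * ip U U)).
    apply: ler_pM; [exact: exprn_ge0|exact: r0| |exact: h0].
    by rewrite lerXn2r ?nnegrE // ler_nat ltnW.
  by rewrite lerDr mulr_ge0 // exprn_ge0.
have kn' : (k <= n)%N by lia.
apply: (@le_trans _ _ (2 ^+ k * ip (iter k (ddx 2) U) (iter k (ddx 2) U))); last first.
  by rewrite lerDl mulr_ge0 // exprn_ge0.
have or' : gorth ((n - k) + k) r by rewrite subnK.
apply: (@le_trans _ _ (2 ^+ k * ((n - k)%:R ^+ k * ip r r))).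
  rewrite mulrA -exprMn ler_wpM2r // lerXn2r ?nnegrE ?mulr_ge0 //.
  by rewrite -natrM ler_nat; lia.
rewrite ler_wpM2l ?exprn_ge0 //; apply: le_trans (spectral_gap_iter sr or') _.
exact: (proj_residual hU sp kn' or).
Qed.

Lemma ip_ddx_bound k : exists (N : nat) (C : R), 0 <= C /\
  forall U (K : R), sjet U -> 0 <= K ->
  (forall m l, (m < N)%N -> (l < N)%N -> forall x, `|x| ^+ m * `|U l x| <= K) ->
  ip (iter k (ddx 2) U) (iter k (ddx 2) U) <= C * K ^+ 2.
Proof.
have [N0 [C0 [C00 h0]]] := ddx_bound (2 : R) k 0 0.
have [N2 [C2 [C20 h2]]] := ddx_bound (2 : R) k 2 0.
exists (maxn N0 N2), ((C0 + C2) * C0 * pi); split.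
  by apply: mulr_ge0; [nneg|exact: pi_ge0].
move=> U K hU K0 hK; set Z := iter k (ddx 2) U.
have sZ : sjet Z by exact: sjet_iter_ddx.
have b0 x : `|Z 0%N x| <= C0 * K.
  have := h0 U (fun=> 1) K (fun=> ler01) K0; rewrite -/Z => /(_ _ x).
  rewrite expr0 !mul1r; apply => m l hm hl y; rewrite mul1r.
  by apply: hK; rewrite leq_max ?hm ?hl.
have b2 x : `|x| ^+ 2 * `|Z 0%N x| <= C2 * K.
  have := h2 U (fun=> 1) K (fun=> ler01) K0; rewrite -/Z => /(_ _ x).
  rewrite mul1r; apply => m l hm hl y; rewrite mul1r.
  by apply: hK; rewrite leq_max ?hm ?hl orbT.
have -> : (C0 + C2) * C0 * pi * K ^+ 2 = (C0 + C2) * K * (C0 * K) * pi by ring.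
apply: Rintegral_dom.
  by apply: measurable_funM; apply: measurable_jet; case: sZ.
move=> x; rewrite ler_pdivlMr ?oneDsqr_gt0 // normrM mulrAC.
apply: ler_pM => //; first by rewrite mulr_ge0 // ltW // oneDsqr_gt0.
by have := b0 x; have := b2 x; rewrite real_normK ?num_real //; lra.
Qed.

Lemma cabs_norm (z : (R * R)%type) : `|z.1| <= cabs z /\ `|z.2| <= cabs z.
Proof.
by split; rewrite /cabs -sqrtr_sqr ler_wsqrtr // /cabs2 ?lerDl ?lerDr sqr_ge0.
Qed.

Lemma cabs_le_norm (z : (R * R)%type) : cabs z <= `|z.1| + `|z.2|.
Proof.
apply: cabs_le; first by rewrite addr_ge0.
rewrite /cabs2 -(real_normK (num_real z.1)) -(real_normK (num_real z.2)).
by have := normr_ge0 z.1; have := normr_ge0 z.2; nra.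
Qed.

Lemma schwartz_sjet (g : @cfun R) : schwartz g ->
  sjet (fun l x => (derive1n l g x).1) /\ sjet (fun l x => (derive1n l g x).2).
Proof.
move=> [sg hg]; have [j1 j2] := (jet_pairP _).1 (smooth_jet sg).
split; split => // m l; have [M hM] := hg m l; exists M => x; apply: le_trans (hM x);
  rewrite ler_wpM2l ?exprn_ge0 //; by have [] := cabs_norm (derive1n l g x).
Qed.

Lemma pS_ub (g : @cfun R) m l x : schwartz g -> `|x| ^+ m * cabs (derive1n l g x) <= pS m l g.
Proof.
move=> [_ /(_ m l)[M hM]]; apply: ub_le_sup; last by exists x.
by exists M => _ [y _ <-].
Qed.

Lemma pS_le (g : @cfun R) m l (K : R) :
  (forall x, `|x| ^+ m * cabs (derive1n l g x) <= K) -> pS m l g <= K.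
Proof.
move=> h; apply: ge_sup; last by move=> _ [x _ <-].
by exists (`|0 : R| ^+ m * cabs (derive1n l g 0)); exists 0.
Qed.

Lemma pS_ge0 (g : @cfun R) m l : schwartz g -> 0 <= pS m l g.
Proof.
move=> hg; apply: le_trans (pS_ub m l 0 hg).
by rewrite mulr_ge0 ?exprn_ge0 ?sqrtr_ge0.
Qed.

Lemma sum_pS_ge0 (g : @cfun R) N : schwartz g -> 0 <= \sum_(m < N) \sum_(l < N) pS m l g.
Proof. by move=> hg; apply: sumr_ge0 => m _; apply: sumr_ge0 => l _; exact: pS_ge0. Qed.

Lemma pS_le_sum (g : @cfun R) N m l : schwartz g -> (m < N)%N -> (l < N)%N ->
  pS m l g <= \sum_(m < N) \sum_(l < N) pS m l g.
Proof.
move=> hg hm hl; rewrite (bigD1 (Ordinal hm)) //= (bigD1 (Ordinal hl)) //= -!addrA lerDl addr_ge0 //.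
  by apply: sumr_ge0 => i _; exact: pS_ge0.
by apply: sumr_ge0 => i _; apply: sumr_ge0 => j _; exact: pS_ge0.
Qed.

Definition gauss_lift (g : @cfun R) : @cfun R :=
  fun x => (expR (x ^+ 2) * (g x).1, expR (x ^+ 2) * (g x).2).

Lemma inL2_gauss_lift (g : @cfun R) : schwartz g -> inL2 2 (gauss_lift g).
Proof.
move=> /schwartz_sjet[h1 h2]; apply/inL2P; split.
  exact: (rL2_expsq h1).
exact: (rL2_expsq h2).
Qed.

Lemma schwartz_distPi k : exists (N : nat) (C : R), forall g : @cfun R, schwartz g ->
  forall n, n%:R ^+ k * distPi 2 (gauss_lift g) n <= C * \sum_(m < N) \sum_(l < N) pS m l g.
Proof.
(* The gap concerns squared norms, so decay of order [k] takes [2 k] applications of [ddx 2]; the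
   leading [2] in [D] accounts for the two components. *)
have [N1 [C1 [C10 h1]]] := ip_ddx_bound (2 * k); have [N0 [C0 [C00 h0]]] := ip_ddx_bound 0.
set N := maxn N1 N0.
set D := 2 * (2 ^+ (2 * k) * C1 + (2 * (2 * k))%:R ^+ (2 * k) * C0).
have D0 : 0 <= D by rewrite /D; nneg.
exists N, (Num.sqrt D) => g hg n; set K := \sum_(m < N) _.
have K0 : 0 <= K by exact: sum_pS_ge0.
have [s1 s2] := schwartz_sjet hg.
have hK m l x : (m < N)%N -> (l < N)%N -> `|x| ^+ m * cabs (derive1n l g x) <= K.
  by move=> hm hl; apply: le_trans (pS_ub m l x hg) _; exact: pS_le_sum.
have hp := inL2_gauss_lift hg.
have [r1 r2] := (inL2P 2 _).1 hp.
have [p pp] := exists_proj one_lt2 n r1; have [q qq] := exists_proj one_lt2 n r2.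
rewrite (distPi_proj one_lt2 hp pp qq).
have part U (e : {poly R}) : sjet U -> isproj 2 n (fun x => expsq x * U 0%N x) e ->
    (forall l x, `|U l x| <= cabs (derive1n l g x)) ->
    n%:R ^+ (2 * k) * wE 2 (fun x => (expsq x * U 0%N x - e.[x]) ^+ 2) <= D / 2 * K ^+ 2.
  move=> hU pe hUg; apply: (le_trans (proj_decay (2 * k) hU pe)).
  have hKU m l : (m < N)%N -> (l < N)%N -> forall x, `|x| ^+ m * `|U l x| <= K.
    move=> hm hl x; apply: le_trans (hK m l x hm hl).
    by apply: ler_wpM2l; [exact: exprn_ge0|exact: hUg].
  have g1 := h1 U K hU K0 (fun m l hm hl => hKU m l (leq_trans hm (leq_maxl _ _)) (leq_trans hl (leq_maxl _ _))).
  have g0 := h0 U K hU K0 (fun m l hm hl => hKU m l (leq_trans hm (leq_maxr _ _)) (leq_trans hl (leq_maxr _ _))).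
  have -> : D / 2 * K ^+ 2 = 2 ^+ (2 * k) * (C1 * K ^+ 2) + (2 * (2 * k))%:R ^+ (2 * k) * (C0 * K ^+ 2).
    by rewrite /D; field.
  by apply: lerD; apply: ler_wpM2l => //; exact: exprn_ge0.
apply: le_trans (ler_norm _) _; apply: norm_le_sqr; first by rewrite mulr_ge0 ?sqrtr_ge0.
have hc : inL2 2 (csub (gauss_lift g) (cpoly p q)) by apply: inL2B => //; exact: (inL2_cpoly one_lt2).
rewrite [leLHS]exprMn [leRHS]exprMn -exprM mulnC [Num.sqrt D ^+ 2]sqr_sqrtr // wnorm_sqr // mulrDr.
have e1 := part _ p s1 pp (fun l x => (cabs_norm (derive1n l g x)).1).
have e2 := part _ q s2 qq (fun l x => (cabs_norm (derive1n l g x)).2).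
have -> : D * K ^+ 2 = D / 2 * K ^+ 2 + D / 2 * K ^+ 2 by field.
exact: lerD.
Qed.

Lemma cmeasurable_csub_cpoly (u : @cfun R) p q : cmeasurable u -> cmeasurable (csub u (cpoly p q)).
Proof. by move=> [? ?]; split; apply: measurable_funB => //; exact: measurable_horner. Qed.

Lemma distPi_ae (a : R) (u v : @cfun R) n : cmeasurable u -> cmeasurable v ->
  u = v %[ae mu] -> distPi a u n = distPi a v n.
Proof.
move=> mu_ mv uv.
have E p q : wnorm a (csub u (cpoly p q)) = wnorm a (csub v (cpoly p q)).
  congr (Num.sqrt (fine _)); apply: wint2_ae; try exact: cmeasurable_csub_cpoly.
  by apply: aeS uv => x h _; rewrite /csub h.
apply/eqP; rewrite eq_le; apply/andP; split; apply: le_distPi => p q sp sq.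
  by rewrite -E; exact: distPi_le.
by rewrite E; exact: distPi_le.
Qed.

Lemma schwartz_inLra (f g : @cfun R) : cmeasurable f -> schwartz g ->
  f = gauss_lift g %[ae mu] -> inLra 2 f.
Proof.
move=> mf hg fg; have hl := inL2_gauss_lift hg; split.
  by split => //; rewrite (wint2_ae 2 mf hl.1 fg); case: hl.
move=> k; have [N [C h]] := schwartz_distPi k.
apply: (proj1 (@qra_le _ _ _ k (C * \sum_(m < N) \sum_(l < N) pS m l g) _)) => n.
by rewrite (distPi_ae 2 n mf hl.1 fg); exact: h.
Qed.

Lemma qra_le_schwartz k : exists (N : nat) (C : R), forall f g : @cfun R,
  inLra 2 f -> schwartz g -> f = gauss_lift g %[ae mu] ->
  qra 2 k f <= C * \sum_(m < N) \sum_(l < N) pS m l g.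
Proof.
have [N [C h]] := schwartz_distPi k; exists N, C => f g hf hg fg.
apply: (proj2 (@qra_le _ _ _ k _ _)) => n.
by rewrite (distPi_ae 2 n hf.1.1 (inL2_gauss_lift hg).1 fg); exact: h.
Qed.

Lemma gauss_kap m (c : R) : gauss c * `|c| ^+ m <= kap 2 m c.
Proof.
rewrite /kap Wt2 mulrC ler_wpM2r ?(ltW (gauss_gt0 _)) //.
rewrite -[leLHS](ger0_norm (exprn_ge0 m (normr_ge0 c))) -sqrtr_sqr ler_wsqrtr //.
rewrite -exprM mulnC exprM; apply: lerXn2r; rewrite ?nnegrE ?sqr_ge0 ?(ltW (oneDsqr_gt0 _)) //.
by rewrite real_normK ?num_real // lerDr.
Qed.

(** Finitely many pairs [(m, l)] have their own index and constant in [Lra_pointwise]; the maximum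
    of the indices and the sum of the doubled constants serve them all. *)
Lemma gauss_moments N : exists (k : nat) (A : R), 0 <= A /\ forall f v : @cfun R,
  inLra 2 f -> inCinf 2 v -> v = f %[ae mu] ->
  forall m l, (m < N)%N -> (l < N)%N -> forall c,
  gauss c * (`|c| ^+ m * `|(derive1n l v c).1|) <= A * \sum_(i < k) qra 2 i f /\
  gauss c * (`|c| ^+ m * `|(derive1n l v c).2|) <= A * \sum_(i < k) qra 2 i f.
Proof.
have h m l := Lra_pointwise (@one_lt2 R) m l.
have [A hA] := choice (fun ml : nat * nat => h ml.1 ml.2).
have [k hk] := choice hA.
exists (\max_(m < N) \max_(l < N) k (m : nat, l : nat)).+1,
  (\sum_(m < N) \sum_(l < N) (2 * A (m : nat, l : nat))).
have A0 ml : 0 <= A ml by have [] := hk ml.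
split; first by apply: sumr_ge0 => m _; apply: sumr_ge0 => l _; exact: mulr_ge0.
move=> f v hf hv vf m l hm hl c; set k0 := (\max_(m < N) _).+1; set A1 := \sum_(m < N) _.
have [_ /(_ f v hf hv vf c)[b1 b2]] := hk (m, l).
have kk : (k (m, l) < k0)%N.
  rewrite ltnS; apply: leq_trans (leq_bigmax_cond (Ordinal hm) isT).
  exact: (leq_bigmax_cond (F := fun l : 'I_N => k (m, l : nat)) (Ordinal hl) isT).
have AA : 2 * A (m, l) <= A1.
  rewrite /A1 (bigD1 (Ordinal hm)) //= (bigD1 (Ordinal hl)) //= -!addrA lerDl addr_ge0 //.
    by apply: sumr_ge0 => i _; exact: mulr_ge0.
  by apply: sumr_ge0 => i _; apply: sumr_ge0 => j _; exact: mulr_ge0.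
have S0 := sum_qra_ge0 k0 hf.
have hS : A (m, l) * (qra 2 0 f + qra 2 (k (m, l)) f) <= A1 * \sum_(i < k0) qra 2 i f.
  have h0 := qra_le_sum hf (ltn0Sn _ : (0 < k0)%N); have h1 := qra_le_sum hf kk.
  apply: (@le_trans _ _ (2 * A (m, l) * \sum_(i < k0) qra 2 i f)); last exact: ler_wpM2r.
  rewrite [2 * _]mulrC -mulrA ler_wpM2l //; lra.
have fin (y : R) : `|kap 2 m c * y| <= A (m, l) * (qra 2 0 f + qra 2 (k (m, l)) f) ->
    gauss c * (`|c| ^+ m * `|y|) <= A1 * \sum_(i < k0) qra 2 i f.
  move=> hy; apply: le_trans hS; apply: le_trans hy.
  by rewrite normrM (gtr0_norm (kap_gt0 2 m c)) mulrA ler_wpM2r // gauss_kap.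
by split; exact: fin.
Qed.

Definition gauss_drop (v : @cfun R) : @cfun R := fun x => (gauss x * (v x).1, gauss x * (v x).2).

Lemma gauss_dropK (v : @cfun R) : gauss_lift (gauss_drop v) = v.
Proof.
apply/funext => x; rewrite /gauss_lift /gauss_drop /= !mulrA -/(expsq x) expsq_gauss !mul1r.
by case: (v x).
Qed.

Lemma gauss_liftK (g : @cfun R) : gauss_drop (gauss_lift g) = g.
Proof.
apply/funext => x; rewrite /gauss_lift /gauss_drop /= !mulrA -/(expsq x).
by rewrite [gauss x * _]mulrC expsq_gauss !mul1r; case: (g x).
Qed.

Lemma gauss_drop_jet (v : @cfun R) : smooth v ->
  jet (fun l x => (gjet (fun l x => (derive1n l v x).1) l x,
                   gjet (fun l x => (derive1n l v x).2) l x)).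
Proof.
move=> /smooth_jet/jet_pairP[j1 j2].
by apply/jet_pairP; split; exact: jet_gjet.
Qed.

(** Derivatives of [e^(-x^2) v] are [e^(-x^2)] times powers of [d/dx - 2 x] applied to [v], so
    [ddx_bound] with the weight [gauss] reduces them to [gauss_moments]. *)
Lemma gauss_drop_bound m l : exists (k : nat) (C : R), forall f v : @cfun R,
  inLra 2 f -> inCinf 2 v -> v = f %[ae mu] ->
  forall x, `|x| ^+ m * cabs (derive1n l (gauss_drop v) x) <= C * \sum_(i < k) qra 2 i f.
Proof.
have [N [C [C0 h]]] := ddx_bound (-2 : R) l m 0; have [k [A [A0 hA]]] := gauss_moments N.
exists k, (2 * (C * A)) => f v hf hv vf x.
have -> : derive1n l (gauss_drop v) x = (gjet (fun l x => (derive1n l v x).1) l x,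
                   gjet (fun l x => (derive1n l v x).2) l x).
  by have := derive1n_jet l (gauss_drop_jet hv.1) => ->.
set K := \sum_(i < k) _; have K0 : 0 <= K by exact: sum_qra_ge0.
have g0 (y : R) : 0 <= gauss y by exact: ltW (gauss_gt0 y).
have AK0 : 0 <= A * K by exact: mulr_ge0.
have part V : (forall m' l', (m' < N)%N -> (l' < N)%N ->
     forall y, gauss y * (`|y| ^+ m' * `|V l' y|) <= A * K) ->
    `|x| ^+ m * `|gjet V l x| <= C * (A * K).
  move=> hV; have := h V (@gauss R) (A * K) g0 AK0 hV x.
  by rewrite /gjet normrM (gtr0_norm (gauss_gt0 x)) mulrCA.
apply: (@le_trans _ _ (`|x| ^+ m * (`|gjet (fun l x => (derive1n l v x).1) l x| +
   `|gjet (fun l x => (derive1n l v x).2) l x|))).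
  by apply: ler_wpM2l; [exact: exprn_ge0|exact: cabs_le_norm].
have -> : 2 * (C * A) * K = C * (A * K) + C * (A * K) by ring.
rewrite mulrDr; apply: lerD; apply: part => m' l' hm hl y.
  exact: (hA f v hf hv vf m' l' hm hl y).1.
exact: (hA f v hf hv vf m' l' hm hl y).2.
Qed.

Lemma schwartz_gauss_drop (f v : @cfun R) : inLra 2 f -> inCinf 2 v -> v = f %[ae mu] ->
  schwartz (gauss_drop v).
Proof.
move=> hf hv vf; split.
  exact: (jet_smooth (gauss_drop_jet hv.1)).
move=> m l; have [k [C h]] := gauss_drop_bound m l.
by exists (C * \sum_(i < k) qra 2 i f) => x; exact: h.
Qed.

Lemma Lra_schwartz (f : @cfun R) : inLra 2 f ->
  exists g, schwartz g /\ f = gauss_lift g %[ae mu].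
Proof.
move=> hf; have [v [hv vf]] := Lra_sub_Cinf one_lt2 hf.
exists (gauss_drop v); split; first exact: schwartz_gauss_drop vf.
by rewrite gauss_dropK; apply: aeS vf => x h _; rewrite h.
Qed.

Lemma pS_le_qra m l : exists (k : nat) (C : R), forall f g : @cfun R,
  inLra 2 f -> schwartz g -> f = gauss_lift g %[ae mu] ->
  pS m l g <= C * \sum_(i < k) qra 2 i f.
Proof.
have [k [C h]] := gauss_drop_bound m l; exists k, C => f g hf hg fg.
have [v [hv vf]] := Lra_sub_Cinf one_lt2 hf.
(* Both are smooth and agree almost everywhere, so the bound for the representative [v] reaches the
   given [g]. *)
have <- : gauss_drop v = g.
  apply: smooth_ae_eq; [exact: (schwartz_gauss_drop hf hv vf).1|exact: hg.1|].
  apply: aeS2 fg vf => x h1 h2 _; rewrite -[in RHS](gauss_liftK g) /gauss_drop.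
  by rewrite -h1 // h2.
by apply: pS_le; exact: h.
Qed.

End Hermite.

Theorem theorem1p5 (R : realType) (a : R) (ha : 1 < a) :
  (* (i) C^infty_alpha is a Frechet space (Hausdorff + complete for its
     countable family of seminorms), and convergence implies uniform
     convergence of all derivatives on compacts *)
  ((forall f : cfun, inCinf a f -> (forall j, qC a j f = 0) -> f = (fun=> 0)) /\
   (forall fs : nat -> cfun, (forall n, inCinf a (fs n)) -> cauchy_in (qC a) fs ->
      exists f, inCinf a f /\ conv_in (qC a) fs f) /\
   (forall (fs : nat -> cfun) (f : cfun), (forall n, inCinf a (fs n)) -> inCinf a f ->
      conv_in (qC a) fs f ->
      forall j, ucc (fun n => derive1n j (fs n)) (derive1n j f))) /\
  (* (ii) L_2(W_alpha^2)_ra is contained in C^infty_alpha, continuously *)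
  ((forall f : cfun, inLra a f ->
      exists g, inCinf a g /\ g = f %[ae (@lebesgue_measure R)]) /\
   (forall j : nat, exists (k : nat) (C : R), forall f g : cfun,
      inLra a f -> inCinf a g -> g = f %[ae (@lebesgue_measure R)] ->
      qC a j g <= C * \sum_(i < k) qra a i f) /\
   (forall (fs gs : nat -> cfun) (f g : cfun),
      (forall n, inLra a (fs n)) -> inLra a f ->
      (forall n, inCinf a (gs n)) -> inCinf a g ->
      (forall n, gs n = fs n %[ae (@lebesgue_measure R)]) ->
      g = f %[ae (@lebesgue_measure R)] ->
      conv_in (qra a) fs f ->
      forall j, ucc (fun n => derive1n j (gs n)) (derive1n j g))) /\
  (* (iii) orthonormal polynomial expansion converges in L_ra, and the
     differentiated series converge uniformly on compacts *)
  (forall P : nat -> {poly R},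
      (forall n, size (P n) = n.+1) ->
      (forall m n, fine (\int[@lebesgue_measure R]_x
                          ((P m).[x] * (P n).[x] * Wt a x ^+ 2)%:E)%E = (m == n)%:R) ->
      forall f : cfun, inLra a f ->
        conv_in (qra a)
          (fun N x => \sum_(n < N) ((P n).[x] * (acoef a (P n) f).1,
                                    (P n).[x] * (acoef a (P n) f).2)) f /\
        (forall g : cfun, inCinf a g -> g = f %[ae (@lebesgue_measure R)] ->
          forall j : nat,
            ucc (fun N x => \sum_(n < N) ((derivn j (P n)).[x] * (acoef a (P n) f).1,
                                          (derivn j (P n)).[x] * (acoef a (P n) f).2))
                (derive1n j g))) /\
  (* (iv) the Hermite case alpha = 2 *)
  (a = 2 ->
    (forall f : cfun, cmeasurable f ->
       (inLra a f <-> (exists g, schwartz g /\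
          f = (fun x => (expR (x ^+ 2) * (g x).1, expR (x ^+ 2) * (g x).2))
              %[ae (@lebesgue_measure R)]))) /\
    (forall m l : nat, exists (k : nat) (C : R), forall f g : cfun,
       inLra a f -> schwartz g ->
       f = (fun x => (expR (x ^+ 2) * (g x).1, expR (x ^+ 2) * (g x).2))
           %[ae (@lebesgue_measure R)] ->
       pS m l g <= C * \sum_(i < k) qra a i f) /\
    (forall k : nat, exists (N : nat) (C : R), forall f g : cfun,
       inLra a f -> schwartz g ->
       f = (fun x => (expR (x ^+ 2) * (g x).1, expR (x ^+ 2) * (g x).2))
           %[ae (@lebesgue_measure R)] ->
       qra a k f <= C * \sum_(m < N) \sum_(l < N) pS m l g)).
Proof.
split; [|split; [|split]].
- split; [|split].
  + exact: Cinf_separated.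
  + exact: Cinf_complete.
  + exact: Cinf_cvg_ucc.
- split; [|split].
  + exact: Lra_sub_Cinf.
  + exact: Lra_Cinf_continuous.
  + move=> fs gs f g hfs hf hgs hg gsfs gf hc.
    exact: Cinf_cvg_ucc (Lra_cvg_Cinf ha hfs hf hgs hg gsfs gf hc).
- move=> P sP oP f hf; split.
  + have := expansion_cvg ha sP oP hf.
    (* The expansion itself is order [0] of the differentiated identity. *)
    by rewrite -[X in conv_in _ X](expansion_partial a P f 0).
  + by move=> g hg gf j; rewrite (expansion_partial a P f j); exact: expansion_ucc.
- move=> a2; move: ha; rewrite a2 => ha2; split; [|split].
  + move=> f mf; split; first exact: Lra_schwartz.
    by move=> [g [hg fg]]; exact: (schwartz_inLra mf hg fg).
  + exact: pS_le_qra.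
  + exact: qra_le_schwartz.
Qed.
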